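(* Let $\mathcal{M}\in\{\mathcal{M}_B^2,\mathcal{M}_D^2\}$, where $\mathcal{M}_B^2$ and $\mathcal{M}_D^2$ are the countable relational structures defined in the context. Then: (1) $\mathcal{M}$ is not monadically NIP. (2) The sequence $(f_k(\mathrm{Aut}(\mathcal{M})))_k$ has super-exponential growth rate. (3) $\mathrm{Age}(\mathcal{M})$ is not well-quasi-ordered under embeddability.
   Context: **General notions.** A structure is *monadically NIP* if every expansion of it by unary predicates is NIP. For an oligomorphic permutation group $G$ on $\Omega$, $f_k(G)$ is the number of orbits of $G$ on unordered $k$-subsets of $\Omega$; $(f_k(G))$ has *super-exponential growth* if for every $c>1$ there is $K\in\mathbb{N}$ such that $f_k(G)>c^k$ for all $k>K$. The *age* $\mathrm{Age}(M)$ of a relational structure $M$ is the class of finite structures that embed in $M$; it is well-quasi-ordered (wqo) under embeddability if it has no infinite antichain (and no infinite strictly descending chain). **Finite trees of $B$-sets and $\mathcal{M}_B^1$.** Let $A$ be a finite nonempty set. A *tree of $B$-sets* on $A$ consists of a finite rooted tree $\tau$ (ordered by $\leq$ with the root least) and, for each vertex $\mu$ of $\tau$, a subset $X_\mu\subseteq A$, an equivalence relation $\sim_\mu$ on $X_\mu$, and a graph-theoretic tree $T_\mu$ with vertex set $X_\mu/{\sim_\mu}$, such that: (i) for the root $\rho$, $X_\rho=A$ and $\sim_\rho$ is equality; (ii) for each $\mu$, the immediate successors of $\mu$ in $\tau$ are in bijection with the vertices $v$ of $T_\mu$ at which there are at least three branches (a branch at $v$ is a connected component of $T_\mu\setminus\{v\}$);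 (iii) if $\nu$ is the successor of $\mu$ corresponding to $v$, then $X_\nu=X_\mu\setminus v$ (with $v$ viewed as a $\sim_\mu$-class), and $x\sim_\nu y$ iff $x/{\sim_\mu}$ and $y/{\sim_\mu}$ lie in the same branch at $v$. Let $\mathcal{L}_B^1$ be the language with a ternary relation symbol $L$ and 4-ary symbols $L',N,S$. A tree of $B$-sets makes $A$ an $\mathcal{L}_B^1$-structure: $L(x;y,z)$ holds, *witnessed* at $\mu$, if $x,y,z\in X_\mu$ are pairwise $\sim_\mu$-inequivalent and $x/{\sim_\mu}$ lies on the path in $T_\mu$ from $y/{\sim_\mu}$ to $z/{\sim_\mu}$; $L'(x;y,z;w)$ holds if $L(x;y,z)$ is witnessed at some $\mu$ with $w\notin X_\mu$; $N(x,y;z,w)$ holds, witnessed at $\mu$, if there is $u\in X_\mu$ with $x,y,z,w,u\in X_\mu$ pairwise $\sim_\mu$-inequivalent such that in $T_\mu$ (modulo $\sim_\mu$) $u$ lies on each of the three paths between pairs of $x,y,z$, and $z$ lies on the path from $u$ to $w$; $S(x,y;z,w)$ holds, witnessed at $\mu$, if there are $u,v\in X_\mu$ with $x,y,z,w,u,v\in X_\mu$ pairwise $\sim_\mu$-inequivalent such that in $T_\mu$ (modulo $\sim_\mu$) $x,y,v$ lie in three distinct branches at $u$, and $z,w,u$ lie in three distinct branches at $v$. Let $\mathcal{B}$ be the class of all finite $\mathcal{L}_B^1$-structures isomorphic to one arising in this way (the tree of $B$-sets, with its levels carrying relations, is determined by the structure). $\mathcal{M}_B^1$ is the Fraïssé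 limit of $\mathcal{B}$: the countably infinite $\mathcal{L}_B^1$-structure, unique up to isomorphism, such that every finite subset is contained in a finite substructure belonging to $\mathcal{B}$; every member of $\mathcal{B}$ embeds in it; and every isomorphism between finite substructures belonging to $\mathcal{B}$ extends to an automorphism. **The structure $\mathcal{M}_B^2$.** It has the same domain as $\mathcal{M}_B^1$, and its language $\mathcal{L}_B^2$ has the symbols $L,N,S$, interpreted as in $\mathcal{M}_B^1$, and for each ordered pair $(\Phi,\Psi)$ with $\Phi,\Psi\in\{L,N,S\}$ a relation symbol $W_{\Phi,\Psi}(\bar x,\bar y)$ (arity the sum of the arities), holding iff there is a finite substructure $A\in\mathcal{B}$ of $\mathcal{M}_B^1$ containing $\bar x,\bar y$ such that in the tree of $B$-sets of $A$, $\Phi(\bar x)$ is witnessed at a vertex $\mu$, $\Psi(\bar y)$ is witnessed at a vertex $\nu$, and $\mu\leq\nu$. **Finite trees of $D$-sets and $\mathcal{M}_D^1$.** Let $A$ be a finite set with $|A|\ge 3$. A *tree of $D$-sets* on $A$ consists of a finite rooted tree $\tau$ (ordered with the root least) and, for each vertex $\mu$ of $\tau$, a subset $X_\mu\subseteq A$, an equivalence relation $\sim_\mu$ on $X_\mu$ with at least three classes, and a finite graph-theoretic tree $T_\mu$ with no vertex of degree 2 and with set of leaves $X_\mu/{\sim_\mu}$, together with, for each node (non-leaf vertex) $v$ of $T_\mu$, a choice of one branch at $v$, called the *special branch* at $v$ (a branch at $v$ is the set of leaves in a connected component of $T_\mu\setminus\{v\}$), such that: (i) for the root $\rho$, $X_\rho=A$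 and $\sim_\rho$ is equality; (ii) the immediate successors of $\mu$ in $\tau$ are in bijection with the nodes $v$ of $T_\mu$ having at least three non-special branches; (iii) if $\nu$ is the successor of $\mu$ corresponding to $v$, then $X_\nu$ is the set of $x\in X_\mu$ with $x/{\sim_\mu}$ not in the special branch at $v$, and $x\sim_\nu y$ iff $x/{\sim_\mu}$, $y/{\sim_\mu}$ lie in the same branch at $v$. For three distinct leaves $p,q,r$ of $T_\mu$, $\mathrm{ram}(p,q,r)$ is the unique node at which they lie in distinct branches. Let $\mathcal{L}_D^1$ be the language with relation symbols $L$ (arity 3), $L',S$ (arity 4), $S'$ (arity 5), $R$ (arity 6), $Q$ (arity 7). A tree of $D$-sets makes $A$ an $\mathcal{L}_D^1$-structure: $L(x;y,z)$ holds, *witnessed* at $\mu$, if $x,y,z\in X_\mu$ are pairwise $\sim_\mu$-inequivalent and $x/{\sim_\mu}$ lies in the special branch at $\mathrm{ram}(x/{\sim_\mu},y/{\sim_\mu},z/{\sim_\mu})$; $S(x,y;z,w)$ holds, witnessed at $\mu$, if $x,y,z,w\in X_\mu$ are pairwise $\sim_\mu$-inequivalent and the path in $T_\mu$ from $x/{\sim_\mu}$ to $y/{\sim_\mu}$ is disjoint from the path from $z/{\sim_\mu}$ to $w/{\sim_\mu}$; $L'(x;y,z;w)$ holds if $L(x;y,z)$ is witnessed at some $\mu$ with $w\notin X_\mu$; $S'(x,y;z,w;u)$ holds if $S(x,y;z,w)$ is witnessed at some $\mu$ with $u\notin X_\mu$; $R(x;y,z:u;v,w)$ holds if $L(x;y,z)$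 and $L(u;v,w)$ are witnessed at the same $\mu$; $Q(x,y;z,w:p;q,s)$ holds if $S(x,y;z,w)$ and $L(p;q,s)$ are witnessed at the same $\mu$. Let $\mathcal{D}$ be the class of all finite $\mathcal{L}_D^1$-structures isomorphic to one arising in this way (the tree of $D$-sets is determined by the structure). $\mathcal{M}_D^1$ is the Fraïssé limit of $\mathcal{D}$: the countably infinite $\mathcal{L}_D^1$-structure, unique up to isomorphism, such that every finite subset is contained in a finite substructure belonging to $\mathcal{D}$; every member of $\mathcal{D}$ embeds in it; and every isomorphism between finite substructures belonging to $\mathcal{D}$ extends to an automorphism. **The structure $\mathcal{M}_D^2$.** It has the same domain as $\mathcal{M}_D^1$, and its language $\mathcal{L}_D^2$ has symbols $L,S$, interpreted as in $\mathcal{M}_D^1$, and $P$ (arity 6), $Q^{\leq},Q^{\geq}$ (arity 7), $T$ (arity 8), interpreted as follows, where ''$\Phi$ is witnessed at $i$, $\Psi$ is witnessed at $j$ and $i\leq j$'' means that there is a finite substructure $A\in\mathcal{D}$ of $\mathcal{M}_D^1$ containing all the entries such that in its tree of $D$-sets $\Phi$ is witnessed at vertex $i$, $\Psi$ at vertex $j$, and $i\leq j$: $P(x;y,z:p;q,s)$ iff $L(x;y,z)$ is witnessed at $i$, $L(p;q,s)$ at $j$, and $i\leq j$; $T(x,y;z,w:p,q;s,t)$ iff $S(x,y;z,w)$ is witnessed at $i$, $S(p,q;s,t)$ at $j$, and $i\leq j$; $Q^{\leq}(x,y;z,w:p;q,s)$ (respectively $Q^{\geq}$) iff $S(x,y;z,w)$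 is witnessed at $i$, $L(p;q,s)$ at $j$, and $i\leq j$ (respectively $i\geq j$). *)

(* Defs.v *)
From HB Require Import structures.
From mathcomp Require Import all_boot all_order all_algebra.

Set Implicit Arguments.
Unset Strict Implicit.
Unset Printing Implicit Defensive.

Import Order.TTheory.

Section Graphs.
Variable U : finType.
Implicit Types (P D : {set U}) (e : rel U) (Bs : {set {set U}}) (a b c v : U).

Definition is_tree P e : Prop :=
  [/\ P != set0,
      symmetric e /\ irreflexive e,
      forall a b, e a b -> (a \in P) && (b \in P),
      {in P &, forall a b, connect e a b} &
      forall s : seq U, ucycle e s -> size s <= 2].

Definition degree e a : nat := #|[set b | e a b]|.

(* v lies on a simple path from a to b, endpoints included; in a tree there is
   exactly one such path. *)
Definition on_path e v a b : Prop :=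
  exists p : seq U,
    [/\ path e a p, last a p = b, uniq (a :: p) & v \in a :: p].

Definition components e D : {set {set U}} :=
  equivalence_partition (connect [rel a b | [&& e a b, a \in D & b \in D]]) D.

Definition branches P e v : {set {set U}} := components e (P :\ v).

Definition same_block Bs a b : bool :=
  [exists C in Bs, (a \in C) && (b \in C)].

Definition in_distinct_blocks Bs a b c : Prop :=
  exists C1 C2 C3 : {set U},
    [/\ [/\ C1 \in Bs, C2 \in Bs & C3 \in Bs],
        a \in C1, b \in C2, c \in C3 & uniq [:: C1; C2; C3]].

End Graphs.

(* The part of the data common to trees of B-sets and trees of D-sets.  Only the
   restriction of [lsim mu] to [lX mu] is meaningful. *)

Record levels (A : finType) := Levels {
  ldisp : Order.disp_t;
  ltau : finBPOrderType ldisp;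
  lX : ltau -> {set A};
  lsim : ltau -> rel A;
  ltau_tree : forall x y z : ltau, (x <= z -> y <= z -> x >=< y)%O;
  lsim_equiv : forall mu, {in lX mu & &, equivalence_rel (lsim mu)};
  lX_root : lX \bot%O = [set: A];
  lsim_root : forall x y, lsim \bot%O x y = (x == y)
}.

Section Levels.
Variables (A : finType) (t : levels A).
Implicit Types (mu nu : ltau t) (x y : A).

Definition immediate_succ mu nu : bool :=
  (mu < nu)%O && [forall ka : ltau t, ~~ (mu < ka < nu)%O].

Definition cls mu x : {set A} := [set y in lX mu | lsim mu x y].

Definition classes mu : {set {set A}} := equivalence_partition (lsim mu) (lX mu).

Definition inequivalent mu (s : seq A) : Prop :=
  all (mem (lX mu)) s && pairwise [rel x y | ~~ lsim mu x y] s.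

End Levels.

(* Trees of B-sets: T_mu is the graph on the set of classes with edge relation
   [Bedge mu], and [Bchild mu v] is the successor of mu attached to v; its value
   matters only when v is in [Bbig mu]. *)

Record Bdata (A : finType) := BData {
  Blevels :> levels A;
  Bedge : ltau Blevels -> rel {set A};
  Bchild : ltau Blevels -> {set A} -> ltau Blevels
}.

Section Bdata.
Variables (A : finType) (t : Bdata A).
Implicit Types (mu : ltau t) (v : {set A}).

Definition Bbranches mu v : {set {set {set A}}} :=
  branches (classes mu) (Bedge mu) v.

Definition Bbig mu : {set {set A}} :=
  [set v in classes mu | 3 <= #|Bbranches mu v|].

Record is_Btree : Prop := IsBTree {
  B_nonempty : 0 < #|A|;
  B_tree : forall mu, is_tree (classes mu) (Bedge mu);
  B_child_inj : forall mu, {in Bbig mu &, injective (Bchild mu)};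
  B_child_succ : forall mu,
    [set Bchild mu v | v in Bbig mu] = [set nu | immediate_succ mu nu];
  B_child_X : forall mu v, v \in Bbig mu -> lX (Bchild mu v) = lX mu :\: v;
  B_child_sim : forall mu v, v \in Bbig mu ->
    {in lX (Bchild mu v) &, forall x y,
      lsim (Bchild mu v) x y = same_block (Bbranches mu v) (cls mu x) (cls mu y)}
}.

End Bdata.

(* Trees of D-sets: the vertices of T_mu are the classes, which are its leaves,
   and the elements of the type [Dnode mu].  A branch at a node is a set of
   leaves. *)

Record Ddata (A : finType) := DData {
  Dlevels :> levels A;
  Dnode : ltau Dlevels -> finType;
  Dedge : forall mu, rel ({set A} + Dnode mu)%type;
  Dspecial : forall mu, Dnode mu -> {set {set A}};
  Dchild : forall mu, Dnode mu -> ltau Dlevels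
}.

Arguments Dedge {A d} mu.

Section Ddata.
Variables (A : finType) (t : Ddata A).
Implicit Types mu : ltau t.

Definition Dleaves mu : {set {set A} + Dnode mu} :=
  [set inl C | C in classes mu].

Definition Dverts mu : {set {set A} + Dnode mu} :=
  Dleaves mu :|: [set inr n | n in [set: Dnode mu]].

Definition Dbranches mu (n : Dnode mu) : {set {set {set A}}} :=
  [set [set K | inl K \in C] | C : {set {set A} + Dnode mu}
                               in branches (Dverts mu) (Dedge mu) (inr n)].

Definition Dbig mu : {set Dnode mu} :=
  [set n : Dnode mu | 3 <= #|Dbranches n :\ Dspecial n|].

Record is_Dtree : Prop := IsDTree {
  D_card : 3 <= #|A|;
  D_classes : forall mu, 3 <= #|classes mu|;
  D_tree : forall mu, is_tree (Dverts mu) (Dedge mu);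
  D_degree : forall mu, {in Dverts mu, forall a, degree (Dedge mu) a != 2};
  D_leaves : forall mu,
    [set a in Dverts mu | degree (Dedge mu) a == 1] = Dleaves mu;
  D_special : forall mu (n : Dnode mu), Dspecial n \in Dbranches n;
  D_child_inj : forall mu, {in Dbig mu &, injective (@Dchild A t mu)};
  D_child_succ : forall mu,
    [set Dchild n | n in Dbig mu] = [set nu | immediate_succ mu nu];
  D_child_X : forall mu (n : Dnode mu), n \in Dbig mu ->
    lX (Dchild n) = [set x in lX mu | cls mu x \notin Dspecial n];
  D_child_sim : forall mu (n : Dnode mu), n \in Dbig mu ->
    {in lX (Dchild n) &, forall x y,
      lsim (Dchild n) x y = same_block (Dbranches n) (cls mu x) (cls mu y)}
}.

End Ddata.

Record language := Language { symbol :> Type; arity : symbol -> nat }.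

Definition structure (L : language) (T : Type) :=
  forall s : L, (arity s).-tuple T -> Prop.

Definition embedding (L : language) (T U : Type)
    (M : structure L T) (N : structure L U) (f : T -> U) : Prop :=
  injective f /\ forall s (a : (arity s).-tuple T), M s a <-> N s (map_tuple f a).

Definition isomorphism (L : language) (T U : Type)
    (M : structure L T) (N : structure L U) (f : T -> U) : Prop :=
  bijective f /\ embedding M N f.

Definition isomorphic (L : language) (T U : Type)
    (M : structure L T) (N : structure L U) : Prop :=
  exists f : T -> U, isomorphism M N f.

(* In the interpretations below the arguments always have the length prescribed
   by the arity, so the [_ => False] cases do not occur. *)

Inductive Bsym := BL | BN | BS.

Definition Bsym_arity (s : Bsym) : nat :=
  match s with BL => 3 | BN => 4 | BS => 4 end.

Inductive B1sym := B1 (s : Bsym) | B1L'.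

Definition LB1 : language :=
  @Language B1sym (fun s => match s with B1 s => Bsym_arity s | B1L' => 4 end).

Inductive B2sym := B2 (s : Bsym) | B2W (s1 s2 : Bsym).

Definition LB2 : language :=
  @Language B2sym (fun s => match s with
                            | B2 s => Bsym_arity s
                            | B2W s1 s2 => Bsym_arity s1 + Bsym_arity s2
                            end).

Section Bstructure.
Variables (A : finType) (t : Bdata A).

Definition Bwitness (mu : ltau t) (s : Bsym) (args : seq A) : Prop :=
  let c := cls mu in
  let between u x y := on_path (Bedge mu) (c u) (c x) (c y) in
  let split u x y z := in_distinct_blocks (Bbranches mu (c u)) (c x) (c y) (c z) in
  match s, args with
  | BL, [:: x; y; z] => inequivalent mu [:: x; y; z] /\ between x y z
  | BN, [:: x; y; z; w] =>
      exists u, [/\ inequivalent mu [:: x; y; z; w; u],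
                    between u x y, between u y z, between u x z & between z u w]
  | BS, [:: x; y; z; w] =>
      exists u v, [/\ inequivalent mu [:: x; y; z; w; u; v],
                      split u x y v & split v z w u]
  | _, _ => False
  end.

Definition Brelation (s : B1sym) (args : seq A) : Prop :=
  match s, args with
  | B1 s, a => exists mu : ltau t, Bwitness mu s a
  | B1L', [:: x; y; z; w] =>
      exists mu : ltau t, Bwitness mu BL [:: x; y; z] /\ w \notin lX mu
  | _, _ => False
  end.

Definition Bstructure : structure LB1 A := fun s args => Brelation s args.

End Bstructure.

Definition classB (T : Type) (M : structure LB1 T) : Prop :=
  exists (A : finType) (t : Bdata A), is_Btree t /\ isomorphic (Bstructure t) M.

(* The substructure in the class is the image of f. *)
Definition Bprec (T : Type) (M : structure LB1 T) (s1 s2 : Bsym) (xs ys : seq T) :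
    Prop :=
  exists (A : finType) (t : Bdata A) (f : A -> T),
    [/\ is_Btree t, embedding (Bstructure t) M f &
        exists (mu nu : ltau t) (a b : seq A),
          [/\ xs = map f a, ys = map f b, Bwitness mu s1 a, Bwitness nu s2 b
            & (mu <= nu)%O]].

Definition MB2 (T : Type) (M : structure LB1 T) : structure LB2 T := fun s =>
  match s return (@arity LB2 s).-tuple T -> Prop with
  | B2 s => fun args => M (B1 s) args
  | B2W s1 s2 => fun args =>
      Bprec M s1 s2 (take (Bsym_arity s1) args) (drop (Bsym_arity s1) args)
  end.

Inductive Dsym := DL | DS.

Definition Dsym_arity (s : Dsym) : nat := match s with DL => 3 | DS => 4 end.

Inductive D1sym := D1 (s : Dsym) | D1L' | D1S' | D1R | D1Q.

Definition LD1 : language :=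
  @Language D1sym (fun s => match s with
                            | D1 s => Dsym_arity s
                            | D1L' => 4 | D1S' => 5 | D1R => 6 | D1Q => 7
                            end).

Inductive D2sym := D2 (s : Dsym) | D2P | D2Qle | D2Qge | D2T.

Definition LD2 : language :=
  @Language D2sym (fun s => match s with
                            | D2 s => Dsym_arity s
                            | D2P => 6 | D2Qle => 7 | D2Qge => 7 | D2T => 8
                            end).

Section Dstructure.
Variables (A : finType) (t : Ddata A).

Definition is_ram (mu : ltau t) (n : Dnode mu) (p q r : {set A}) : Prop :=
  in_distinct_blocks (Dbranches n) p q r.

Definition Dwitness (mu : ltau t) (s : Dsym) (args : seq A) : Prop :=
  let c := cls mu in
  let between a x y := on_path (Dedge mu) a (inl (c x)) (inl (c y)) in
  match s, args with
  | DL, [:: x; y; z] =>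
      inequivalent mu [:: x; y; z] /\
      exists n : Dnode mu, is_ram n (c x) (c y) (c z) /\ c x \in Dspecial n
  | DS, [:: x; y; z; w] =>
      inequivalent mu [:: x; y; z; w] /\ forall a, ~ (between a x y /\ between a z w)
  | _, _ => False
  end.

Definition Drelation (s : D1sym) (args : seq A) : Prop :=
  match s, args with
  | D1 s, a => exists mu : ltau t, Dwitness mu s a
  | D1L', [:: x; y; z; w] =>
      exists mu : ltau t, Dwitness mu DL [:: x; y; z] /\ w \notin lX mu
  | D1S', [:: x; y; z; w; u] =>
      exists mu : ltau t, Dwitness mu DS [:: x; y; z; w] /\ u \notin lX mu
  | D1R, [:: x; y; z; u; v; w] =>
      exists mu : ltau t, Dwitness mu DL [:: x; y; z] /\ Dwitness mu DL [:: u; v; w]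
  | D1Q, [:: x; y; z; w; p; q; s] =>
      exists mu : ltau t,
        Dwitness mu DS [:: x; y; z; w] /\ Dwitness mu DL [:: p; q; s]
  | _, _ => False
  end.

Definition Dstructure : structure LD1 A := fun s args => Drelation s args.

End Dstructure.

Definition classD (T : Type) (M : structure LD1 T) : Prop :=
  exists (A : finType) (t : Ddata A), is_Dtree t /\ isomorphic (Dstructure t) M.

Definition Dprec (T : Type) (M : structure LD1 T) (s1 s2 : Dsym) (xs ys : seq T) :
    Prop :=
  exists (A : finType) (t : Ddata A) (f : A -> T),
    [/\ is_Dtree t, embedding (Dstructure t) M f &
        exists (mu nu : ltau t) (a b : seq A),
          [/\ xs = map f a, ys = map f b, Dwitness mu s1 a, Dwitness nu s2 b
            & (mu <= nu)%O]].

Definition MD2 (T : Type) (M : structure LD1 T) : structure LD2 T := fun s =>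
  match s return (@arity LD2 s).-tuple T -> Prop with
  | D2 s => fun args => M (D1 s) args
  | D2P => fun args => Dprec M DL DL (take 3 args) (drop 3 args)
  | D2Qle => fun args => Dprec M DS DL (take 4 args) (drop 4 args)
  | D2Qge => fun args => Dprec M DL DS (drop 4 args) (take 4 args)
  | D2T => fun args => Dprec M DS DS (take 4 args) (drop 4 args)
  end.

(* First-order formulas with equality and free variables in 'I_n; the variable
   bound by [FEx] is variable 0 of its body. *)

Inductive formula (L : language) : nat -> Type :=
  | FRel n (s : L) (args : (arity s).-tuple 'I_n) : formula L n
  | FEq n (i j : 'I_n) : formula L n
  | FNot n (phi : formula L n) : formula L n
  | FAnd n (phi psi : formula L n) : formula L n
  | FEx n (phi : formula L n.+1) : formula L n.

Fixpoint sat (L : language) (T : Type) (M : structure L T) (n : nat)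
    (phi : formula L n) : n.-tuple T -> Prop :=
  match phi in formula _ n return n.-tuple T -> Prop with
  | FRel n s args => fun v => M s (map_tuple (tnth v) args)
  | FEq n i j => fun v => tnth v i = tnth v j
  | FNot n phi => fun v => ~ sat M phi v
  | FAnd n phi psi => fun v => sat M phi v /\ sat M psi v
  | FEx n phi => fun v => exists a : T, sat M phi (cons_tuple a v)
  end.

(* phi(x; y) has the independence property, x being the first m variables. *)
Definition has_IP (L : language) (T : Type) (M : structure L T) (m n : nat)
    (phi : formula L (m + n)) : Prop :=
  forall k : nat,
  exists (a : 'I_k -> m.-tuple T) (b : {set 'I_k} -> n.-tuple T),
    forall i J, sat M phi (cat_tuple (a i) (b J)) <-> i \in J.

Definition NIP (L : language) (T : Type) (M : structure L T) : Prop :=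
  forall (m n : nat) (phi : formula L (m + n)), ~ has_IP M phi.

Definition monadic_language (L : language) (I : Type) : language :=
  @Language (L + I)%type
    (fun s => match s with inl s => arity s | inr _ => 1 end).

Definition monadic_expansion (L : language) (T : Type) (M : structure L T)
    (I : Type) (P : I -> T -> Prop) : structure (monadic_language L I) T :=
  fun s => match s return (@arity (monadic_language L I) s).-tuple T -> Prop with
           | inl s => fun args => M s args
           | inr i => fun args => P i (thead args)
           end.

Definition monadically_NIP (L : language) (T : Type) (M : structure L T) : Prop :=
  forall (I : Type) (P : I -> T -> Prop), NIP (monadic_expansion M P).

Record finite_structure (L : language) := FiniteStructure {
  fs_dom : finType;
  fs_str : structure L fs_dom
}.

Arguments fs_str {L} f.

Definition embeds (L : language) (N1 N2 : finite_structure L) : Prop :=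
  exists f, embedding (fs_str N1) (fs_str N2) f.

Definition Age (L : language) (T : Type) (M : structure L T)
    (N : finite_structure L) : Prop :=
  exists f, embedding (fs_str N) M f.

Definition wqo (X : Type) (C : X -> Prop) (le : X -> X -> Prop) : Prop :=
  ~ (exists a : nat -> X,
       (forall i, C (a i)) /\ forall i j, i <> j -> ~ le (a i) (a j)) /\
  ~ (exists a : nat -> X,
       (forall i, C (a i)) /\ forall i, le (a i.+1) (a i) /\ ~ le (a i) (a i.+1)).

(* From here on set notations denote classical sets, no longer finsets. *)
From mathcomp Require Import all_classical all_reals all_analysis.

Local Open Scope classical_set_scope.
Local Open Scope card_scope.

Definition induced (L : language) (T : Type) (M : structure L T) (S : set T) :
    structure L (set_type S) :=
  fun s args => M s (map_tuple val args).

Arguments induced {L T} M S.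

Definition Aut (L : language) (T : Type) (M : structure L T) : set (T -> T) :=
  [set g | isomorphism M M g].

Record is_Fraisse_limit (L : language) (K : forall U : Type, structure L U -> Prop)
    (T : Type) (M : structure L T) : Prop := IsFraisseLimit {
  Fraisse_countable : [set: T] #= [set: nat];
  Fraisse_age : forall F : set T, finite_set F ->
    exists S : set T, [/\ finite_set S, F `<=` S & K (set_type S) (induced M S)];
  Fraisse_universal : forall (U : Type) (N : structure L U), K U N ->
    exists f : U -> T, embedding N M f;
  Fraisse_homogeneous : forall S1 S2 : set T, finite_set S1 -> finite_set S2 ->
    K (set_type S1) (induced M S1) -> K (set_type S2) (induced M S2) ->
    forall f : set_type S1 -> set_type S2,
      isomorphism (induced M S1) (induced M S2) f ->
      exists2 g, Aut M g & forall x, g (val x) = val (f x)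
}.

Definition is_MB1 (T : Type) (M : structure LB1 T) : Prop :=
  is_Fraisse_limit classB M.

Definition is_MD1 (T : Type) (M : structure LD1 T) : Prop :=
  is_Fraisse_limit classD M.

Definition subset_orbits (T : Type) (G : set (T -> T)) (k : nat) : set (set (set T)) :=
  [set [set g @` A | g in G] | A in [set A : set T | A #= `I_k]].

(* The number of orbits on k-subsets, as an extended real: it is +oo when there
   are infinitely many orbits, which does not happen if G is oligomorphic. *)
Definition orbit_growth (R : realType) (T : Type) (G : set (T -> T)) (k : nat) :
    \bar R :=
  counting (subset_orbits G k).

Definition super_exponential (R : realType) (f : nat -> \bar R) : Prop :=
  forall c : R, (1 < c)%R ->
    exists K : nat, forall k : nat, (K < k)%N -> ((c ^+ k)%:E < f k)%E.

(* Main.v *)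
Require Import Defs.
From HB Require Import structures.
From mathcomp Require Import all_boot all_order all_algebra.

Set Implicit Arguments.
Unset Strict Implicit.
Unset Printing Implicit Defensive.

Import Order.TTheory.

(** Only the relation [L] matters: on either limit it has the following extension
    property, recorded as [twin_over].  For a finite set [F] of points and [p] in
    [F] there are two new points, a twin [q] of [p] and an apex [c].  For [L], the
    apex lies between any two distinct points, [q] being identified with [p]; and
    [p] lies between [q] and everything else; apart from this [q] relates to the
    points of [F] as [p] does.

    The property comes from adding a root below the tree of sets of a finite
    structure of the class.  For B-sets the tree at the new root is the star with
    centre [c] on the old points, with [q] hanging from the leaf [p]; for D-sets
    it has a centre with the special branch [{c}] and a second node, with leaves
    [p] and [q] and special branch [{p}].  In both cases the only successor of the
    new root is the old root, where [c] has disappeared and [q] has merged with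
    [p]; and the new level witnesses nothing about old points only.  So the old
    structure is a substructure of the new one ([Bext_embedding],
    [Dext_embedding]), and universality and homogeneity of the limit carry the two
    new points into it ([Fraisse_twin]).

    Iterating ([twin_sequence_exists]) gives, for an arbitrary parent function [g],
    points [q k], each the twin of [q (g k)], and apexes [c k].  The apex [c k]
    sees [q i] and [q j] as one point exactly when they become equal after each
    point of index at least [k] is replaced by its parent ([L_c_q_q]): the apexes
    are a clock, and [L] tells in which interval of time a twin was created.

    With [g] taking every finite word of values on some interval, the formula
    saying that [q i] got a twin in the interval cut out by two apexes has the
    independence property; a predicate for the points [q k] restricts its
    quantifier ([not_monadically_NIP]).

    For the two other claims a word over a finite alphabet is coded: the first
    points are the letters, and the later points are twins of the letters in the
    order in which these occur in the word.  The key fact ([word_embedding]) is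
    that any map between two such finite configurations which respects [L], with
    no constants or predicates to guide it, embeds one word in the other as a
    pattern, up to renaming the letters.  There are [r!] words of length [2 * r]
    consisting of [0 1 ... r - 1] followed by a permutation, no two of them
    equivalent, which gives at least [r!] orbits on sets of size about [5 * r]; and
    the words [0 0 1 0 2 1 3 2 ...] in which each letter overlaps with the next
    one, with the first and the last letter tripled, form an antichain. *)

(** * Graphs *)

Section Components.
Variables (U : finType) (e : rel U).
Hypothesis e_sym : symmetric e.
Implicit Types (D : {set U}) (a b c : U).

Definition within D : rel U := [rel a b | [&& e a b, a \in D & b \in D]].

Lemma within_connect_sym D : connect_sym (within D).
Proof.
apply: sym_connect_sym => a b; rewrite /within /= e_sym.
by rewrite [(a \in D) && _]andbC.
Qed.

Definition component D a : {set U} := [set b in D | connect (within D) a b].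

Lemma componentsE D : components e D = [set component D a | a in D].
Proof. by []. Qed.

Lemma component_eq D a b :
  a \in D -> b \in D -> (component D a == component D b) = connect (within D) a b.
Proof.
move=> aD bD; apply/eqP/idP => [E|ab].
  have: b \in component D b by rewrite inE bD connect0.
  by rewrite -E inE bD.
apply/setP => x; rewrite !inE.
by rewrite (same_connect (within_connect_sym D) ab).
Qed.

Lemma mem_component D a C : C \in components e D -> a \in C ->
  a \in D /\ C = component D a.
Proof.
rewrite componentsE => /imsetP[b bD ->]; rewrite inE => /andP[aD ba]; split=> //.
by apply/eqP; rewrite component_eq.
Qed.

Lemma same_block_components D a b : a \in D -> b \in D ->
  same_block (components e D) a b = connect (within D) a b.
Proof.
move=> aD bD; apply/existsP/idP => [[C /and3P[CD aC bC]]|ab].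
  have [_ Ea] := mem_component CD aC; have [_ Eb] := mem_component CD bC.
  by rewrite -component_eq // -Ea -Eb.
exists (component D a); rewrite componentsE imset_f //=.
by rewrite !inE aD bD connect0.
Qed.

Lemma in_distinct_blocks_components D a b c :
  in_distinct_blocks (components e D) a b c <->
  [/\ a \in D, b \in D & c \in D] /\
  [/\ ~~ connect (within D) a b, ~~ connect (within D) a c
    & ~~ connect (within D) b c].
Proof.
split=> [[C1 [C2 [C3 [[H1 H2 H3] aC bC cC]]]]|[[aD bD cD] [nab nac nbc]]].
  have [aD Ea] := mem_component H1 aC.
  have [bD Eb] := mem_component H2 bC.
  have [cD Ec] := mem_component H3 cC.
  rewrite /= !inE !negb_or andbT => /andP[/andP[n12 n13] n23].
  split; first by split.
  by rewrite Ea Eb Ec !component_eq // in n12 n13 n23.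
exists (component D a), (component D b), (component D c); split.
- by split; apply: imset_f.
- by rewrite inE aD connect0.
- by rewrite inE bD connect0.
- by rewrite inE cD connect0.
by rewrite /= !inE !negb_or !component_eq // nab nac nbc.
Qed.

(** No edge leaves the set of the vertices with a given label, and this set is
    connected through its hub.  The branches of the explicit trees are found in
    this way. *)
Lemma connect_label (K : eqType) (label : U -> K) (hub : K -> U) (r : rel U)
    (D : {set U}) :
  connect_sym r -> (forall a b, r a b -> label a = label b) ->
  {in D, forall a, connect r a (hub (label a))} ->
  {in D &, forall a b, connect r a b = (label a == label b)}.
Proof.
move=> rS lab hubP a b aD bD; apply/idP/eqP => [/connectP[p]|E].
  elim: p a {aD} => [|c p IH] a /=; first by move=> _ ->.
  by move=> /andP[/lab-> ?]; apply: IH.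
by apply: connect_trans (hubP a aD) _; rewrite rS E hubP.
Qed.

(** In a connected graph every branch at [v] contains a neighbour of [v]. *)
Lemma degree_ge_branches (P : {set U}) v :
  v \in P -> (forall a b, e a b -> (a \in P) && (b \in P)) ->
  {in P &, forall a b, connect e a b} ->
  #|branches P e v| <= degree e v.
Proof.
move=> vP eP conn.
have sub : branches P e v \subset [set component (P :\ v) b | b in [set b | e v b]].
  apply/subsetP => C; rewrite /branches componentsE => /imsetP[a aD ->].
  have aP : a \in P by move: aD; rewrite !inE => /andP[].
  have /connectP[p pp aE] := conn _ _ vP aP.
  move: aE; case/shortenP: pp => q qp qu _ aE.
  case: q qp qu aE => [|b q] /= qp qu aE.
    by move: aD; rewrite aE !inE eqxx.
  case/andP: qp => vb qp; move: qu => /andP[vnq _].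
  apply/imsetP; exists b; first by rewrite inE.
  have mD x : x \in b :: q -> x \in P -> x \in P :\ v.
    move=> xq xP; rewrite !inE xP andbT; apply: contraNneq vnq => <-; exact: xq.
  have bD : b \in P :\ v by apply: mD; rewrite ?mem_head //; case/andP: (eP _ _ vb).
  apply/eqP; rewrite component_eq // within_connect_sym; apply/connectP; exists q => //.
  have : forall x y, x \in b :: q -> y \in b :: q -> e x y -> within (P :\ v) x y.
    by move=> x y xq yq exy; have /andP[xP yP] := eP _ _ exy; rewrite /within /= exy !mD.
  elim: q b qp {vb vnq aE bD mD} => //= y q IH b /andP[ey yq] H.
  rewrite (H b y) ?mem_head ?inE ?eqxx ?orbT //; apply: IH => // x z xq zq.
  by apply: H; rewrite inE ?xq ?zq orbT.
apply: leq_trans (subset_leq_card sub) _.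
exact: leq_imset_card.
Qed.

End Components.

Section Rooted.
Variables (U : finType) (r : U) (par : U -> U) (rk : U -> nat).
Hypothesis rk_par : forall x, x != r -> rk (par x) < rk x.

Definition parent_edge : rel U :=
  fun x y => ((x != r) && (par x == y)) || ((y != r) && (par y == x)).

Lemma parent_edge_sym : symmetric parent_edge.
Proof. by move=> x y; rewrite /parent_edge orbC. Qed.

Lemma parent_edge_rk x y : parent_edge x y -> rk y <= rk x -> y = par x.
Proof.
case/orP => /andP[nr /eqP E] // le.
by have := rk_par nr; rewrite E ltnNge le.
Qed.

Lemma parent_edge_neq x y : parent_edge x y -> x != y.
Proof.
by case/orP=> /andP[nr /eqP E]; have := rk_par nr; rewrite E;
  apply: contraTneq => ->; rewrite ltnn.
Qed.

Lemma connect_root x : connect parent_edge x r.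
Proof.
have [n] := ubnP (rk x); elim: n x => // n IH x le.
have [->//|nr] := eqVneq x r.
apply: connect_trans (connect1 _) (IH (par x) _).
  by rewrite /parent_edge nr eqxx.
exact: leq_trans (rk_par nr) le.
Qed.

Lemma rooted_tree : is_tree [set: U] parent_edge.
Proof.
split.
- by apply/set0Pn; exists r; rewrite inE.
- split; first exact: parent_edge_sym.
  by move=> x; apply/negP => /parent_edge_neq; rewrite eqxx.
- by move=> a b _; rewrite !inE.
- move=> a b _ _; apply: connect_trans (connect_root a) _.
  by rewrite (sym_connect_sym parent_edge_sym) connect_root.
move=> s; case: (posnP (size s)) => [->//|s_gt0].
(* both neighbours on a cycle of a vertex of maximal rank are its parent *)
have [x xs xmax] : exists2 x, x \in s & forall y, y \in s -> rk y <= rk x.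
  case: s s_gt0 => // x0 s _.
  have : x0 \in x0 :: s by rewrite mem_head.
  case/(@arg_maxnP _ x0 (mem (x0 :: s)) rk) => x xs xmax.
  by exists x => // y /xmax.
case: (rot_to xs) => i s' rs sc.
have : ucycle parent_edge (x :: s') by rewrite -rs rot_ucycle.
have mem y : y \in x :: s' -> rk y <= rk x by rewrite -rs mem_rot => /xmax.
rewrite -(size_rot i) rs.
case: s' mem {rs} => [|y s'] mem //= /andP[].
case: (lastP s') mem => [|{}s' z] mem //=.
rewrite rcons_path last_rcons => /and3P[exy _ ezx].
rewrite mem_rcons !inE !negb_or => /andP[_ /andP[/andP[nyz _] _]].
have Ey := parent_edge_rk exy (mem y _).
have Ez : z = par x.
  apply: parent_edge_rk; first by rewrite parent_edge_sym.
  by apply: mem; rewrite !inE mem_rcons inE eqxx !orbT.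
by move: nyz; rewrite Ez Ey ?eqxx // !inE eqxx orbT.
Qed.

End Rooted.

(** Transport of graph notions along an injection whose image contains all the
    edges of the target.  The levels of the extended trees are copies of explicit
    graphs or of the levels of the given tree. *)
Section GraphMap.
Variables (U V : finType) (h : U -> V) (e : rel U) (e' : rel V).
Hypothesis h_inj : injective h.
Hypothesis e'h : forall a b, e' (h a) (h b) = e a b.
Hypothesis e'_codom : forall x y, e' x y -> (x \in codom h) && (y \in codom h).

Lemma path_h a s : path e' (h a) (map h s) = path e a s.
Proof. by rewrite path_map; apply: eq_path => x y /=. Qed.

Lemma path_codom x s : path e' x s -> exists s0, s = map h s0.
Proof.
elim: s x => [|y s IH] x /=; first by exists [::].
case/andP => /e'_codom/andP[_ /codomP[b ->]] /IH[s0 ->].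
by exists (b :: s0).
Qed.

Lemma connect_h a b : connect e' (h a) (h b) = connect e a b.
Proof.
apply/connectP/connectP => [[p pp E]|[p pp ->]].
  have [s0 Es] := path_codom pp; exists s0; first by rewrite -path_h -Es.
  by apply: h_inj; rewrite E Es last_map.
by exists (map h p); rewrite ?path_h ?last_map.
Qed.

Lemma on_path_h v a b : on_path e' (h v) (h a) (h b) <-> on_path e v a b.
Proof.
split=> [[p [pp E u m]]|[p [pp E u m]]].
  have [s0 Es] := path_codom pp; exists s0.
  rewrite Es in pp E u m; split.
  - by rewrite -path_h.
  - by apply: h_inj; rewrite -last_map.
  - by rewrite -(map_inj_uniq h_inj).
  - by move: m; rewrite -map_cons mem_map.
exists (map h p); split.
- by rewrite path_h.
- by rewrite last_map E.
- by rewrite -map_cons map_inj_uniq.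
- by rewrite -map_cons mem_map.
Qed.

Lemma degree_h a : degree e' (h a) = degree e a.
Proof.
rewrite /degree -(card_imset _ h_inj); congr #|pred_of_set _|.
apply/setP => y; rewrite inE; apply/idP/imsetP => [ey|[b]].
  have /andP[_ /codomP[b E]] := e'_codom ey; exists b => //.
  by rewrite inE -e'h -E.
by rewrite inE -e'h => ? ->.
Qed.

Lemma tree_h P : is_tree P e -> is_tree (h @: P) e'.
Proof.
move=> [P0 [eS eI] eP eC eA]; split.
- by have /set0Pn[x xP] := P0; apply/set0Pn; exists (h x); apply: imset_f.
- split.
    move=> x y; apply/idP/idP => exy; have /andP[/codomP[a Ea] /codomP[b Eb]] :=
      e'_codom exy; by rewrite Ea Eb e'h eS -e'h -Ea -Eb.
  move=> x; apply/negP => exx; have /andP[/codomP[a Ea] _] := e'_codom exx.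
  by move: exx; rewrite Ea e'h eI.
- move=> x y exy; have /andP[/codomP[a Ea] /codomP[b Eb]] := e'_codom exy.
  by move: exy; rewrite Ea Eb e'h => /eP/andP[? ?]; rewrite !imset_f.
- by move=> _ _ /imsetP[a aP ->] /imsetP[b bP ->]; rewrite connect_h eC.
move=> [//|x s] /andP[cs us].
have [s1 Es1] := path_codom cs.
have /codomP[a Ea] : x \in codom h.
  have : x \in rcons s x by rewrite mem_rcons mem_head.
  by rewrite Es1 => /mapP[b _ ->]; rewrite codom_f.
have [s0 Es] : exists s0, s = map h s0.
  by move: cs; rewrite /= rcons_path => /andP[/path_codom].
rewrite Ea Es -map_cons in us cs *.
rewrite size_map; apply: eA; apply/andP; split.
  by rewrite /= -path_h map_rcons; exact: cs.
by rewrite -(map_inj_uniq h_inj).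
Qed.

End GraphMap.

Section BranchMap.
Variables (U V : finType) (h : U -> V) (e : rel U) (e' : rel V).
Hypothesis h_inj : injective h.
Hypothesis e'h : forall a b, e' (h a) (h b) = e a b.

Lemma imset_setD1 (P : {set U}) v : h @: (P :\ v) = (h @: P) :\ h v.
Proof.
apply/setP => y; rewrite !inE; apply/imsetP/andP => [[x]|[ny /imsetP[x xP Ey]]].
  by rewrite !inE => /andP[nx xP] ->; rewrite (inj_eq h_inj) nx imset_f.
by exists x => //; rewrite !inE xP andbT; apply: contraNneq ny => <-; rewrite Ey.
Qed.

Lemma branches_h (P : {set U}) v :
  branches (h @: P) e' (h v) = [set h @: (C : {set U}) | C in branches P e v].
Proof.
rewrite /branches -imset_setD1 !componentsE -!imset_comp.
apply: eq_in_imset => a aD /=.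
set D := P :\ v in aD *.
have conn x y : connect [rel a b | [&& e' a b, a \in h @: D & b \in h @: D]] (h x) (h y)
    = connect [rel a b | [&& e a b, a \in D & b \in D]] x y.
  apply: connect_h => //= [{}x {}y|{}x {}y].
    by rewrite e'h !mem_imset.
  by case/and3P => _ /imsetP[? _ ->] /imsetP[? _ ->]; rewrite !codom_f.
apply/setP => y; rewrite inE; apply/andP/imsetP => [[/imsetP[b bD ->]]|[b]].
  by rewrite conn => ab; exists b => //; rewrite inE bD.
by rewrite inE => /andP[bD ab] ->; rewrite imset_f // conn.
Qed.

Lemma same_block_h (Bs : {set {set U}}) a b :
  same_block [set h @: (C : {set U}) | C in Bs] (h a) (h b) = same_block Bs a b.
Proof.
apply/existsP/existsP => [[_ /and3P[/imsetP[C CB ->]]]|[C /and3P[CB aC bC]]].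
  by rewrite !mem_imset // => aC bC; exists C; apply/and3P; split.
by exists (h @: C); apply/and3P; split; [exact: imset_f|rewrite mem_imset..].
Qed.

Lemma in_distinct_blocks_h (Bs : {set {set U}}) a b c :
  in_distinct_blocks [set h @: (C : {set U}) | C in Bs] (h a) (h b) (h c) <->
  in_distinct_blocks Bs a b c.
Proof.
have hU (C1 C2 C3 : {set U}) :
    uniq [:: h @: C1; h @: C2; h @: C3] = uniq [:: C1; C2; C3].
  by rewrite -(map_inj_uniq (imset_inj h_inj)).
split=> [[_ [_ [_ [[/imsetP[C1 H1 ->] /imsetP[C2 H2 ->] /imsetP[C3 H3 ->]]]]]]|].
  by rewrite !mem_imset // hU; exists C1, C2, C3.
move=> [C1 [C2 [C3 [[H1 H2 H3] ? ? ? ?]]]].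
by exists (h @: C1), (h @: C2), (h @: C3); rewrite hU !(mem_imset _ _ h_inj); split=> //;
  split; apply: imset_f.
Qed.

End BranchMap.

Definition image_rel (U V : finType) (h : U -> V) (e : rel U) : rel V :=
  fun x y => [exists a, exists b, [&& x == h a, y == h b & e a b]].

Lemma image_relE (U V : finType) (h : U -> V) (e : rel U) :
  injective h -> forall a b, image_rel h e (h a) (h b) = e a b.
Proof.
move=> hI a b; apply/existsP/idP => [[a' /existsP[b' /and3P[]]]|ab].
  by move=> /eqP/hI -> /eqP/hI ->.
by exists a; apply/existsP; exists b; rewrite !eqxx.
Qed.

Lemma image_rel_codom (U V : finType) (h : U -> V) (e : rel U) x y :
  image_rel h e x y -> (x \in codom h) && (y \in codom h).
Proof.
by case/existsP => a /existsP[b /and3P[/eqP-> /eqP-> _]]; rewrite !codom_f.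
Qed.

Section PathFacts.
Variables (U : finType) (e : rel U).
Hypothesis e_sym : symmetric e.

Lemma on_path_sym v a b : on_path e v a b -> on_path e v b a.
Proof.
move=> [p [pp E u m]]; exists (rev (belast a p)); split.
- by rewrite -E rev_path (eq_path (e' := e)) // => x y; rewrite /= e_sym.
- case: p pp E u m => [|x p] //= _ _ _ _.
  by rewrite rev_cons last_rcons.
- by rewrite -E -rev_rcons -lastI rev_uniq.
- by rewrite -E -rev_rcons -lastI mem_rev.
Qed.

(** In the explicit trees almost all neighbours of a vertex are leaves.  A simple
    path cannot leave a leaf again, so that the neighbours of an interior vertex
    determine the ends of the path. *)
Lemma on_path_interior v a b : on_path e v a b -> v != a -> v != b ->
  exists u w, [/\ e v u, e v w & u != w] /\
    ((forall x, e u x -> x = v) -> u = a) /\ ((forall x, e w x -> x = v) -> w = b).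
Proof.
move=> [p [pp E u m]] va vb; move: m; rewrite inE (negPf va) /= => m.
case/splitPr: m pp E u => p1 p2; rewrite cat_path last_cat /= => /and3P[pp1 e1 pp2] E u.
case: p2 pp2 E u => [|w p2] /= pp2 E u; first by rewrite E eqxx in vb.
case/andP: pp2 => vw pp2.
exists (last a p1), w; split; first split=> //.
- by rewrite e_sym.
- move: u => /andP[]; rewrite !(mem_cat, inE) !negb_or => /andP[_ /and3P[_ aw _]].
  rewrite cat_uniq => /and3P[_ /hasPn H _].
  case/lastP: p1 {pp1 e1 E} H aw => [|p1 x] // H aw; rewrite last_rcons.
  have := H w; rewrite !inE eqxx orbT mem_rcons inE negb_or eq_sym => /(_ isT).
  by case/andP.
split.
  case/lastP: p1 pp1 e1 E u => [//|p1 x]; rewrite last_rcons rcons_path.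
  move=> /andP[_ ex] _ _ u H.
  have Ev : last a p1 = v by apply: H; rewrite e_sym.
  move: u => /andP[]; rewrite !(mem_cat, inE) !negb_or => /andP[_ /and3P[av _ _]].
  rewrite cat_uniq => /and3P[_ /hasPn/(_ v) H2 _].
  move: H2; rewrite mem_head mem_rcons inE negb_or => /(_ isT)/andP[_].
  case/lastP: p1 {ex} Ev => [/= ae|p1 z]; first by rewrite ae eqxx in av.
  by rewrite last_rcons => ->; rewrite mem_rcons mem_head.
case: p2 pp2 E u => [//|z p2] /= /andP[wz _] _ u H.
have Ez := H _ wz.
by move: u; rewrite cat_uniq /= Ez !inE eqxx !orbT /= !andbF.
Qed.

Lemma on_path_leaf v a b : on_path e v a b -> (forall x y, e v x -> e v y -> x = y) ->
  v = a \/ v = b.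
Proof.
move=> H leaf; have [->|va] := eqVneq v a; first by left.
have [->|vb] := eqVneq v b; first by right.
have [u [w [[vu vw /eqP nuw] _]]] := on_path_interior H va vb.
by case: nuw; apply: leaf.
Qed.

Lemma on_path_pendant v a b : on_path e v a b -> (forall x, e b x -> x = a) ->
  v = a \/ v = b.
Proof.
move=> [p [pp E u m]] leaf; case/lastP: p pp E u m => [|p b'].
  by move=> _ /= _ _; rewrite inE => /eqP; left.
rewrite last_rcons rcons_path => /andP[_ eb] Eb; rewrite {}Eb in eb *.
have Ea : last a p = a by apply: leaf; rewrite e_sym.
case/lastP: p Ea {eb} => [_ _|p x].
  by rewrite !inE => /orP[] /eqP; [left|right].
rewrite last_rcons => ->.
by rewrite /= mem_rcons inE mem_rcons mem_head orbT.
Qed.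

End PathFacts.

(** * Adding a root level *)

Definition with_bottom (T : Type) : Type := option T.

HB.instance Definition _ (T : finType) := Finite.copy (with_bottom T) (option T).

Section WithBottom.
Variables (d : Order.disp_t) (T : finBPOrderType d).

Definition wb_le (x y : with_bottom T) : bool :=
  match x, y with
  | None, _ => true
  | Some _, None => false
  | Some a, Some b => (a <= b)%O
  end.

Lemma wb_le_refl : reflexive wb_le. Proof. by case=> //= a. Qed.
Lemma wb_le_anti : antisymmetric wb_le.
Proof. by move=> [a|] [b|] //= /le_anti ->. Qed.
Lemma wb_le_trans : transitive wb_le.
Proof. by move=> [a|] [b|] [c|] //=; apply: le_trans. Qed.
Lemma wb_le_bottom (x : with_bottom T) : wb_le None x. Proof. by []. Qed.

HB.instance Definition _ := Order.Le_isPOrder.Build d (with_bottom T)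
  wb_le_refl wb_le_anti wb_le_trans.
HB.instance Definition _ := Order.hasBottom.Build d (with_bottom T) wb_le_bottom.

Lemma wb_leE (a b : T) : (Some a <= Some b :> with_bottom T)%O = (a <= b)%O.
Proof. by []. Qed.
Lemma wb_ltE (a b : T) : (Some a < Some b :> with_bottom T)%O = (a < b)%O.
Proof. by rewrite !lt_neqAle wb_leE. Qed.
Lemma wb_lt0 (a : T) : ((None : with_bottom T) < Some a)%O.
Proof. by rewrite lt_neqAle. Qed.
Lemma wb_lte0 (a : with_bottom T) : (a < (None : with_bottom T))%O = false.
Proof. by rewrite lt_neqAle; case: a. Qed.

End WithBottom.

Section Blowup.
Variables (A : finType) (p : A).

Notation A2 := (option (option A)).

(** In [option (option A)] the points [Some (Some a)] are the old ones, [Some None]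
    is the twin of [p] and [None] is the apex.  Identifying the twin with [p] is a
    map to [A] from all points but the apex, along which the classes of the old
    levels are pulled back. *)
Definition untwin (y : option A) : A := odflt p y.

Definition blow (V : {set A}) : {set A2} :=
  [set x | if x is Some y then untwin y \in V else false].

Definition unblow (V : {set A2}) : {set A} := [set a | Some (Some a) \in V].

Lemma blowK : cancel blow unblow.
Proof. by move=> V; apply/setP => a; rewrite !inE. Qed.

Lemma blow_inj : injective blow. Proof. exact: can_inj blowK. Qed.

Lemma in_blow V y : (Some y \in blow V) = (untwin y \in V).
Proof. by rewrite inE. Qed.

Lemma in_blow0 V : (None \in blow V) = false. Proof. by rewrite inE. Qed.

Lemma blowD V W : blow (V :\: W) = blow V :\: blow W.
Proof. by apply/setP => -[y|]; rewrite !inE ?andbF. Qed.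

End Blowup.

Section ExtLevels.
Variables (A : finType) (p : A) (t : levels A).

Notation A2 := (option (option A)).
Notation tau2 := (with_bottom (ltau t)).

Definition lX2 (mu : tau2) : {set A2} :=
  if mu is Some m then blow p (lX m) else [set: A2].

Definition lsim2 (mu : tau2) : rel A2 := fun x y =>
  match mu, x, y with
  | Some m, Some x, Some y => lsim m (untwin p x) (untwin p y)
  | Some _, _, _ => false
  | None, _, _ => x == y
  end.

Lemma tau2_tree (x y z : tau2) : (x <= z -> y <= z -> x >=< y)%O.
Proof. by case: x y z => [x|] [y|] [z|] //=; apply: ltau_tree. Qed.

Lemma lsim2_equiv mu : {in lX2 mu & &, equivalence_rel (lsim2 mu)}.
Proof.
case: mu => [m|] [x|] [y|] [z|]; rewrite ?in_blow ?in_blow0 //=.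
- by move=> ? ? ?; apply: (@lsim_equiv _ t).
all: by rewrite ?eqxx; move=> *; split=> // /eqP ->.
Qed.

(** Above the new root the apex is gone and the twin is equivalent to [p]. *)
Definition ext_levels : levels A2 :=
  @Levels A2 (ldisp t) tau2 lX2 lsim2 tau2_tree lsim2_equiv erefl
    (fun _ _ => erefl).

Lemma ext_cls (mu : ltau t) y :
  @cls _ ext_levels (Some mu) (Some y) = blow p (cls mu (untwin p y)).
Proof. by apply/setP => -[z|]; rewrite !inE. Qed.

Lemma ext_cls0 x : @cls _ ext_levels None x = [set x].
Proof. by apply/setP => z; rewrite !inE eq_sym. Qed.

Lemma classesE (B : finType) (s : levels B) (mu : ltau s) :
  classes mu = [set cls mu x | x in lX mu].
Proof. by []. Qed.

Lemma ext_classes (mu : ltau t) :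
  @classes _ ext_levels (Some mu) = [set blow p C | C in classes mu].
Proof.
rewrite !classesE; apply/setP => C; apply/imsetP/imsetP => [[[y|] ]|[_ /imsetP[x xX ->] ->]].
- rewrite in_blow => yX ->; exists (cls mu (untwin p y)); first exact: imset_f.
  exact: ext_cls.
- by rewrite in_blow0.
by exists (Some (Some x)); rewrite ?in_blow // (ext_cls mu (Some x)).
Qed.

Lemma ext_classes0 : @classes _ ext_levels None = [set [set x] | x in [set: A2]].
Proof. by rewrite classesE; apply: eq_imset => x; rewrite ext_cls0. Qed.

Lemma ext_inequivalent (mu : ltau t) (s : seq (option A)) :
  @inequivalent _ ext_levels (Some mu) (map Some s) <->
  inequivalent mu (map (untwin p) s).
Proof.
rewrite /inequivalent !all_map !pairwise_map.
have -> : all (preim Some (mem (@lX _ ext_levels (Some mu)))) s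
        = all (preim (untwin p) (mem (lX mu))) s.
  by apply: eq_all => y; rewrite /= in_blow.
by [].
Qed.

Lemma ext_inequivalent0 (s : seq A2) :
  @inequivalent _ ext_levels None s <-> uniq s.
Proof.
rewrite /inequivalent uniq_pairwise.
have -> : all (mem (@lX _ ext_levels None)) s by apply/allP => x; rewrite inE.
by [].
Qed.

Lemma immediate_succ_ext0 (nu : ltau ext_levels) :
  @immediate_succ _ ext_levels None nu = (nu == Some \bot%O).
Proof.
rewrite /immediate_succ; apply/andP/eqP => [[H /forallP/(_ (Some \bot%O))]|->].
  case: nu H => [nu|] H; last by rewrite ltxx in H.
  rewrite (wb_lt0 _) wb_ltE lt0x negbK => /eqP->//.
split; first exact: wb_lt0.
apply/forallP => -[ka|]; last by rewrite ltxx.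
by rewrite wb_ltE ltx0 andbF.
Qed.

Lemma immediate_succ_ext (mu : ltau t) (nu : ltau ext_levels) :
  @immediate_succ _ ext_levels (Some mu) nu =
  (if nu is Some n then immediate_succ mu n else false).
Proof.
rewrite /immediate_succ; case: nu => [nu|]; last by rewrite wb_lte0.
rewrite wb_ltE; congr (_ && _); apply/forallP/forallP => H ka.
  by have := H (Some ka); rewrite !wb_ltE.
by case: ka => [ka|]; rewrite ?wb_ltE ?wb_lte0 //; exact: H.
Qed.

End ExtLevels.

Lemma in_distinct_blocks_sym (U : finType) (Bs : {set {set U}}) a b c :
  in_distinct_blocks Bs a b c -> in_distinct_blocks Bs a c b.
Proof.
move=> [C1 [C2 [C3 [[H1 H2 H3] aC bC cC u]]]]; exists C1, C3, C2; split=> //.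
move: u; rewrite /= !inE !negb_or !andbT [C3 == C2]eq_sym.
by case/andP => /andP[-> ->] ->.
Qed.

(** * Extending a tree of B-sets *)

Section SproutB.
Variables (A : finType) (p : A).

Notation A2 := (option (option A)).

(** The star with centre [None] whose leaf at [p] is continued by a pendant
    vertex [Some None]. *)
Definition stem_parent (x : A2) : A2 :=
  if x is Some None then Some (Some p) else None.

Definition stem_rank (x : A2) : nat :=
  match x with None => 0 | Some None => 2 | Some (Some _) => 1 end.

Lemma stem_rank_parent x : x != None -> stem_rank (stem_parent x) < stem_rank x.
Proof. by case: x => [[a|]|]. Qed.

Definition stem : rel A2 := parent_edge None stem_parent.

Lemma stem_sym : symmetric stem. Proof. exact: parent_edge_sym. Qed.

Lemma stem_tree : is_tree [set: A2] stem.
Proof. exact: (rooted_tree stem_rank_parent). Qed.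

Lemma stemE x y : stem x y =
  match x, y with
  | None, Some (Some _) | Some (Some _), None => true
  | Some None, Some (Some a) | Some (Some a), Some None => a == p
  | _, _ => false
  end.
Proof.
rewrite /stem /parent_edge; case: x y => [[a|]|] [[b|]|] //=; rewrite ?eqxx ?orbT //=.
- exact: eq_sym.
- by rewrite orbF eq_sym.
Qed.

Lemma stem_leaf a x : a != p -> stem (Some (Some a)) x -> x = None.
Proof. by move=> ap; rewrite stemE; case: x => [[b|]|] //; rewrite (negPf ap). Qed.

Lemma stem_pendant x : stem (Some None) x -> x = Some (Some p).
Proof. by rewrite stemE; case: x => [[b|]|] // /eqP ->. Qed.

Lemma stem_p x : stem (Some (Some p)) x -> x = None \/ x = Some None.
Proof. by rewrite stemE; case: x => [[b|]|] // _; [right|left]. Qed.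

Lemma stem_pq : stem (Some (Some p)) (Some None).
Proof. by rewrite stemE. Qed.

Lemma stem_connect x y : x \in [set: A2] :\ None -> y \in [set: A2] :\ None ->
  connect (within stem ([set: A2] :\ None)) x y =
  (untwin p (odflt None x) == untwin p (odflt None y)).
Proof.
move=> xD yD.
apply: (connect_label (label := fun x => untwin p (odflt None x))
   (hub := fun a => Some (Some a)) _ _ _ xD yD).
- exact: within_connect_sym stem_sym _.
- move=> {xD yD} {}x {}y; rewrite /within /= !inE !andbT => /and3P[].
  by case: x => [[a|]|] //; case: y => [[b|]|] //=;
     rewrite stemE // => /eqP ->.
move=> {xD yD} {}x {y}; rewrite !inE andbT; case: x => [[a|]|] // _ /=.
by apply: connect1; rewrite /within /= !inE stem_sym stem_pq.
Qed.

Lemma stem_degree x : x != None -> degree stem x <= 2.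
Proof.
case: x => [x|] // _; suff [u [v H]] : exists u v, forall y, stem (Some x) y -> y \in [set u; v].
  apply: leq_trans (_ : #|[set u; v]| <= 2); last by rewrite cards2; case: (u == v).
  by apply: subset_leq_card; apply/subsetP => y; rewrite inE => /H.
case: x => [a|]; last first.
  by exists None, (Some (Some p)) => y /stem_pendant ->; rewrite !inE eqxx orbT.
exists None, (Some None) => y; have [->|ap] := eqVneq a p.
  by case/stem_p => ->; rewrite !inE.
by move/(stem_leaf ap) => ->; rewrite !inE.
Qed.

(** The centre is the only vertex to which a successor level is attached. *)
Lemma stem_branches_big x : 2 < #|A| ->
  (2 < #|branches [set: A2] stem x|) = (x == None).
Proof.
move=> A3; have [_ _ eP eC _] := stem_tree.
apply/idP/eqP => [H|->].
  case: (eqVneq x None) => // /stem_degree H2.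
  have := leq_trans H (degree_ge_branches stem_sym (in_setT x) eP eC).
  by move/leq_trans/(_ H2).
have [a [b [c [_ [ab bc ca]]]]] := card_gt2P A3.
apply/card_gt2P.
have D z : Some (Some z) \in [set: A2] :\ None by rewrite !inE.
pose C z := component stem ([set: A2] :\ None) (Some (Some z)).
have CB z : C z \in branches [set: A2] stem None by apply: imset_f.
have CE y z : (C y == C z) = (y == z).
  by rewrite component_eq ?stem_connect //; exact: stem_sym.
by exists (C a), (C b), (C c); rewrite !CE.
Qed.

Lemma stem_between x y z : uniq [:: x; y; z] ->
  on_path stem x y z <->
  [/\ x = None, y != None, z != None & untwin p (odflt None y) != untwin p (odflt None z)] \/
  x = Some (Some p) /\ (y = Some None \/ z = Some None).
Proof.
have S1 := stem_sym.
rewrite /= !inE !negb_or andbT => /andP[/andP[xy xz] yz]; split=> [H|].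
  case: x xy xz H => [[a|]|] xy xz H.
  - right; have [Ea|ap] := eqVneq a p; last first.
      case: (on_path_leaf S1 H) => [u v /(stem_leaf ap)-> /(stem_leaf ap)->//|E|E];
        by rewrite E eqxx in xy xz.
    rewrite {}Ea in xy xz H *; split=> //.
    have [u [w [[pu pw uw] [Eu Ew]]]] := on_path_interior S1 H xy xz.
    case: (stem_p pu) uw Eu => -> // uw Eu; last by left; rewrite Eu // => ? /stem_pendant.
    case: (stem_p pw) uw Ew => -> // uw Ew; by right; rewrite Ew // => ? /stem_pendant.
  - case: (on_path_leaf S1 H) => [u v /stem_pendant-> /stem_pendant->//|E|E];
      by rewrite E eqxx in xy xz.
  left; split; rewrite // 1?eq_sym //; apply/eqP => E.
  have {E} : y = Some None /\ z = Some (Some p) \/ z = Some None /\ y = Some (Some p).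
    case: y z xy xz yz E {H} => [[a|]|] [[b|]|] //= _ _ yz E.
    - by rewrite E eqxx in yz.
    - by right; rewrite E.
    - by left; rewrite E.
  case=> -[Ey Ez].
    case: (on_path_pendant S1 (on_path_sym S1 H)) => [u|E|E]; rewrite ?Ez ?Ey.
    + exact: stem_pendant.
    + by rewrite E eqxx in xz.
    + by rewrite E eqxx in xy.
  case: (on_path_pendant S1 H) => [u|E|E]; rewrite ?Ez ?Ey.
  + exact: stem_pendant.
  + by rewrite E eqxx in xy.
  + by rewrite E eqxx in xz.
(* every remaining case is an explicit path *)
have P1 a b : a != b -> on_path stem None (Some (Some a)) (Some (Some b)).
  move=> ab; exists [:: None; Some (Some b)]; split=> //=.
  rewrite !inE /= andbT; apply: contra ab; by move/eqP => [->].
have P2 b : p != b -> on_path stem None (Some None) (Some (Some b)).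
  move=> pb; exists [:: Some (Some p); None; Some (Some b)]; split=> //=.
  - by rewrite stem_sym stem_pq.
  - rewrite !inE /= andbT; apply: contra pb; by move/eqP => [->].
have P3 b : p != b -> on_path stem (Some (Some p)) (Some None) (Some (Some b)).
  move=> pb; exists [:: Some (Some p); None; Some (Some b)]; split=> //=.
  - by rewrite stem_sym stem_pq.
  - rewrite !inE /= andbT; apply: contra pb; by move/eqP => [->].
  - by rewrite !inE ?eqxx ?orbT.
have P4 : on_path stem (Some (Some p)) (Some None) None.
  exists [:: Some (Some p); None]; split=> //=; first by rewrite stem_sym stem_pq.
  by rewrite !inE ?eqxx ?orbT.
case=> [[-> y0 z0]|[Ex]].
  case: y z y0 z0 {xy xz yz} => [[a|]|] [[b|]|] //= _ _ ne.
  - exact: P1.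
  - by apply/(on_path_sym S1)/P2; rewrite eq_sym.
  - exact: P2.
  - by rewrite eqxx in ne.
rewrite {}Ex in xy xz *; case=> E; rewrite E in xy xz yz *.
  case: z xz yz {E} => [[b|]|] // xz _; apply: P3.
  by apply: contra xz => /eqP ->.
apply: (on_path_sym S1); case: y xy yz {E} => [[b|]|] // xy _; apply: P3.
by apply: contra xy => /eqP ->.
Qed.

End SproutB.

Lemma inequivalent_ext_Some (A : finType) (p : A) (t : levels A) (m : ltau t)
    (l : seq (option (option A))) x :
  @inequivalent _ (ext_levels p t) (Some m) l -> x \in l ->
  exists y, x = Some y.
Proof.
case/andP => /allP H _ /H /=; case: x => [y|]; first by exists y.
by rewrite in_blow0.
Qed.

Section ExtB.
Variables (A : finType) (p : A) (t : Bdata A).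
Hypothesis A3 : 2 < #|A|.
Hypothesis tP : is_Btree t.

Notation A2 := (option (option A)).

Let lev := ext_levels p t.

Definition Bedge2 (mu : ltau lev) : rel {set A2} :=
  match mu with
  | Some m => image_rel (blow p) (Bedge m)
  | None => image_rel set1 (stem p)
  end.

Definition Bchild2 (mu : ltau lev) (v : {set A2}) : ltau lev :=
  match mu with
  | Some m => Some (Bchild m (unblow v))
  | None => Some \bot%O
  end.

Definition Bext : Bdata A2 := @BData A2 lev Bedge2 Bchild2.

Lemma Bedge2_blow m V W : Bedge2 (Some m) (blow p V) (blow p W) = Bedge m V W.
Proof. exact/image_relE/blow_inj. Qed.

Lemma Bedge2_set1 x y : Bedge2 None [set x] [set y] = stem p x y.
Proof. exact/image_relE/set1_inj. Qed.

Lemma Bbranches2 (m : ltau t) v : @Bbranches _ Bext (Some m) (blow p v) =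
  [set blow p @: (C : {set {set A}}) | C in Bbranches m v].
Proof.
rewrite /Bbranches (ext_classes p m).
exact: (branches_h (@blow_inj _ p) (Bedge2_blow m)).
Qed.

Lemma Bbranches20 x : @Bbranches _ Bext None [set x] =
  [set set1 @: (C : {set A2}) | C in branches [set: A2] (stem p) x].
Proof.
rewrite /Bbranches (ext_classes0 p t).
exact: (branches_h (@set1_inj _) Bedge2_set1).
Qed.

Lemma Bbig2 (m : ltau t) : @Bbig _ Bext (Some m) = blow p @: Bbig m.
Proof.
rewrite /Bbig (ext_classes p m); apply/setP => V; rewrite inE.
have cB v : #|@Bbranches _ Bext (Some m) (blow p v)| = #|Bbranches m v|.
  by rewrite Bbranches2 card_imset //; apply: imset_inj; apply: blow_inj.
apply/andP/imsetP => [[/imsetP[v vC ->]]|[v]].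
  by rewrite cB => H; exists v => //; rewrite inE vC.
by rewrite inE => /andP[vC H] ->; rewrite cB imset_f.
Qed.

Lemma Bbig20 : @Bbig _ Bext None = [set [set None]].
Proof.
rewrite /Bbig (ext_classes0 p t); apply/setP => V; rewrite !inE.
have cB x : (2 < #|@Bbranches _ Bext None [set x]|) = (x == None).
  rewrite Bbranches20 card_imset ?stem_branches_big //.
  by apply: imset_inj; apply: set1_inj.
apply/andP/eqP => [[/imsetP[x _ ->]]|->].
  by rewrite cB => /eqP ->.
by rewrite cB eqxx imset_f.
Qed.

(** The branches at the centre are the old points, the twin being in the branch of
    [p]: they are the classes of the old root, which is thus the right successor. *)
Lemma Bext_tree : is_Btree Bext.
Proof.
split.
- by apply/card_gt0P; exists None.
- case=> [m|].
    rewrite (ext_classes p m).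
    by apply: (tree_h (@blow_inj _ p) (Bedge2_blow m) (@image_rel_codom _ _ _ _)
      (B_tree tP m)).
  rewrite (ext_classes0 p t).
  exact: (tree_h (@set1_inj _) Bedge2_set1 (@image_rel_codom _ _ _ _) (stem_tree p)).
- case=> [m|]; last by rewrite Bbig20 => V W /set1P -> /set1P ->.
  rewrite Bbig2 => _ _ /imsetP[v vB ->] /imsetP[w wB ->] /=.
  by rewrite !blowK => -[/(B_child_inj tP vB wB) ->].
- case=> [m|].
    rewrite Bbig2 -imset_comp; apply/setP => nu; rewrite inE (immediate_succ_ext).
    have -> : [set (@Bchild _ Bext (Some m) \o blow p) v | v in Bbig m] =
      [set Some n | n in [set n | immediate_succ m n]].
      rewrite -(B_child_succ tP m) -imset_comp; apply: eq_imset => v /=.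
      by rewrite blowK.
    apply/imsetP/idP => [[n]|]; first by rewrite inE => ? ->.
    by case: nu => // n H; exists n; rewrite // inE.
  rewrite Bbig20 imset_set1; apply/setP => nu.
  by rewrite !inE (immediate_succ_ext0).
- case=> [m|] V; last first.
    rewrite Bbig20 => /set1P -> /=; apply/setP => -[y|]; rewrite !inE ?lX_root //.
    by rewrite inE.
  rewrite Bbig2 => /imsetP[v vB ->] /=.
  by rewrite blowK (B_child_X tP vB) blowD.
case=> [m|] V.
  rewrite Bbig2 => /imsetP[v vB ->] x y /=.
  rewrite blowK; case: x => [x|]; rewrite ?in_blow0 // in_blow => xX.
  case: y => [y|]; rewrite ?in_blow0 // in_blow => yX.
  rewrite !(ext_cls p) Bbranches2 (same_block_h (@blow_inj _ p)).
  exact: (B_child_sim tP vB).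
rewrite Bbig20 => /set1P -> x y /=.
case: x => [x|]; rewrite ?in_blow0 // in_blow => xX.
case: y => [y|]; rewrite ?in_blow0 // in_blow => yX.
rewrite !(ext_cls0 p t) lsim_root Bbranches20 (same_block_h (@set1_inj _)).
rewrite same_block_components ?inE //; last exact: stem_sym.
by rewrite -[RHS]/(connect (within _ _) _ _) stem_connect ?inE.
Qed.

Lemma Bext_between (m : ltau t) x y z :
  on_path (@Bedge _ Bext (Some m)) (@cls _ Bext (Some m) (Some x))
     (@cls _ Bext (Some m) (Some y)) (@cls _ Bext (Some m) (Some z)) <->
  on_path (Bedge m) (cls m (untwin p x)) (cls m (untwin p y)) (cls m (untwin p z)).
Proof.
rewrite !(ext_cls p).
exact: (on_path_h (@blow_inj _ p) (Bedge2_blow m) (@image_rel_codom _ _ _ _)).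
Qed.

Lemma Bext_split (m : ltau t) u x y z :
  in_distinct_blocks (@Bbranches _ Bext (Some m) (@cls _ Bext (Some m) (Some u)))
     (@cls _ Bext (Some m) (Some x)) (@cls _ Bext (Some m) (Some y))
     (@cls _ Bext (Some m) (Some z)) <->
  in_distinct_blocks (Bbranches m (cls m (untwin p u)))
     (cls m (untwin p x)) (cls m (untwin p y)) (cls m (untwin p z)).
Proof.
rewrite !(ext_cls p) Bbranches2.
exact: (in_distinct_blocks_h (@blow_inj _ p)).
Qed.

Lemma Bext_witness (m : ltau t) (s : Bsym) (a : seq (option A)) :
  @Bwitness _ Bext (Some m) s (map Some a) <-> Bwitness m s (map (untwin p) a).
Proof.
case: s; rewrite /Bwitness.
- case: a => [|x [|y [|z [|? ?]]]] //=.
  by rewrite Bext_between (ext_inequivalent p m [:: x; y; z]).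
- case: a => [|x [|y [|z [|w [|? ?]]]]] //=; split=> [[u]|[u]].
    case=> iu; have [u' Eu] := inequivalent_ext_Some iu (mem_last _ _).
    rewrite /= in Eu; rewrite {}Eu in iu *.
    move: iu => /(ext_inequivalent p m [:: x; y; z; w; u']) iu.
    move=> /Bext_between b1 /Bext_between b2 /Bext_between b3 /Bext_between b4.
    by exists (untwin p u').
  move=> [iu b1 b2 b3 b4]; exists (Some (Some u)); split; try exact/Bext_between.
  exact/(ext_inequivalent p m [:: x; y; z; w; Some u]).
case: a => [|x [|y [|z [|w [|? ?]]]]] //=; split=> [[u [v]]|[u [v]]].
  case=> iuv; have [v' Ev] := inequivalent_ext_Some iuv (mem_last _ _).
  have [u' Eu] : exists u', u = Some u'.
    by apply: (inequivalent_ext_Some iuv); rewrite !inE eqxx !orbT.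
  rewrite /= in Ev; rewrite {}Ev {}Eu in iuv *.
  move: iuv => /(ext_inequivalent p m [:: x; y; z; w; u'; v']) iuv.
  by move=> /Bext_split s1 /Bext_split s2; exists (untwin p u'), (untwin p v').
move=> [iuv s1 s2]; exists (Some (Some u)), (Some (Some v)); split;
  try exact/Bext_split.
exact/(ext_inequivalent p m [:: x; y; z; w; Some u; Some v]).
Qed.

Lemma Bext_witness0_L x y z : @Bwitness _ Bext None BL [:: x; y; z] <->
  [/\ x = None, y != None, z != None
     & untwin p (odflt None y) != untwin p (odflt None z)] \/
  x = Some (Some p) /\ uniq [:: x; y; z] /\ (y = Some None \/ z = Some None).
Proof.
have bE : on_path (@Bedge _ Bext None) (@cls _ lev None x) (@cls _ lev None y)
    (@cls _ lev None z) <-> on_path (stem p) x y z.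
  rewrite !(ext_cls0 p t).
  exact: (on_path_h (@set1_inj _) Bedge2_set1 (@image_rel_codom _ _ _ _)).
rewrite /Bwitness (ext_inequivalent0 p t); split=> [[u /bE/(stem_between p u)]|].
  by case=> [H|[H1 H2]]; [left|right].
move=> H; suff u : uniq [:: x; y; z].
  split=> //; apply/bE/(stem_between p u).
  by case: H => [H|[H1 [H2 H3]]]; [left|right].
case: H => [[-> y0 z0 ne]|[_ []//]].
rewrite /= !inE !negb_or ![None == _]eq_sym y0 z0 /= andbT.
by apply: contraNneq ne => ->.
Qed.

(** The new root level says nothing about the old points.  The interior vertices
    of a path are the centre and [p], and past [p] there is only the pendant
    vertex: this excludes [L] and [N].  The two vertices which [S] requires have
    three branches each, and only the centre does. *)
Lemma Bext_witness0 s (a : seq A) :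
  ~ @Bwitness _ Bext None s (map (fun x => Some (Some x)) a).
Proof.
have bE x y z : on_path (@Bedge _ Bext None) (@cls _ lev None x) (@cls _ lev None y)
    (@cls _ lev None z) <-> on_path (stem p) x y z.
  rewrite !(ext_cls0 p t).
  exact: (on_path_h (@set1_inj _) Bedge2_set1 (@image_rel_codom _ _ _ _)).
have sE u x y z : in_distinct_blocks (@Bbranches _ Bext None (@cls _ lev None u))
    (@cls _ lev None x) (@cls _ lev None y) (@cls _ lev None z) -> u = None.
  rewrite !(ext_cls0 p t) => -[C1 [C2 [C3 [[H1 H2 H3] _ _ _ U]]]].
  apply/eqP; rewrite -(stem_branches_big p u A3).
  have <- : #|@Bbranches _ Bext None [set u]| = #|branches [set: A2] (stem p) u|.
    by rewrite Bbranches20 card_imset //; apply/imset_inj/set1_inj.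
  apply/card_gt2P; exists C1, C2, C3; split=> //.
  move: U; rewrite /= !inE !negb_or !andbT => /andP[/andP[? ?] ?].
  by split=> //; rewrite eq_sym.
case: s.
- case: a => [|x [|y [|z [|? ?]]]] //; rewrite /= -/(Bwitness _ _ _).
  by move/Bext_witness0_L => [[]|[_ [_ []]]].
- case: a => [|x [|y [|z [|w [|? ?]]]]] //= [u].
  move=> [/(ext_inequivalent0 p t) U /bE b1 _ _ /bE b4].
  move: U; rewrite /= !inE !negb_or andbT.
  move=> /and4P[/and4P[xy _ _ xu] /and3P[_ _ yu] /andP[zw zu] wu].
  have U1 : uniq [:: Some (Some z); u; Some (Some w)].
    by rewrite /= !inE !negb_or zu zw [u == _]eq_sym wu.
  have [[]//|[_ [Eu|//]]] := (stem_between p U1).1 b4.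
  have U2 : uniq [:: u; Some (Some x); Some (Some y)].
    by rewrite /= !inE !negb_or ![u == _]eq_sym xu yu xy.
  rewrite Eu in b1 U2.
  by have [[]|[]] := (stem_between p U2).1 b1.
case: a => [|x [|y [|z [|w [|? ?]]]]] //= [u [v]].
case=> U /sE Eu /sE Ev.
move: U => /(ext_inequivalent0 p t).
by rewrite Eu Ev /= !inE ?eqxx !(orbT, andbF).
Qed.

Lemma Bext_embedding :
  embedding (Bstructure t) (Bstructure Bext) (fun a => Some (Some a)).
Proof.
split; first by move=> x y [].
have W s (a : seq A) : (exists mu, @Bwitness _ Bext mu s (map (fun x => Some (Some x)) a))
    <-> exists mu, @Bwitness _ t mu s a.
  have E : map (untwin p) (map Some a) = a by rewrite -map_comp map_id.
  split=> [[[m|]]|[m H]]; last 2 first.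
  - by move/Bext_witness0.
  - exists (Some m); rewrite (map_comp Some Some) Bext_witness E; exact: H.
  by rewrite (map_comp Some Some) Bext_witness E; exists m.
move=> s a; rewrite /Bstructure /Brelation; case: s a => [s|] a /=.
  by apply: iff_sym; exact: W.
case: a => -[|x [|y [|z [|w [|? ?]]]]] //= _.
have E : map (untwin p) (map Some [:: x; y; z]) = [:: x; y; z] by [].
split=> [[m [H w0]]|[[m|] [H w0]]].
- exists (Some m); split; last by rewrite in_blow.
  by apply/(Bext_witness m BL [:: Some x; Some y; Some z]).
- exists m; split; last by rewrite in_blow in w0.
  by move: H => /(Bext_witness m BL [:: Some x; Some y; Some z]).
by move: H => /(@Bext_witness0 BL [:: x; y; z]).
Qed.

End ExtB.

(** * Extending a tree of D-sets *)

Section Leafsets.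
Variables (X N : finType).

Definition leafset (C : {set X + N}) : {set X} := [set K | inl K \in C].

Variable e : rel (X + N).
Hypothesis e_sym : symmetric e.

Lemma same_block_leafset (D : {set X + N}) a b : inl a \in D -> inl b \in D ->
  same_block [set leafset C | C in components e D] a b =
  connect (within e D) (inl a) (inl b).
Proof.
move=> aD bD; rewrite -same_block_components //.
apply/existsP/existsP => [[_ /and3P[/imsetP[C CB ->]]]|[C /and3P[CB aC bC]]].
  by rewrite !inE => aC bC; exists C; apply/and3P.
by exists (leafset C); apply/and3P; rewrite !inE imset_f.
Qed.

Lemma in_distinct_blocks_leafset (D : {set X + N}) a b c :
  inl a \in D -> inl b \in D -> inl c \in D ->
  in_distinct_blocks [set leafset C | C in components e D] a b c <->
  [/\ ~~ connect (within e D) (inl a) (inl b),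
      ~~ connect (within e D) (inl a) (inl c)
    & ~~ connect (within e D) (inl b) (inl c)].
Proof.
move=> aD bD cD.
suff -> : in_distinct_blocks [set leafset C | C in components e D] a b c <->
    in_distinct_blocks (components e D) (inl a) (inl b) (inl c).
  by rewrite in_distinct_blocks_components //; split=> [[]|].
split.
  case=> _ [_ [_ [[/imsetP[C1 H1 ->] /imsetP[C2 H2 ->] /imsetP[C3 H3 ->]]]]].
  rewrite !inE => aC bC cC U; exists C1, C2, C3; split=> //.
  by apply: (@map_uniq _ _ leafset).
case=> [C1 [C2 [C3 [[H1 H2 H3] aC bC cC U]]]].
exists (leafset C1), (leafset C2), (leafset C3); split; rewrite ?inE //.
  by split; apply: imset_f.
have inj C C' x : C \in components e D -> C' \in components e D -> inl x \in C ->
    leafset C = leafset C' -> C = C'.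
  move=> HC HC' xC E; have xC' : inl x \in C'.
    by move: E => /setP/(_ x); rewrite !inE xC.
  by have [_ ->] := mem_component e_sym HC xC; have [_ ->] := mem_component e_sym HC' xC'.
move: U; rewrite /= !inE !negb_or !andbT => /andP[/andP[n12 n13] n23].
apply/andP; split; first (apply/andP; split).
- by apply: contra n12 => /eqP/(inj _ _ _ H1 H2 aC) ->.
- by apply: contra n13 => /eqP/(inj _ _ _ H1 H3 aC) ->.
- by apply: contra n23 => /eqP/(inj _ _ _ H2 H3 bC) ->.
Qed.

End Leafsets.

Section SproutD.
Variables (A : finType) (p : A).

Notation A2 := (option (option A)).
Notation V := (A2 + bool)%type.

(** The centre [inr true] is joined to every leaf except [p] and the new leaf
    [Some None]; these two hang from the node [inr false]. *)
Definition fork_parent (x : V) : V :=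
  match x with
  | inr _ => inr true
  | inl (Some None) => inr false
  | inl (Some (Some a)) => inr (a != p)
  | inl None => inr true
  end.

Definition fork_rank (x : V) : nat :=
  match x with inr true => 0 | inr false => 1 | inl _ => 2 end.

Lemma fork_rank_parent x : x != inr true -> fork_rank (fork_parent x) < fork_rank x.
Proof. by case: x => [[[a|]|]|[]] //= _; case: (a == p). Qed.

Definition fork : rel V := parent_edge (inr true) fork_parent.

Lemma fork_sym : symmetric fork. Proof. exact: parent_edge_sym. Qed.

Lemma fork_tree : is_tree [set: V] fork.
Proof. exact: (rooted_tree fork_rank_parent). Qed.

Lemma forkE x y : fork x y =
  match x, y with
  | inr b, inr b' => b != b'
  | inl (Some (Some a)), inr b | inr b, inl (Some (Some a)) => b == (a != p)
  | inl (Some None), inr b | inr b, inl (Some None) => ~~ b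
  | inl None, inr b | inr b, inl None => b
  | _, _ => false
  end.
Proof.
rewrite /fork /parent_edge.
have E (a b : bool) : (inr a == inr b :> V) = (a == b) by apply/eqP/eqP => [[]|->].
by case: x y => [[[a|]|]|[]] [[[b|]|]|[]] //=; rewrite ?E //=;
  case: (_ == p).
Qed.

Lemma fork_degree_leaf x : degree fork (inl x) = 1.
Proof.
rewrite /degree (_ : [set b | _] = [set fork_parent (inl x)]) ?cards1 //.
apply/setP => y; rewrite !inE forkE.
have E (a b : bool) : (inr a == inr b :> V) = (a == b) by apply/eqP/eqP => [[]|->].
by case: x y => [[a|]|] [y|b] //=; rewrite E //; case: b.
Qed.

Lemma fork_degree_u : degree fork (inr false) = 3.
Proof.
rewrite /degree (_ : [set b | _] = [set inr true; inl (Some None); inl (Some (Some p))]).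
  by rewrite setUC cardsU1 cards2 !inE.
apply/setP => y; rewrite !inE forkE; case: y => [[[a|]|]|[]] //=.
by case: (eqVneq a p) => [->|ap]; [rewrite eqxx|apply/esym/eqP => -[E]; rewrite E eqxx in ap].
Qed.

Lemma fork_degree_v : 2 < #|A| -> 2 < degree fork (inr true).
Proof.
move=> A3; have [a [b [ap bp ab]]] : exists a b, [/\ a != p, b != p & a != b].
  have [a [b [c [_ [ab bc ca]]]]] := card_gt2P A3.
  have [Ea|ap] := eqVneq a p.
    by exists b, c; rewrite -Ea ca eq_sym ab bc.
  have [Eb|bp] := eqVneq b p; last by exists a, b.
  by exists a, c; rewrite ap -Eb ![_ == c]eq_sym [c == b]eq_sym bc ca.
apply/card_gt2P; exists (inl None), (inl (Some (Some a))), (inl (Some (Some b))).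
rewrite !inE !forkE ap bp; split=> //; split=> //.
Qed.

Definition label_v (x : V) : option A :=
  match x with
  | inl None => None
  | inl (Some y) => Some (untwin p y)
  | inr b => if b then None else Some p
  end.

Definition label_u (x : V) : option bool :=
  match x with
  | inl (Some None) => Some false
  | inl (Some (Some a)) => if a == p then Some true else None
  | _ => None
  end.

Lemma fork_connect_v x y :
  connect (within fork ([set: V] :\ inr true)) (inl x) (inl y) =
  (label_v (inl x) == label_v (inl y)).
Proof.
pose hub (o : option A) : V := match o with
  | None => inl None
  | Some a => if a == p then inr false else inl (Some (Some a)) end.
apply: (connect_label (label := label_v) (hub := hub) (D := [set: V] :\ inr true));
  rewrite ?inE //.
- exact: within_connect_sym fork_sym _.
- move=> {x y} x y; rewrite /within /= !inE !andbT forkE => /and3P[].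
  by case: x => [[[a|]|]|[]] //=; case: y => [[[b|]|]|[]] //=;
    by case: (eqVneq _ p) => // ->.
move=> {y} {}x; rewrite !inE andbT; case: x => [[[a|]|]|[]] //= _.
- case: eqP => [->|_]; last exact: connect0.
  by apply: connect1; apply/and3P; rewrite forkE !inE eqxx.
- by rewrite /untwin /= eqxx; apply: connect1; apply/and3P; rewrite forkE !inE.
by rewrite eqxx; apply: connect0.
Qed.

Lemma fork_connect_u x y :
  connect (within fork ([set: V] :\ inr false)) (inl x) (inl y) =
  (label_u (inl x) == label_u (inl y)).
Proof.
pose hub (o : option bool) : V := match o with
  | None => inr true
  | Some true => inl (Some (Some p))
  | Some false => inl (Some None) end.
apply: (connect_label (label := label_u) (hub := hub) (D := [set: V] :\ inr false));
  rewrite ?inE //.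
- exact: within_connect_sym fork_sym _.
- move=> {x y} x y; rewrite /within /= !inE !andbT forkE => /and3P[].
  by case: x => [[[a|]|]|[]] //=; case: y => [[[b|]|]|[]] //=; case: (eqVneq _ p).
move=> {y} {}x; rewrite !inE andbT; case: x => [[[a|]|]|[]] //= _.
- case: (eqVneq a p) => [->|ap]; first exact: connect0.
  by apply: connect1; apply/and3P; rewrite forkE !inE ap.
- by apply: connect1; apply/and3P; rewrite forkE !inE.
Qed.

Definition fork_branches (b : bool) : {set {set A2}} :=
  [set leafset C | C in branches [set: V] fork (inr b)].

(** The branch [{p}] rather than that of the twin is special at the lower node, so
    that it is [p] which lies between the twin and any other point. *)
Definition fork_special (b : bool) : {set A2} :=
  [set if b then None else Some (Some p)].

Lemma fork_specialP b : fork_special b \in fork_branches b.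
Proof.
pose c : A2 := if b then None else Some (Some p).
apply/imsetP; exists (component fork ([set: V] :\ inr b) (inl c)).
  by apply: imset_f; rewrite !inE.
apply/setP => x; rewrite !inE /=; case: b @c => /=.
  by rewrite fork_connect_v; case: x => [[x|]|].
rewrite fork_connect_u /= eqxx; case: x => [[x|]|] //=.
case: (eqVneq x p) => [->|xp]; first by rewrite !eqxx.
by apply/negP => /eqP[] E; rewrite E eqxx in xp.
Qed.

Lemma fork_same_block_v x y :
  same_block (fork_branches true) x y = (label_v (inl x) == label_v (inl y)).
Proof. by rewrite same_block_leafset ?inE ?fork_connect_v //; exact: fork_sym. Qed.

Lemma fork_ram b x y z : in_distinct_blocks (fork_branches b) x y z <->
  if b then uniq (map label_v [:: inl x; inl y; inl z])
  else uniq (map label_u [:: inl x; inl y; inl z]).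
Proof.
rewrite in_distinct_blocks_leafset ?inE //; last exact: fork_sym.
rewrite !cons_uniq !inE !negb_or /=.
case: b; rewrite ?fork_connect_v ?fork_connect_u.
  by split=> [[-> ->]|/andP[/andP[-> ->] ]]; rewrite ?andbT // andbT.
by split=> [[-> ->]|/andP[/andP[-> ->] ]]; rewrite ?andbT // andbT.
Qed.

(** The lower node has three branches, one of which is special, so that no
    successor level is attached to it. *)
Lemma fork_big b : 2 < #|A| -> (2 < #|fork_branches b :\ fork_special b|) = b.
Proof.
move=> A3; case: b; last first.
  apply/negbTE; rewrite -leqNgt -ltnS.
  have <- : #|fork_branches false| = #|fork_branches false :\ fork_special false|.+1.
    by rewrite (cardsD1 (fork_special false)) fork_specialP.
  apply: leq_trans (leq_imset_card _ _) _.
  have [_ _ eP eC _] := fork_tree.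
  by rewrite -fork_degree_u (degree_ge_branches fork_sym).
have [a [b [c [_ [ab bc ca]]]]] := card_gt2P A3.
pose C x := leafset (component fork ([set: V] :\ inr true) (inl (Some (Some x)))).
have memC x y : (Some (Some y) \in C x) = (x == y).
  by rewrite !inE fork_connect_v /= /untwin /=; apply/eqP/eqP => [[]|->].
have CD x : C x \in fork_branches true :\ fork_special true.
  apply/setD1P; split; last by apply: imset_f; apply: imset_f; rewrite !inE.
  apply/eqP => E.
  by have := memC x x; rewrite eqxx E inE.
have CE x y : x != y -> C x != C y.
  by apply: contraNneq => E; rewrite -memC E memC.
by apply/card_gt2P; exists (C a), (C b), (C c); rewrite !CD !CE.
Qed.

(** The special branch plays the part of the deleted centre: the ternary relation
    is the one which the star with a pendant vertex gives. *)
Lemma fork_L x y z :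
  (uniq [:: x; y; z] /\ exists b, in_distinct_blocks (fork_branches b) x y z /\
     x \in fork_special b) <->
  [/\ x = None, y != None, z != None
     & untwin p (odflt None y) != untwin p (odflt None z)] \/
  x = Some (Some p) /\ uniq [:: x; y; z] /\ (y = Some None \/ z = Some None).
Proof.
split.
  move=> [U [[] [/fork_ram]]] /=; rewrite !inE !negb_or !andbT.
    move=> /andP[/andP[xy xz] yz] /eqP Ex; left; rewrite Ex in xy xz *.
    by case: y z xy xz yz {U} => [y|] [z|].
  move=> H /eqP Ex; right; split=> //; split; first by move: U; rewrite /= !inE !negb_or !andbT.
  move: H; rewrite {}Ex in U *; rewrite /= eqxx.
  by case: y z U => [[y|]|] [[z|]|] _ //; do ?[by left|by right];
    try case: (y == p); try case: (z == p).
case=> [[-> y0 z0 ne]|[Ex [U H]]].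
  split.
    rewrite /= !inE !negb_or ![None == _]eq_sym y0 z0 /= andbT.
    by apply: contraNneq ne => ->.
  exists true; split; last by rewrite inE.
  apply/fork_ram; case: y z y0 z0 ne => [y|] [z|] //= _ _ ne.
  by rewrite !inE /= andbT; apply: contra ne => /eqP[->].
rewrite Ex in U *; split=> //; exists false; split; last by rewrite inE.
apply/fork_ram; rewrite /= eqxx.
have nz a : Some (Some p) != Some (Some a) :> A2 -> (a == p) = false.
  by move=> ne; apply: contraNF ne => /eqP ->.
move: U; rewrite /= !inE !negb_or !andbT => /andP[/andP[px pz] yz].
case: H => E; rewrite E in px pz yz *.
  by case: z pz yz {E} => [[z|]|] //= pz _; rewrite nz.
by case: y px yz {E} => [[y|]|] //= px _; rewrite nz.
Qed.

Lemma fork_centre x y : x != y ->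
  on_path fork (inr true) (inl (Some (Some x))) (inl (Some (Some y))).
Proof.
wlog yp : x y / y != p => [H xy|xy].
  have [Ey|] := eqVneq y p; last by move=> yp; apply: H.
  apply: (on_path_sym fork_sym); apply: H; rewrite -?Ey // eq_sym //.
have [Ex|xp] := eqVneq x p.
  exists [:: inr false; inr true; inl (Some (Some y))]; split=> //=.
  - by rewrite !forkE Ex eqxx yp.
  - by rewrite !inE /= andbT; apply: contra xy => /eqP[->].
exists [:: inr true; inl (Some (Some y))]; split=> //=.
- by rewrite !forkE xp yp.
- by rewrite !inE /= andbT; apply: contra xy => /eqP[->].
Qed.

End SproutD.

Section SumMap.
Variables (X Y N : finType) (h : X -> Y).
Hypothesis h_inj : injective h.

Definition leaf_map (a : X + N) : Y + N :=
  match a with inl K => inl (h K) | inr n => inr n end.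

Lemma leaf_map_inj : injective leaf_map.
Proof. by move=> [K|n] [K'|n'] //= [E]; [rewrite (h_inj E)|rewrite E]. Qed.

Lemma leafset_leaf_map (C : {set X + N}) :
  leafset (leaf_map @: C) = h @: leafset C.
Proof.
apply/setP => K; rewrite inE; apply/imsetP/imsetP => [[[K'|n] KC]|[K']].
- by move=> [->]; exists K'; rewrite // inE.
- by [].
by rewrite inE => KC ->; exists (inl K').
Qed.

End SumMap.

Section ExtD.
Variables (A : finType) (p : A) (t : Ddata A).
Hypothesis tP : is_Dtree t.

Notation A2 := (option (option A)).

Let lev := ext_levels p t.

Let A3 : 2 < #|A|. Proof. exact: D_card tP. Qed.

Definition Dnode2 (mu : ltau lev) : finType :=
  match mu with Some m => Dnode m | None => bool end.

Definition Dedge2 (mu : ltau lev) : rel ({set A2} + Dnode2 mu)%type :=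
  match mu with
  | Some m => image_rel (leaf_map (blow p)) (Dedge m)
  | None => image_rel (leaf_map set1) (fork p)
  end.

Definition Dspecial2 (mu : ltau lev) : Dnode2 mu -> {set {set A2}} :=
  match mu with
  | Some m => fun n => [set blow p C | C in Dspecial n]
  | None => fun b => set1 @: fork_special p b
  end.

Definition Dchild2 (mu : ltau lev) : Dnode2 mu -> ltau lev :=
  match mu with
  | Some m => fun n => Some (Dchild n)
  | None => fun _ => Some \bot%O
  end.

Definition Dext : Ddata A2 := @DData A2 lev Dnode2 Dedge2 Dspecial2 Dchild2.

Notation hblow m := (@leaf_map {set A} {set A2} (@Dnode A t m) (blow p)).
Notation hset1 := (@leaf_map A2 {set A2} bool set1).

Lemma hblow_inj m : injective (hblow m). Proof. exact/leaf_map_inj/blow_inj. Qed.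
Lemma hset1_inj : injective hset1. Proof. exact/leaf_map_inj/set1_inj. Qed.

Lemma Dedge2_blow m a b : @Dedge2 (Some m) (hblow m a) (hblow m b) = Dedge m a b.
Proof. exact/image_relE/hblow_inj. Qed.

Lemma Dedge2_set1 a b : @Dedge2 None (hset1 a) (hset1 b) = fork p a b.
Proof. exact/image_relE/hset1_inj. Qed.

Lemma leaf_map_verts (X Y N : finType) (h : X -> Y) (S : {set X}) :
  [set inl K | K in h @: S] :|: [set inr n | n in [set: N]] =
  @leaf_map X Y N h @: ([set inl K | K in S] :|: [set inr n | n in [set: N]]).
Proof. by rewrite imsetU -!imset_comp. Qed.

Lemma Dverts2 (m : ltau t) : @Dverts _ Dext (Some m) = hblow m @: Dverts m.
Proof. by rewrite /Dverts /Dleaves (ext_classes p m) leaf_map_verts. Qed.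

Lemma Dleaves2 (m : ltau t) : @Dleaves _ Dext (Some m) = hblow m @: Dleaves m.
Proof. by rewrite /Dleaves (ext_classes p m) -!imset_comp. Qed.

Lemma Dleaves20 : @Dleaves _ Dext None = hset1 @: [set inl K | K in [set: A2]].
Proof. by rewrite /Dleaves (ext_classes0 p t) -!imset_comp. Qed.

Lemma Dverts20 : @Dverts _ Dext None = hset1 @: [set: A2 + bool].
Proof.
rewrite /Dverts /Dleaves (ext_classes0 p t) leaf_map_verts.
suff -> : [set inl K | K in [set: A2]] :|: [set inr n | n in [set: bool]] =
  [set: A2 + bool] by [].
by apply/setP => -[x|b]; rewrite !inE imset_f ?inE ?orbT.
Qed.

Lemma Dbranches2 (m : ltau t) (n : Dnode m) : @Dbranches _ Dext (Some m) n =
  [set blow p @: (C : {set {set A}}) | C in Dbranches n].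
Proof.
rewrite /Dbranches Dverts2.
have := branches_h (@hblow_inj m) (@Dedge2_blow m) (Dverts m) (inr n).
rewrite [hblow m (inr n)]/= => ->.
rewrite -[LHS]imset_comp -[RHS]imset_comp; apply: eq_imset => C /=.
exact: leafset_leaf_map.
Qed.

Lemma Dbranches20 b : @Dbranches _ Dext None b =
  [set set1 @: (C : {set A2}) | C in fork_branches p b].
Proof.
rewrite /Dbranches Dverts20.
have := branches_h hset1_inj Dedge2_set1 [set: A2 + bool] (inr b).
rewrite [hset1 (inr b)]/= => ->.
rewrite -[LHS]imset_comp -[RHS]imset_comp; apply: eq_imset => C /=.
exact: leafset_leaf_map.
Qed.

Lemma Dbig2 (m : ltau t) : @Dbig _ Dext (Some m) = Dbig m.
Proof.
apply/setP => n; rewrite !inE Dbranches2 [Dspecial _]/=.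
have bI : injective (fun C : {set {set A}} => blow p @: C).
  exact/imset_inj/blow_inj.
by rewrite -(imset_setD1 bI) card_imset.
Qed.

Lemma Dbig20 : @Dbig _ Dext None = [set true].
Proof.
apply/setP => b; rewrite !inE Dbranches20 [Dspecial _]/=.
have bI : injective (fun C : {set A2} => set1 @: C).
  exact/imset_inj/set1_inj.
by rewrite -(imset_setD1 bI) card_imset // fork_big // eqb_id.
Qed.

Lemma Dext_tree : is_Dtree Dext.
Proof.
have cA2 : 2 < #|{: A2}| by rewrite !card_option !ltnS; apply: ltnW (ltnW A3).
split.
- exact: cA2.
- case=> [m|].
    by rewrite (ext_classes p m) card_imset; [exact: D_classes tP m|exact: blow_inj].
  by rewrite (ext_classes0 p t) card_imset ?cardsT //; exact: set1_inj.
- case=> [m|].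
    rewrite Dverts2.
    exact: (tree_h (@hblow_inj m) (@Dedge2_blow m) (@image_rel_codom _ _ _ _)
      (D_tree tP m)).
  rewrite Dverts20.
  exact: (tree_h hset1_inj Dedge2_set1 (@image_rel_codom _ _ _ _) (fork_tree p)).
- case=> [m|].
    rewrite Dverts2 => _ /imsetP[a aP ->].
    rewrite (degree_h (@hblow_inj m) (@Dedge2_blow m) (@image_rel_codom _ _ _ _)).
    exact: D_degree tP _ _ aP.
  rewrite Dverts20 => _ /imsetP[a aP ->].
  rewrite (degree_h hset1_inj Dedge2_set1 (@image_rel_codom _ _ _ _)).
  case: a aP => [x|[]] _; rewrite ?fork_degree_leaf ?fork_degree_u //.
  by rewrite gtn_eqF // fork_degree_v.
- case=> [m|].
    rewrite Dleaves2 -(D_leaves tP m) Dverts2; apply/setP => a; rewrite inE.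
    have dE := degree_h (@hblow_inj m) (@Dedge2_blow m) (@image_rel_codom _ _ _ _).
    apply/andP/imsetP => [[/imsetP[b bV ->]]|[b]].
      by rewrite dE => d1; exists b; rewrite // inE bV.
    by rewrite inE => /andP[bV d1] ->; rewrite dE imset_f.
  rewrite Dleaves20 Dverts20; apply/setP => a; rewrite inE.
  have dE := degree_h hset1_inj Dedge2_set1 (@image_rel_codom _ _ _ _).
  apply/andP/imsetP => [[/imsetP[b bV ->]]|[_ /imsetP[x _ ->] ->]].
    rewrite dE => d1; exists b => //; case: b d1 {bV} => [x|[]].
    - by rewrite imset_f.
    - by have := fork_degree_v p A3; case: (degree _ _) => [|[|?]].
    - by rewrite fork_degree_u.
  by rewrite dE fork_degree_leaf imset_f.
- case=> [m|] n.
    by rewrite Dbranches2; apply: imset_f; apply: D_special.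
  by rewrite Dbranches20; apply: imset_f; apply: fork_specialP.
- case=> [m|].
    by rewrite Dbig2 => n n' nB n'B [] /(D_child_inj tP nB n'B).
  by rewrite Dbig20 => b b' /set1P -> /set1P ->.
- case=> [m|].
    rewrite Dbig2; apply/setP => nu; rewrite inE (immediate_succ_ext).
    have -> : [set @Dchild _ Dext (Some m) n | n in Dbig m] =
        [set Some n | n in [set n | immediate_succ m n]].
      by rewrite -(D_child_succ tP m) -imset_comp.
    apply/imsetP/idP => [[n]|]; first by rewrite inE => ? ->.
    by case: nu => // n H; exists n; rewrite // inE.
  rewrite Dbig20 imset_set1; apply/setP => nu.
  by rewrite !inE immediate_succ_ext0.
- case=> [m|] n.
    rewrite Dbig2 => nB /=; rewrite (D_child_X tP nB); apply/setP => -[y|].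
      by rewrite !inE (ext_cls p) mem_imset //; exact: blow_inj.
    by rewrite !inE.
  rewrite Dbig20 => /set1P -> /=; apply/setP => -[y|].
    rewrite !inE lX_root inE (ext_cls0 p t) imset_set1 inE.
    by apply/esym/eqP => /set1_inj.
  by rewrite !inE (ext_cls0 p t) imset_set1 inE eqxx.
case=> [m|] n.
  rewrite Dbig2 => nB x y /=.
  case: x => [x|]; rewrite ?in_blow0 // in_blow => xX.
  case: y => [y|]; rewrite ?in_blow0 // in_blow => yX.
  rewrite !(ext_cls p) Dbranches2 (same_block_h (@blow_inj _ p)).
  exact: (D_child_sim tP nB).
rewrite Dbig20 => /set1P -> x y /=.
case: x => [x|]; rewrite ?in_blow0 // in_blow => xX.
case: y => [y|]; rewrite ?in_blow0 // in_blow => yX.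
rewrite !(ext_cls0 p t) lsim_root Dbranches20 (same_block_h (@set1_inj _)).
rewrite fork_same_block_v /=.
by apply/eqP/eqP => [->|[]].
Qed.

Lemma Dext_ram (m : ltau t) (n : Dnode m) x y z :
  is_ram (n : @Dnode _ Dext (Some m)) (@cls _ Dext (Some m) (Some x))
     (@cls _ Dext (Some m) (Some y)) (@cls _ Dext (Some m) (Some z)) <->
  is_ram n (cls m (untwin p x)) (cls m (untwin p y)) (cls m (untwin p z)).
Proof.
rewrite /is_ram !(ext_cls p) Dbranches2.
exact: (in_distinct_blocks_h (@blow_inj _ p)).
Qed.

Lemma Dext_between (m : ltau t) a x y :
  on_path (@Dedge _ Dext (Some m)) (hblow m a)
    (inl (@cls _ Dext (Some m) (Some x))) (inl (@cls _ Dext (Some m) (Some y))) <->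
  on_path (Dedge m) a (inl (cls m (untwin p x))) (inl (cls m (untwin p y))).
Proof.
rewrite !(ext_cls p).
exact: (on_path_h (@hblow_inj m) (@Dedge2_blow m) (@image_rel_codom _ _ _ _)
  a (inl _) (inl _)).
Qed.

Lemma on_path_codom (m : ltau t) a x y :
  on_path (@Dedge _ Dext (Some m)) a
    (inl (@cls _ Dext (Some m) (Some x))) (inl (@cls _ Dext (Some m) (Some y))) ->
  exists a', a = hblow m a'.
Proof.
rewrite !(ext_cls p) => -[s [ps _ _]].
have [s0 Es] := path_codom (@image_rel_codom _ _ _ _) ps.
rewrite Es inE => /orP[/eqP ->|/mapP[a' _ ->]]; last by exists a'.
by exists (inl (cls m (untwin p x))).
Qed.

Lemma Dext_witness (m : ltau t) (s : Dsym) (a : seq (option A)) :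
  @Dwitness _ Dext (Some m) s (map Some a) <-> Dwitness m s (map (untwin p) a).
Proof.
case: s; rewrite /Dwitness.
- case: a => [|x [|y [|z [|? ?]]]] //=.
  split=> -[iu [n [r sp]]]; split.
  + by move/(ext_inequivalent p m [:: x; y; z]): iu.
  + exists n; split; first exact: (Dext_ram n x y z).1 r.
    by move: sp; rewrite (ext_cls p) mem_imset //; exact: blow_inj.
  + exact/(ext_inequivalent p m [:: x; y; z]).
  + exists n; split; first exact: (Dext_ram n x y z).2 r.
    by rewrite (ext_cls p) imset_f.
case: a => [|x [|y [|z [|w [|? ?]]]]] //=.
split=> -[iu H]; split.
- by move/(ext_inequivalent p m [:: x; y; z; w]): iu.
- move=> a [b1 b2]; apply: (H (hblow m a)); split.
    exact: (Dext_between a x y).2 b1.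
  exact: (Dext_between a z w).2 b2.
- exact/(ext_inequivalent p m [:: x; y; z; w]).
move=> a [b1 b2]; have [a' Ea] := on_path_codom b1; rewrite {}Ea in b1 b2.
apply: (H a'); split; first exact: (Dext_between a' x y).1 b1.
exact: (Dext_between a' z w).1 b2.
Qed.

Lemma Dext_witness0_L x y z : @Dwitness _ Dext None DL [:: x; y; z] <->
  [/\ x = None, y != None, z != None
     & untwin p (odflt None y) != untwin p (odflt None z)] \/
  x = Some (Some p) /\ uniq [:: x; y; z] /\ (y = Some None \/ z = Some None).
Proof.
rewrite -fork_L /Dwitness (ext_inequivalent0 p t).
have ramE b : is_ram (b : @Dnode _ Dext None) (@cls _ lev None x) (@cls _ lev None y)
    (@cls _ lev None z) <-> in_distinct_blocks (fork_branches p b) x y z.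
  rewrite /is_ram !(ext_cls0 p t) Dbranches20.
  exact: (in_distinct_blocks_h (@set1_inj _)).
have spE b : (@cls _ lev None x \in @Dspecial _ Dext None b) = (x \in fork_special p b).
  by rewrite (ext_cls0 p t) [Dspecial _]/= mem_imset //; exact: set1_inj.
split=> -[U [b [r s]]]; split=> //; exists b; split.
- exact/ramE.
- by rewrite -spE.
- exact/ramE.
- by rewrite spE.
Qed.

(** The new root level says nothing about the old points: two paths between old
    points meet at the centre; and [L] there needs either the apex, whose branch
    is the special one at the centre, or the twin, without which no three points
    ramify at the lower node. *)
Lemma Dext_witness0 s (a : seq A) :
  ~ @Dwitness _ Dext None s (map (fun x => Some (Some x)) a).
Proof.
case: s.
  case: a => [|x [|y [|z [|? ?]]]] //.
  by move/Dext_witness0_L => [[]|[_ [_ []]]].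
case: a => [|x [|y [|z [|w [|? ?]]]]] //= [/(ext_inequivalent0 p t) U].
move=> /(_ (inr true)); apply.
rewrite !(ext_cls0 p t).
have oE x' y' : x' != y' -> on_path (Dedge2 (mu := None)) (inr true)
    (inl [set Some (Some x')]) (inl [set Some (Some y')]).
  move=> /(fork_centre p).
  exact: (on_path_h hset1_inj Dedge2_set1 (@image_rel_codom _ _ _ _)
    (inr true) (inl _) (inl _)).2.
move: U; rewrite /= !inE !negb_or => /and4P[/and3P[xy _ _] _ zw _].
split; apply: oE; [by apply: contra xy => /eqP ->|].
by apply: contra zw => /eqP ->.
Qed.

Lemma Dext_embedding :
  embedding (Dstructure t) (Dstructure Dext) (fun a => Some (Some a)).
Proof.
split; first by move=> x y [].
pose f (x : A) : A2 := Some (Some x).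
have W s m (a : seq A) : @Dwitness _ Dext (Some m) s (map f a) <-> Dwitness m s a.
  rewrite /f (map_comp Some Some) Dext_witness -map_comp.
  by have -> : map (untwin p \o Some) a = a by rewrite map_id.
have W0 s (a : seq A) : ~ @Dwitness _ Dext None s (map f a) := @Dext_witness0 s a.
move=> s a; rewrite /Dstructure /Drelation; case: s a => [s| | | |] a /=.
- split=> [[m H]|[[m|] H]]; last 1 first.
  + by case: (W0 s a).
  + by exists (Some m); apply/W.
  by exists m; apply/W.
- case: a => -[|x [|y [|z [|w [|? ?]]]]] //= _.
  split=> [[m [H w0]]|[[m|] [H w0]]].
  + by exists (Some m); split; [apply/(W DL m [:: x; y; z])|rewrite in_blow].
  + by exists m; split; [apply/(W DL m [:: x; y; z])|rewrite in_blow in w0].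
  by case: (W0 DL [:: x; y; z]).
- case: a => -[|x [|y [|z [|w [|u [|? ?]]]]]] //= _.
  split=> [[m [H w0]]|[[m|] [H w0]]].
  + by exists (Some m); split; [apply/(W DS m [:: x; y; z; w])|rewrite in_blow].
  + by exists m; split; [apply/(W DS m [:: x; y; z; w])|rewrite in_blow in w0].
  by case: (W0 DS [:: x; y; z; w]).
- case: a => -[|x [|y [|z [|u [|v [|w [|? ?]]]]]]] //= _.
  split=> [[m [H1 H2]]|[[m|] [H1 H2]]].
  + by exists (Some m); split; [apply/(W DL m [:: x; y; z])|apply/(W DL m [:: u; v; w])].
  + by exists m; split; [apply/(W DL m [:: x; y; z])|apply/(W DL m [:: u; v; w])].
  by case: (W0 DL [:: x; y; z]).
case: a => -[|x [|y [|z [|w [|u [|v [|s [|? ?]]]]]]]] //= _.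
split=> [[m [H1 H2]]|[[m|] [H1 H2]]].
- by exists (Some m); split;
    [apply/(W DS m [:: x; y; z; w])|apply/(W DL m [:: u; v; s])].
- by exists m; split; [apply/(W DS m [:: x; y; z; w])|apply/(W DL m [:: u; v; s])].
by case: (W0 DL [:: u; v; s]).
Qed.

End ExtD.

From mathcomp Require Import all_classical all_reals all_analysis.

Local Open Scope classical_set_scope.
Local Open Scope card_scope.

(** * The extension property of the limits *)

Section Twin.
Variables (T : Type) (L : T -> T -> T -> Prop).

(** Adding the apex [c] and the twin [q] of [p] to [F].  For [c] the points [q] and
    [p] are one and the same; for all other points [q] is the part of [p] which is
    turned away from them. *)
Record twin_over (F : set T) (p c q : T) : Prop := TwinOver {
  apex_new : ~ F c;
  twin_new : ~ F q;
  apex_neq_twin : c <> q;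
  apex_old_old : forall y z, F y -> F z -> (L c y z <-> y <> z);
  apex_twin_old : forall y, F y -> (L c q y <-> y <> p);
  old_apex_old : forall y z, F y -> F z -> ~ L y c z;
  old_apex_twin : forall y, F y -> (L y c q <-> y = p);
  twin_apex_old : forall y, F y -> ~ L q c y;
  twin_old_old : forall y z, F y -> F z -> (L q y z <-> L p y z);
  old_twin_old : forall x z, F x -> F z -> (L x q z <-> (x = p /\ z <> p) \/ L x p z)
}.

Definition ternary_sym : Prop := forall x y z, L x y z -> L x z y.

Definition ternary_distinct : Prop :=
  forall x y z, L x y z -> [/\ x <> y, x <> z & y <> z].

Lemma twin_over_sub (F G : set T) p c q :
  F `<=` G -> twin_over G p c q -> twin_over F p c q.
Proof.
move=> FG [H1 H2 H3 H4 H5 H6 H7 H8 H9 H10].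
by split; auto.
Qed.

End Twin.

Lemma twin_over_embedding (T U : Type) (L : T -> T -> T -> Prop)
    (L' : U -> U -> U -> Prop) (f : U -> T) (F : set U) p c q :
  injective f -> (forall x y z, L (f x) (f y) (f z) <-> L' x y z) -> F p ->
  twin_over L' F p c q -> twin_over L (f @` F) (f p) (f c) (f q).
Proof.
move=> fI fL Fp [H1 H2 H3 H4 H5 H6 H7 H8 H9 H10].
have fE x y : f x = f y <-> x = y by split=> [/fI|->].
split.
- by move=> [x Fx /fI E]; apply: H1; rewrite -E.
- by move=> [x Fx /fI E]; apply: H2; rewrite -E.
- by move/fI.
- by move=> _ _ [y Fy <-] [z Fz <-]; rewrite fL fE; exact: H4.
- by move=> _ [y Fy <-]; rewrite fL fE; exact: H5.
- by move=> _ _ [y Fy <-] [z Fz <-]; rewrite fL; exact: H6.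
- by move=> _ [y Fy <-]; rewrite fL fE; exact: H7.
- by move=> _ [y Fy <-]; rewrite fL; exact: H8.
- by move=> _ _ [y Fy <-] [z Fz <-]; rewrite !fL; exact: H9.
by move=> _ _ [y Fy <-] [z Fz <-]; rewrite !fL !fE; exact: H10.
Qed.

Section Ternary.
Variables (Lg : language) (s : Lg) (ar : arity s = 3).

Definition ternary (T : Type) (M : structure Lg T) (x y z : T) : Prop :=
  M s (tcast (esym ar) [tuple x; y; z]).

Lemma map_tcast (T U : Type) (f : T -> U) m n (e : m = n) (u : m.-tuple T) :
  map_tuple f (tcast e u) = tcast e (map_tuple f u).
Proof. by case: n / e. Qed.

Lemma map_tuple3 (T U : Type) (f : T -> U) x y z :
  map_tuple f [tuple x; y; z] = [tuple f x; f y; f z].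
Proof. exact: val_inj. Qed.

Lemma ternary_embedding (T U : Type) (M : structure Lg T) (N : structure Lg U) f :
  embedding M N f -> forall x y z, ternary N (f x) (f y) (f z) <-> ternary M x y z.
Proof.
by move=> [_ fL] x y z; rewrite /ternary fL map_tcast map_tuple3.
Qed.

Variable K : forall U : Type, structure Lg U -> Prop.

Definition iso_closed : Prop := forall (U V : Type) (N : structure Lg U)
  (N' : structure Lg V), K N -> isomorphic N N' -> K N'.

(** With fewer than three points the centre of the new level would have too few
    branches to carry a successor. *)
Definition twin_class : Prop := forall (U : Type) (N : structure Lg U), K N ->
  (exists x y z : U, [/\ x <> y, y <> z & z <> x]) -> forall p : U,
  exists (U' : Type) (N' : structure Lg U') (i : U -> U') (c q : U'),
    [/\ K N', embedding N N' i & twin_over (ternary N') (range i) (i p) c q].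

Definition class_ternary_sym : Prop := forall (U : Type) (N : structure Lg U),
  K N -> ternary_sym (ternary N).

Definition class_ternary_distinct : Prop := forall (U : Type) (N : structure Lg U),
  K N -> ternary_distinct (ternary N).

Hypothesis K_iso : iso_closed.

Variables (T : Type) (M : structure Lg T).
Hypothesis MK : is_Fraisse_limit K M.

Lemma induced_embedding (S : set T) : embedding (Defs.induced M S) M val.
Proof. by split=> // x y /val_inj. Qed.

Lemma embedding_comp (L' : language) (X Y Z : Type) (N1 : structure L' X)
    (N2 : structure L' Y) (N3 : structure L' Z) f g :
  embedding N1 N2 f -> embedding N2 N3 g -> embedding N1 N3 (g \o f).
Proof.
move=> [fI fE] [gI gE]; split; first exact: inj_comp.
move=> r a; rewrite fE gE.
by have -> : map_tuple (g \o f) a = map_tuple g (map_tuple f a)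
  by apply: val_inj; rewrite /= map_comp.
Qed.

(** Embeddings into the limit can be chosen over a given finite substructure of
    the class: universality gives some copy, homogeneity moves it. *)
Lemma Fraisse_extension (S : set T) (U : Type) (N : structure Lg U)
    (i : set_type S -> U) :
  finite_set S -> K (Defs.induced M S) -> K N -> embedding (Defs.induced M S) N i ->
  exists2 f, embedding N M f & forall x, f (i x) = val x.
Proof.
move=> Sfin KS KN iE.
have [f fE] := Fraisse_universal MK KN.
have [hI hE] := embedding_comp iE fE.
pose h := f \o i; pose S1 : set T := range h.
have hS1 x : h x \in S1 by apply/mem_set; exists x.
pose h1 (x : set_type S) : set_type S1 := exist _ (h x) (hS1 x).
have /choice[h2 h2P] : forall y : set_type S1, exists x, h x = val y.
  by move=> [y yS1]; have [x _ E] := set_mem yS1; exists x; exact: E.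
have h12 : cancel h1 h2 by move=> x; apply: hI; exact: h2P (h1 x).
have h21 : cancel h2 h1 by move=> y; apply: val_inj; exact: h2P.
have h2E : embedding (Defs.induced M S1) (Defs.induced M S) h2.
  split; first exact: can_inj h21.
  move=> r a; rewrite hE /Defs.induced.
  by have -> : map_tuple h (map_tuple h2 a) = map_tuple val a
    by apply: val_inj; rewrite /= -map_comp; apply: eq_map => y /=; exact: h2P.
have h1E : embedding (Defs.induced M S) (Defs.induced M S1) h1.
  split; first exact: can_inj h12.
  move=> r a; rewrite hE /Defs.induced.
  by have -> : map_tuple val (map_tuple h1 a) = map_tuple h a
    by apply: val_inj; rewrite /= -map_comp; apply: eq_map.
have S1fin : finite_set S1.
  by apply: finite_image; rewrite (eq_finite_set (card_setT S)).
have [] := Fraisse_homogeneous MK S1fin Sfin _ KS (f := h2).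
- by apply: K_iso KS _; exists h1; split=> //; exists h2.
- by split=> //; exists h1.
move=> g [gB gE] gP; exists (g \o f); first exact: embedding_comp fE gE.
by move=> x; rewrite -[LHS]/(g (val (h1 x))) gP h12.
Qed.

Hypothesis K_twin : twin_class.

Lemma Fraisse_twin (F : set T) p : finite_set F -> F p ->
  exists c q, twin_over (ternary M) F p c q.
Proof.
move=> Ffin Fp.
have [x [y [z [xy yz zx]]]] : exists x y z : T, [/\ x <> y, y <> z & z <> x].
  have /card_set_bijP[f [_ _ fS]] := Fraisse_countable MK.
  have /choice[g gP] : forall n, exists x, f x = n.
    by move=> n; have [x _ E] := fS n I; exists x.
  by exists (g 0%N), (g 1%N), (g 2%N); split=> E;
    have := congr1 f E; rewrite !gP.
(* the three points make the substructure large enough for [twin_class] *)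
have Gfin : finite_set (F `|` [set x] `|` [set y] `|` [set z]).
  by rewrite !finite_setU; do !split=> //; exact: finite_set1.
have [S [Sfin FS KS]] := Fraisse_age MK Gfin.
have inS u : (F `|` [set x] `|` [set y] `|` [set z]) u -> u \in S.
  by move=> /FS /mem_set.
have three : exists x y z : set_type S, [/\ x <> y, y <> z & z <> x].
  have Sx : x \in S by apply: inS; left; left; right.
  have Sy : y \in S by apply: inS; left; right.
  have Sz : z \in S by apply: inS; right.
  exists (exist _ x Sx), (exist _ y Sy), (exist _ z Sz).
  by split=> -[].
have Sp : p \in S by apply: inS; do 3!left.
have [U [N [i [c [q [KN iE tw]]]]]] := K_twin KS three (exist _ p Sp).
have [f fE fP] := Fraisse_extension Sfin KS KN iE.
exists (f c), (f q).
have ip : range i (i (exist _ p Sp)) by exists (exist _ p Sp).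
have := twin_over_embedding fE.1 (ternary_embedding fE) ip tw.
rewrite fP; apply: twin_over_sub => u Fu.
have Su : u \in S by apply: inS; do 3!left.
by exists (i (exist _ u Su)); [exists (exist _ u Su)|rewrite fP].
Qed.

Lemma Fraisse_inhabited : inhabited T.
Proof.
have /card_set_bijP[f [_ _ fS]] := Fraisse_countable MK.
by have [x _ _] := fS 0%N I; exists.
Qed.

Lemma Fraisse_sym : class_ternary_sym -> ternary_sym (ternary M).
Proof.
move=> Ksym x y z.
have Gfin : finite_set ([set x] `|` [set y] `|` [set z]).
  by rewrite !finite_setU; do !split=> //; exact: finite_set1.
have [S [_ FS KS]] := Fraisse_age MK Gfin.
have Sx : x \in S by apply/mem_set/FS; left; left.
have Sy : y \in S by apply/mem_set/FS; left; right.
have Sz : z \in S by apply/mem_set/FS; right.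
have E := ternary_embedding (induced_embedding S).
move=> /(E (exist _ x Sx) (exist _ y Sy) (exist _ z Sz)).
by move=> /(Ksym _ _ KS)/E.
Qed.

Lemma Fraisse_distinct : class_ternary_distinct -> ternary_distinct (ternary M).
Proof.
move=> Kdist x y z.
have Gfin : finite_set ([set x] `|` [set y] `|` [set z]).
  by rewrite !finite_setU; do !split=> //; exact: finite_set1.
have [S [_ FS KS]] := Fraisse_age MK Gfin.
have Sx : x \in S by apply/mem_set/FS; left; left.
have Sy : y \in S by apply/mem_set/FS; left; right.
have Sz : z \in S by apply/mem_set/FS; right.
have E := ternary_embedding (induced_embedding S).
move=> /(E (exist _ x Sx) (exist _ y Sy) (exist _ z Sz)) /(Kdist _ _ KS) [xy xz yz].
by split=> e; [apply: xy|apply: xz|apply: yz]; apply: val_inj.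
Qed.

End Ternary.

Lemma ext_twin_over (A : finType) (p : A) (L : A -> A -> A -> Prop)
    (L2 : option (option A) -> option (option A) -> option (option A) -> Prop) :
  (forall x y z, L2 x y z <->
    ([/\ x = None, y != None, z != None
       & untwin p (odflt None y) != untwin p (odflt None z)] \/
     x = Some (Some p) /\ uniq [:: x; y; z] /\ (y = Some None \/ z = Some None)) \/
    exists x' y' z', [/\ x = Some x', y = Some y', z = Some z'
      & L (untwin p x') (untwin p y') (untwin p z')]) ->
  twin_over L2 (range (fun a => Some (Some a))) (Some (Some p)) None (Some None).
Proof.
move=> H; split; try by [|move=> []].
- move=> _ _ [y _ <-] [z _ <-]; rewrite H; split.
    by case=> [[[_ _ _ /eqP yz]|[]//]|[? [? [? []]]]//] [].
  by move=> yz; left; left; split=> //=; apply/eqP => yz'; apply: yz; congr (Some (Some _)).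
- move=> _ [y _ <-]; rewrite H; split.
    by case=> [[[_ _ _ /= /eqP py]|[]//]|[? [? [? []]]]//] -[] E; apply: py; rewrite E.
  by move=> py; left; left; split=> //=; apply/eqP => E; apply: py; congr (Some (Some _)).
- move=> _ _ [y _ <-] [z _ <-]; rewrite H.
  by case=> [[[]//|[_ [_ []//]]]|[? [? [? []]]]].
- move=> _ [y _ <-]; rewrite H; split.
    by case=> [[[]//|[-> //]]|[? [? [? []]]]].
  by move=> ->; left; right; split=> //; split=> //; right.
- move=> _ [y _ <-]; rewrite H.
  by case=> [[[]//|[]]//|[? [? [? []]]]].
- move=> _ _ [y _ <-] [z _ <-]; rewrite !H.
  split.
    case=> [[[]//|[]]//|[? [? [? [[<-] [<-] [<-] Ly]]]]]; right.
    by exists (Some p), (Some y), (Some z).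
  case=> [[[]//|[_ [_ []//]]]|[? [? [? [[<-] [<-] [<-] Ly]]]]]; right.
  by exists None, (Some y), (Some z).
move=> _ _ [x _ <-] [z _ <-]; rewrite !H; split.
  case=> [[[]//|[Ex [U _]]]|[? [? [? [[<-] [<-] [<-] Ly]]]]].
    left; split=> // E; move: U; rewrite /= Ex E !inE eqxx.
    by rewrite !orbT.
  by right; right; exists (Some x), (Some p), (Some z).
case=> [[-> zp]|[[[]//|[_ [_ []]]]//|[? [? [? [[<-] [<-] [<-] Ly]]]]]].
  left; right; split=> //; split; last by left.
  rewrite /= !inE !negb_or !andbT /=.
  by apply/eqP => E; apply: zp.
by right; exists (Some x), None, (Some z).
Qed.

Lemma isomorphic_inv (Lg : language) (T U : Type) (M : structure Lg T)
    (N : structure Lg U) h : isomorphism M N h ->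
  exists k, [/\ cancel h k, cancel k h & embedding N M k].
Proof.
move=> [[k hk kh] [hI hE]]; exists k; split=> //; split; first exact: can_inj kh.
move=> s a; rewrite hE.
suff -> : map_tuple h (map_tuple k a) = a by [].
by apply: val_inj; rewrite /= -map_comp -[RHS]map_id; apply: eq_map => x; exact: kh.
Qed.

Lemma isomorphic_trans (Lg : language) (T U V : Type) (M : structure Lg T)
    (N : structure Lg U) (P : structure Lg V) :
  isomorphic M N -> isomorphic N P -> isomorphic M P.
Proof.
move=> [f [fB fE]] [g [gB gE]]; exists (g \o f); split; first exact: bij_comp.
exact: embedding_comp fE gE.
Qed.

Lemma isomorphism_id (Lg : language) (T : Type) (M : structure Lg T) :
  isomorphism M M id.
Proof.
split; first by exists id.
split=> // s a; suff -> : map_tuple id a = a by [].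
by apply: val_inj; rewrite /= map_id.
Qed.

Lemma three_points_card (A : finType) (U : Type) (h : A -> U) (k : U -> A) :
  cancel k h -> (exists x y z : U, [/\ x <> y, y <> z & z <> x]) -> 2 < #|A|.
Proof.
move=> kh [x [y [z [xy yz zx]]]]; apply/card_gt2P; exists (k x), (k y), (k z).
by split=> //; split; apply/eqP => /(can_inj kh).
Qed.

Section ClassTransfer.
Variables (Lg : language) (s : Lg) (ar : arity s = 3).
Variable K : forall U : Type, structure Lg U -> Prop.

(* the structures which define the class up to isomorphism *)
Variable R : forall A : finType, structure Lg A -> Prop.
Hypothesis KR : forall U (N : structure Lg U), K N <->
  exists (A : finType) (N' : structure Lg A), R N' /\ isomorphic N' N.

Lemma K_iso_closed : iso_closed K.
Proof.
move=> U V N N' /KR[A [N0 [RN0 i0]]] i; apply/KR; exists A, N0; split=> //.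
exact: isomorphic_trans i0 i.
Qed.

Lemma K_sym : (forall (A : finType) (N : structure Lg A), R N -> ternary_sym (ternary ar N)) ->
  class_ternary_sym ar K.
Proof.
move=> RS U N /KR[A [N0 [RN0 [h hI]]]] x y z.
have [k [hk kh kE]] := isomorphic_inv hI.
move=> /(ternary_embedding ar kE).
by move=> /(RS _ _ RN0)/(ternary_embedding ar kE).
Qed.

Lemma K_distinct :
  (forall (A : finType) (N : structure Lg A), R N -> ternary_distinct (ternary ar N)) ->
  class_ternary_distinct ar K.
Proof.
move=> RS U N /KR[A [N0 [RN0 [h hI]]]] x y z.
have [k [hk kh kE]] := isomorphic_inv hI.
move=> /(ternary_embedding ar kE) /(RS _ _ RN0)[xy xz yz].
by split=> E; [apply: xy|apply: xz|apply: yz]; rewrite E.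
Qed.

Lemma K_twin : (forall (A : finType) (N : structure Lg A) (p : A), R N -> 2 < #|A| ->
    exists N' : structure Lg (option (option A)),
      [/\ R N', embedding N N' (fun a => Some (Some a))
        & twin_over (ternary ar N') (range (fun a => Some (Some a)))
            (Some (Some p)) None (Some None)]) ->
  twin_class ar K.
Proof.
move=> RT U N /KR[A [N0 [RN0 [h hI]]]] three p.
have [k [hk kh kE]] := isomorphic_inv hI.
have [N' [RN' E tw]] := RT _ _ (k p) RN0 (three_points_card kh three).
exists (option (option A)), N', ((fun a => Some (Some a)) \o k), None, (Some None).
split.
- apply/KR; exists (option (option A)), N'; split=> //; exists id; exact: isomorphism_id.
- exact: embedding_comp kE E.
by apply: twin_over_sub tw => _ [x _ <-]; exists (k x).
Qed.

End ClassTransfer.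

Definition B_str (A : finType) (N : structure LB1 A) : Prop :=
  exists t : Bdata A, is_Btree t /\ N = Bstructure t.

Definition D_str (A : finType) (N : structure LD1 A) : Prop :=
  exists t : Ddata A, is_Dtree t /\ N = Dstructure t.

Lemma classB_str U (N : structure LB1 U) : classB N <->
  exists (A : finType) (N' : structure LB1 A), B_str N' /\ isomorphic N' N.
Proof.
split=> [[A [t [tP i]]]|[A [_ [[t [tP ->]] i]]]]; last by exists A, t.
by exists A, (Bstructure t); split=> //; exists t.
Qed.

Lemma classD_str U (N : structure LD1 U) : classD N <->
  exists (A : finType) (N' : structure LD1 A), D_str N' /\ isomorphic N' N.
Proof.
split=> [[A [t [tP i]]]|[A [_ [[t [tP ->]] i]]]]; last by exists A, t.
by exists A, (Dstructure t); split=> //; exists t.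
Qed.

Lemma inequivalent_sym (A : finType) (t : levels A) mu x y z :
  @inequivalent _ t mu [:: x; y; z] -> @inequivalent _ t mu [:: x; z; y].
Proof.
rewrite /inequivalent /= !andbT => /andP[/and3P[xX yX zX] /andP[/andP[xy xz] yz]].
rewrite xX yX zX xy xz /=; apply: contra yz => zy.
by have [_ E] := lsim_equiv zX yX zX; rewrite -(E zy); have [] := lsim_equiv zX zX zX.
Qed.

Lemma inequivalent_distinct (A : finType) (t : levels A) mu x y z :
  @inequivalent _ t mu [:: x; y; z] -> [/\ x <> y, x <> z & y <> z].
Proof.
rewrite /inequivalent /= !andbT => /andP[/and3P[xX yX zX] /andP[/andP[xy xz] yz]].
have r u : u \in lX mu -> lsim mu u u by move=> uX; have [] := lsim_equiv uX uX uX.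
by split=> E; [move: xy|move: xz|move: yz]; rewrite -E r.
Qed.

Definition BL_ternary : @arity LB1 (B1 BL) = 3 := erefl.
Definition DL_ternary : @arity LD1 (D1 DL) = 3 := erefl.

Lemma ternary_B (A : finType) (t : Bdata A) x y z : ternary BL_ternary (Bstructure t) x y z <->
  exists mu, @Bwitness _ t mu BL [:: x; y; z].
Proof. by []. Qed.

Lemma ternary_D (A : finType) (t : Ddata A) x y z : ternary DL_ternary (Dstructure t) x y z <->
  exists mu, @Dwitness _ t mu DL [:: x; y; z].
Proof. by []. Qed.

Lemma B_sym (A : finType) (N : structure LB1 A) : B_str N -> ternary_sym (ternary BL_ternary N).
Proof.
move=> [t [tP ->]] x y z /ternary_B[mu [iu b]]; apply/ternary_B; exists mu; split.
  exact: inequivalent_sym iu.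
by apply: on_path_sym b; have [_ []] := B_tree tP mu.
Qed.

Lemma D_sym (A : finType) (N : structure LD1 A) : D_str N -> ternary_sym (ternary DL_ternary N).
Proof.
move=> [t [tP ->]] x y z /ternary_D[mu [iu [n [r s]]]]; apply/ternary_D; exists mu.
split; first exact: inequivalent_sym iu.
by exists n; split=> //; exact: in_distinct_blocks_sym r.
Qed.

Lemma B_distinct (A : finType) (N : structure LB1 A) : B_str N ->
  ternary_distinct (ternary BL_ternary N).
Proof.
by move=> [t [tP ->]] x y z /ternary_B[mu [iu _]]; exact: inequivalent_distinct iu.
Qed.

Lemma D_distinct (A : finType) (N : structure LD1 A) : D_str N ->
  ternary_distinct (ternary DL_ternary N).
Proof.
by move=> [t [tP ->]] x y z /ternary_D[mu [iu _]]; exact: inequivalent_distinct iu.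
Qed.

Lemma B_twin (A : finType) (N : structure LB1 A) (p : A) : B_str N -> 2 < #|A| ->
  exists N' : structure LB1 (option (option A)),
    [/\ B_str N', embedding N N' (fun a => Some (Some a))
      & twin_over (ternary BL_ternary N') (range (fun a => Some (Some a)))
          (Some (Some p)) None (Some None)].
Proof.
move=> [t [tP ->]] A3; exists (Bstructure (Bext p t)); split.
- by exists (Bext p t); split=> //; exact: Bext_tree.
- exact: Bext_embedding.
apply: (ext_twin_over (L := ternary BL_ternary (Bstructure t))) => x y z.
rewrite ternary_B; split.
  case=> -[m|] H; last by left; apply: (@Bext_witness0_L _ p t x y z).1 H.
  right; have [x' Ex] : exists x', x = Some x'.
    by apply: (inequivalent_ext_Some H.1); rewrite !inE eqxx.
  have [y' Ey] : exists y', y = Some y'.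
    by apply: (inequivalent_ext_Some H.1); rewrite !inE eqxx orbT.
  have [z' Ez] : exists z', z = Some z'.
    by apply: (inequivalent_ext_Some H.1); rewrite !inE eqxx !orbT.
  exists x', y', z'; split=> //; apply/ternary_B; exists m.
  by apply/(Bext_witness p m BL [:: x'; y'; z']); rewrite /= -Ex -Ey -Ez.
case=> [/Bext_witness0_L H|[x' [y' [z' [-> -> -> /ternary_B[m H]]]]]].
  by exists None.
by exists (Some m); apply/(Bext_witness p m BL [:: x'; y'; z']).
Qed.

Lemma D_twin (A : finType) (N : structure LD1 A) (p : A) : D_str N -> 2 < #|A| ->
  exists N' : structure LD1 (option (option A)),
    [/\ D_str N', embedding N N' (fun a => Some (Some a))
      & twin_over (ternary DL_ternary N') (range (fun a => Some (Some a)))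
          (Some (Some p)) None (Some None)].
Proof.
move=> [t [tP ->]] A3; exists (Dstructure (Dext p t)); split.
- by exists (Dext p t); split=> //; exact: Dext_tree.
- exact: Dext_embedding.
apply: (ext_twin_over (L := ternary DL_ternary (Dstructure t))) => x y z.
rewrite ternary_D; split.
  case=> -[m|] H; last by left; apply: (@Dext_witness0_L _ p t x y z).1 H.
  right; have [x' Ex] : exists x', x = Some x'.
    by apply: (inequivalent_ext_Some H.1); rewrite !inE eqxx.
  have [y' Ey] : exists y', y = Some y'.
    by apply: (inequivalent_ext_Some H.1); rewrite !inE eqxx orbT.
  have [z' Ez] : exists z', z = Some z'.
    by apply: (inequivalent_ext_Some H.1); rewrite !inE eqxx !orbT.
  exists x', y', z'; split=> //; apply/ternary_D; exists m.
  by apply/(Dext_witness p m DL [:: x'; y'; z']); rewrite /= -Ex -Ey -Ez.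
case=> [/Dext_witness0_L H|[x' [y' [z' [-> -> -> /ternary_D[m H]]]]]].
  by exists None.
by exists (Some m); apply/(Dext_witness p m DL [:: x'; y'; z']).
Qed.

(** What the two limits have in common; the rest of the argument is about an
    arbitrary such relation. *)
Definition twin_structure (T : Type) (L : T -> T -> T -> Prop) : Prop :=
  [/\ inhabited T, ternary_sym L, ternary_distinct L &
    forall (F : set T) p, finite_set F -> F p -> exists c q, twin_over L F p c q].

Lemma MB1_twin_structure (T : Type) (M : structure LB1 T) : is_MB1 M ->
  twin_structure (ternary BL_ternary M).
Proof.
move=> MB; split.
- exact: Fraisse_inhabited MB.
- exact: Fraisse_sym MB (K_sym classB_str B_sym).
- exact: Fraisse_distinct MB (K_distinct classB_str B_distinct).
move=> F p; apply: (Fraisse_twin (K_iso_closed classB_str) MB).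
exact: K_twin classB_str B_twin.
Qed.

Lemma MD1_twin_structure (T : Type) (M : structure LD1 T) : is_MD1 M ->
  twin_structure (ternary DL_ternary M).
Proof.
move=> MD; split.
- exact: Fraisse_inhabited MD.
- exact: Fraisse_sym MD (K_sym classD_str D_sym).
- exact: Fraisse_distinct MD (K_distinct classD_str D_distinct).
move=> F p; apply: (Fraisse_twin (K_iso_closed classD_str) MD).
exact: K_twin classD_str D_twin.
Qed.

From mathcomp Require Import zify perm.

(** * Sequences of twins *)

Definition past (T : Type) (c q : nat -> T) (k : nat) : set T :=
  (q @` `I_k.+1) `|` (c @` `I_k.+1).

(** The apexes are the points [c k] with [0 < k]. *)
Definition twin_sequence (T : Type) (L : T -> T -> T -> Prop) (g : nat -> nat)
    (c q : nat -> T) : Prop :=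
  forall k, twin_over L (past c q k) (q (g k.+1)) (c k.+1) (q k.+1).

Lemma twin_sequence_exists (T : Type) (L : T -> T -> T -> Prop) (g : nat -> nat) :
  twin_structure L -> (forall k, g k.+1 <= k) ->
  exists c q, twin_sequence L g c q.
Proof.
move=> [[x0] _ _ Ltwin] gP.
have /choice[next nextP] : forall Fp : set T * T, exists cq : T * T,
    finite_set Fp.1 -> Fp.1 Fp.2 -> twin_over L Fp.1 Fp.2 cq.1 cq.2.
  move=> [F p] /=; have [[Ffin Fp]|H] := pselect (finite_set F /\ F p).
    by have [c [q tw]] := Ltwin F p Ffin Fp; exists (c, q).
  by exists (p, p) => Ffin Fp; case: H.
(* the stage [k] of the construction is a sequence that is final up to [k] *)
pose pastv (v : nat -> T * T) := past (fun i => (v i).1) (fun i => (v i).2).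
pose fix st k : nat -> T * T := match k with
  | 0 => fun _ => (x0, x0)
  | k'.+1 => fun i => if (i <= k')%N then st k' i
                      else next (pastv (st k') k', (st k' (g k'.+1)).2)
  end.
pose v k := st k k.
have stE k i : (i <= k)%N -> st k i = v i.
  elim: k => [|k IH]; first by rewrite leqn0 => /eqP ->.
  rewrite leq_eqVlt => /orP[/eqP -> //|]; rewrite ltnS => ik.
  by rewrite /= ik IH.
have vS k : v k.+1 = next (pastv v k, (v (g k.+1)).2).
  rewrite {1}/v /= ltnn stE ?gP //; congr (next (_, _)).
  have E f : [set (f (st k i) : T) | i in `I_k.+1] = [set f (v i) | i in `I_k.+1].
    by apply: eq_imagel => i /= ik; rewrite stE.
  by rewrite /pastv /past; congr (_ `|` _); apply: E.
exists (fun i => (v i).1), (fun i => (v i).2) => k.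
rewrite vS; apply: (nextP (pastv v k, _)) => /=.
  by rewrite finite_setU; split; apply: finite_image; exact: finite_II.
by left; exists (g k.+1) => //=; rewrite ltnS.
Qed.

Section Reduce.
Variable g : nat -> nat.
Hypothesis gP : forall k, g k.+1 <= k.

Lemma g_lt i : 0 < i -> g i < i. Proof. by case: i => // i _; rewrite ltnS. Qed.

Fixpoint reduce_rec (n k i : nat) : nat :=
  if i < k then i else if n is n'.+1 then reduce_rec n' k (g i) else i.

(** The point of index below [k] of which [i] is, at stage [k], still a copy. *)
Definition reduce (k i : nat) : nat := reduce_rec i k i.

Lemma reduce_lt k i : i < k -> reduce k i = i.
Proof. by rewrite /reduce; case: i => [|i] /= ->. Qed.

Lemma reduce_ge k i : 0 < k <= i -> reduce k i = reduce k (g i).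
Proof.
have H n j : 0 < k -> j <= n -> reduce_rec n k j = reduce k j.
  move=> k0; have [m] := ubnP n; elim: m n j => // m IH n j nm jn.
  have [jk|kj] := ltnP j k; first by rewrite reduce_lt //; case: n {nm jn} => [|n] /=; rewrite jk.
  have j0 : 0 < j by lia.
  have gj := g_lt j0.
  case: n nm jn => [|n] nm jn; first by lia.
  case: j kj j0 gj jn => [//|j] kj _ gj jn.
  by rewrite /reduce /= ltnNge kj /= !IH //; lia.
move=> /andP[k0 ki]; have i0 : 0 < i by lia.
have gi := g_lt i0.
case: i ki i0 gi => [//|i] ki _ gi.
by rewrite {1}/reduce /= ltnNge ki /= H //; lia.
Qed.

End Reduce.

Section SequenceFacts.
Variables (T : Type) (L : T -> T -> T -> Prop) (g : nat -> nat) (c q : nat -> T).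
Hypothesis Lsym : ternary_sym L.
Hypothesis Ldist : ternary_distinct L.
Hypothesis gP : forall k, g k.+1 <= k.
Hypothesis tw : twin_sequence L g c q.

Lemma past_q k i : i < k.+1 -> past c q k (q i).
Proof. by left; exists i. Qed.

Lemma past_c k i : i < k.+1 -> past c q k (c i).
Proof. by right; exists i. Qed.

Lemma q_inj : injective q.
Proof.
have H i j : i < j -> q i <> q j.
  case: j => // j ij E; have := twin_new (tw j); apply; rewrite -E; exact: past_q.
move=> i j E; case: (ltngtP i j) => // ij; first by case: (H _ _ ij).
by case: (H _ _ ij).
Qed.

Lemma c_inj i j : 0 < i -> 0 < j -> c i = c j -> i = j.
Proof.
have H a b : a < b -> c a <> c b.
  case: b => // b ab E; have := apex_new (tw b); apply; rewrite -E; exact: past_c.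
by move=> _ _ E; case: (ltngtP i j) => // ij; [case: (H _ _ ij)|case: (H _ _ ij)].
Qed.

Lemma c_neq_q k i : 0 < k -> c k <> q i.
Proof.
case: k => // k _ E; case: (ltngtP i k.+1) => ik.
- by have := apex_new (tw k); apply; rewrite E; apply: past_q.
- case: i ik E => // i ik E.
  by have := twin_new (tw i); apply; rewrite -E; apply: past_c.
by have := apex_neq_twin (tw k); apply; rewrite E ik.
Qed.

Lemma q_eq i j : (q i = q j) <-> (i = j).
Proof. by split=> [/q_inj|->]. Qed.

Lemma L_q_twin_x i e x : 0 < e -> i < e -> past c q e.-1 x ->
  L (q i) (q e) x <-> (i = g e /\ x <> q (g e)) \/ L (q i) (q (g e)) x.
Proof.
case: e => // e _ ie px.
by rewrite (old_twin_old (tw e) (past_q ie) px) q_eq.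
Qed.

(** Points created from stage [k] on are, for [c k], copies of their parents. *)
Lemma L_c_q_q k i j : 0 < k -> i <> j ->
  L (c k) (q i) (q j) <-> reduce g k i <> reduce g k j.
Proof.
move=> k0; have [n] := ubnP (i + j); elim: n i j => // n IH i j ijn ij.
wlog lt_ji : i j ijn ij / j < i => [H|].
  have [ji|ij'|E] := ltngtP j i; [exact: H| |by case: ij].
  have S a b : L (c k) (q a) (q b) <-> L (c k) (q b) (q a) by split; exact: Lsym.
  rewrite S H //; [by split=> A B; apply: A|by rewrite addnC|by move=> E; apply: ij].
case: (ltngtP i k) => ik.
- rewrite !reduce_lt //; last exact: ltn_trans lt_ji ik.
  case: k k0 ik {IH} => // k _ ik.
  rewrite (apex_old_old (tw k) (past_q _) (past_q _)) ?q_eq //; lia.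
- rewrite (reduce_ge gP (i := i)); last by rewrite k0 ltnW.
  case: i ik ijn ij lt_ji => // i ik ijn ij lt_ji.
  have -> : L (c k) (q i.+1) (q j) <->
      (c k = q (g i.+1) /\ q j <> q (g i.+1)) \/ L (c k) (q (g i.+1)) (q j).
    by apply: (old_twin_old (tw i)); [exact: past_c|exact: past_q].
  have [E|E] := eqVneq (g i.+1) j.
    rewrite E; split; last by case.
    by case=> [[/c_neq_q]//|/Ldist[_ _]].
  rewrite -IH; last exact/eqP.
    by split=> [[[/c_neq_q]//|]|]; [|right].
  by have := gP i; lia.
- rewrite -ik in k0 *; rewrite (reduce_ge gP (i := i)) ?k0 ?leqnn //.
  case: i {ik} k0 ijn ij lt_ji => // i _ ijn ij lt_ji.
  rewrite (apex_twin_old (tw i) (past_q lt_ji)) q_eq.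
  have gi := gP i.
  rewrite !reduce_lt //; by split=> A B; apply: A.
Qed.

(** For [c k] all the points which reduce to [q i] are one and the same, and among
    them [q i] is the nearest to the rest. *)
Lemma L_q_q_c k i e : i < k ->
  L (q i) (q e) (c k) <-> i <> e /\ reduce g k e = i.
Proof.
move=> ik; have k0 : 0 < k by lia.
have [n] := ubnP e; elim: n e => // n IH e en.
case: (ltngtP e k) => ek.
- rewrite reduce_lt //; split; last by case=> A B; case: A.
  case: k k0 ik ek {IH} => // k _ ik ek /Lsym.
  by move/(old_apex_old (tw k) (past_q ik) (past_q ek)).
- rewrite (reduce_ge gP); last by rewrite k0 ltnW.
  case: e ek en => // e ek en; have ge := gP e.
  have ie : i < e.+1 by lia.
  rewrite (L_q_twin_x (e := e.+1) isT ie (past_c ek)).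
  rewrite IH; last by lia.
  split=> [[[E _]|[A B]]|[A B]].
  + by split; [lia|rewrite -E reduce_lt].
  + by split=> //; lia.
  + have [E|E] := eqVneq i (g e.+1); first by left; split=> //; exact: c_neq_q.
    by right; split=> //; exact/eqP.
- rewrite ek (reduce_ge gP) ?k0 ?leqnn //.
  case: k k0 ik ek {IH} => // k _ ik ek; have gk := gP k.
  rewrite reduce_lt //.
  have -> : L (q i) (q k.+1) (c k.+1) <-> L (q i) (c k.+1) (q k.+1) by split; exact: Lsym.
  rewrite (old_apex_twin (tw k) (past_q ik)) q_eq.
  by split=> [->|[]//]; split=> //; lia.
Qed.

(** Two points that are told apart by [c b] but not by [c a] separate at a
    stage between [a] and [b]. *)
Lemma exists_twin_between a b i : i < a -> a <= b ->
  (exists e, L (c b) (q i) (q e) /\ L (q i) (q e) (c a)) <->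
  (exists2 e, a <= e < b & g e = i).
Proof.
move=> ia ab; split=> [[e [Lb]]|[e /andP[ae eb] ge]].
  rewrite L_q_q_c // => -[ie ra].
  have b0 : 0 < b by lia.
  move: Lb => /(L_c_q_q b0 ie); rewrite (@reduce_lt g b i); last by lia.
  have [n] := ubnP e; elim: n e ie ra => // n IH e ie ra en rb.
  have ae : a <= e.
    by rewrite leqNgt; apply/negP => ea; apply: ie; rewrite -ra reduce_lt.
  have ge : g e < e by apply: (g_lt gP); lia.
  rewrite (reduce_ge gP) in ra; last by lia.
  have [eb|be] := ltnP e b; have [Ei|Ei] := eqVneq (g e) i.
  - by exists e; rewrite // ae.
  - apply: (IH (g e)) => //; [by apply/eqP; rewrite eq_sym|lia|].
    by rewrite reduce_lt //; [apply/eqP; rewrite eq_sym|lia].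
  - by case: rb; rewrite (reduce_ge gP) ?Ei ?reduce_lt //; lia.
  - apply: (IH (g e)) => //; [by apply/eqP; rewrite eq_sym|lia|].
    by rewrite -(reduce_ge gP) //; lia.
exists e; have b0 : 0 < b by lia.
have ie : i <> e by lia.
split; first by apply/(L_c_q_q b0 ie); rewrite !(@reduce_lt g b); lia.
apply/(L_q_q_c _ ia); split=> //.
by rewrite (reduce_ge gP) ?ge ?reduce_lt //; lia.
Qed.

End SequenceFacts.

(** * Independence *)

(** Every word is the word of arbitrarily late stages, as the second component
    of the decoded pair is ignored. *)
Definition stage_word (s : nat) : seq nat :=
  if (unpickle s : option (seq nat * nat)) is Some (u, _) then u else [::].

Lemma stage_word_late (u : seq nat) (B : nat) :
  exists2 s, B <= s & stage_word s = u.
Proof.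
have [m mB] : exists m : nat, B <= pickle (u, m).
  have [//|H] := pselect (exists m : nat, B <= pickle (u, m)).
  have lt (m : nat) : pickle (u, m) < B.
    by rewrite ltnNge; apply/negP => mB; apply: H; exists m.
  have inj : injective (fun m : 'I_B.+1 => Ordinal (lt m)).
    by move=> m m' /(congr1 val)/= /(pcan_inj pickleK)[] /ord_inj.
  by have := leq_card _ inj; rewrite !card_ord ltnn.
by exists (pickle (u, m)); rewrite // /stage_word pickleK.
Qed.

(** A choice of twins under which every finite word of points is, arbitrarily
    late, the sequence of parents of an interval. *)
Definition universal_parent (n : nat) : nat :=
  let s := trunc_log 2 n in
  let v := nth 0 (stage_word s) (n - 2 ^ s) in
  if v < n then v else 0.

Lemma universal_parent_lt k : universal_parent k.+1 <= k.
Proof. by rewrite /universal_parent; case: ltnP. Qed.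

Lemma universal_parentP (u : seq nat) (B : nat) : {in u, forall i, i < B} ->
  exists a b, [/\ B <= a, a <= b &
    forall i, (exists2 e, a <= e < b & universal_parent e = i) <-> i \in u].
Proof.
move=> uB; have [s sB su] := stage_word_late u (maxn B (size u)).
have sB2 : maxn B (size u) < 2 ^ s by apply: leq_trans (ltn_expl s _); rewrite ?ltnS.
exists (2 ^ s), (2 ^ s + size u); split; [lia|lia|].
have E e : 2 ^ s <= e < 2 ^ s + size u -> universal_parent e = nth 0 u (e - 2 ^ s).
  move=> /andP[se es]; rewrite /universal_parent (@trunc_log_eq 2 s e) //; last first.
    by rewrite expnS; lia.
  have lt : e - 2 ^ s < size u by lia.
  by rewrite su ifT //; apply: leq_trans (uB _ (mem_nth 0 lt)) _; lia.
move=> i; split=> [[e he <-]|iu].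
  by rewrite E //; apply: mem_nth; have : e - 2 ^ s < size u by lia.
have iu' : index i u < size u by rewrite index_mem.
exists (2 ^ s + index i u); first by lia.
by rewrite E ?addKn ?nth_index //; lia.
Qed.

Section NotNIP.
Variables (Lg : language) (s : Lg) (ar : arity s = 3).
Variables (T : Type) (M : structure Lg T).

Notation mlang := (monadic_language Lg unit).

Definition v4 (i : nat) (h : i < 4) : 'I_4 := Ordinal h.

Definition atom3 (i j k : 'I_4) : formula mlang 4 :=
  @FRel mlang 4 (inl s) (tcast (esym ar) [tuple i; j; k]).

(** The variables 1, 2, 3 stand for [x] and the two components of [y]; variable 0
    is bound. *)
Definition separation : formula mlang (1 + 2) :=
  @FEx mlang 3 (FAnd (@FRel mlang 4 (inr tt) [tuple v4 (i := 0) isT])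
    (FAnd (atom3 (v4 (i := 3) isT) (v4 (i := 1) isT) (v4 (i := 0) isT))
          (atom3 (v4 (i := 1) isT) (v4 (i := 0) isT) (v4 (i := 2) isT)))).

Lemma sat_separation (P : unit -> T -> Prop) (x y1 y2 : T) :
  sat (monadic_expansion M P) separation (cat_tuple [tuple x] [tuple y1; y2]) <->
  exists z, P tt z /\ ternary ar M y2 x z /\ ternary ar M x z y1.
Proof.
have E z (i j k : 'I_4) : sat (monadic_expansion M P) (atom3 i j k)
    (cons_tuple z (cat_tuple [tuple x] [tuple y1; y2])) <->
    ternary ar M (nth z [:: z; x; y1; y2] i) (nth z [:: z; x; y1; y2] j)
      (nth z [:: z; x; y1; y2] k).
  rewrite /= map_tcast map_tuple3 /ternary.
  by rewrite !(tnth_nth z).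
split=> -[z [Pz [Lz1 Lz2]]]; exists z; split=> //; split.
- exact: (E z _ _ _).1 Lz1.
- exact: (E z _ _ _).1 Lz2.
- exact: (E z (v4 (i := 3) isT) (v4 (i := 1) isT) (v4 (i := 0) isT)).2 Lz1.
- exact: (E z (v4 (i := 1) isT) (v4 (i := 0) isT) (v4 (i := 2) isT)).2 Lz2.
Qed.

(** The point [q i] stands for [i], and a subset [J] for two apexes between which
    exactly the points of [J] get twins. *)
Lemma not_monadically_NIP : twin_structure (ternary ar M) -> ~ monadically_NIP M.
Proof.
move=> Ltwin; have [c [q tw]] := twin_sequence_exists Ltwin universal_parent_lt.
have [_ Lsym Ldist _] := Ltwin.
move/(_ unit (fun _ => range q) 1 2 separation); apply => k.
have /choice[ab abP] : forall J : {set 'I_k}, exists ab : nat * nat,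
    [/\ k <= ab.1, ab.1 <= ab.2 & forall i, (exists2 e, ab.1 <= e < ab.2 &
       universal_parent e = i) <-> i \in [seq val i | i <- enum J]].
  move=> J; have [|a [b H]] := @universal_parentP [seq val i | i <- enum J] k.
    by move=> _ /mapP[i _ ->]; exact: ltn_ord.
  by exists (a, b).
exists (fun i => [tuple q i]), (fun J => [tuple c (ab J).1; c (ab J).2]) => i J.
have [kab leab abJ] := abP J.
rewrite sat_separation.
have -> : i \in J = (val i \in [seq val i | i <- enum J]).
  by rewrite (mem_map val_inj) mem_enum.
rewrite -abJ -(exists_twin_between Lsym Ldist universal_parent_lt tw _ leab).
  by split=> [[_ [[e _ <-] H]]|[e H]]; [exists e|exists (q e); split=> //; exists e].
exact: leq_trans (ltn_ord i) kab.
Qed.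

End NotNIP.

(** * Words *)

Section ApexFacts.
Variables (T : Type) (L : T -> T -> T -> Prop) (g : nat -> nat) (c q : nat -> T).
Hypothesis Lsym : ternary_sym L.
Hypothesis Ldist : ternary_distinct L.
Hypothesis gP : forall k, g k.+1 <= k.
Hypothesis tw : twin_sequence L g c q.

Lemma L_symE x y z : L x y z <-> L x z y. Proof. by split; exact: Lsym. Qed.

Lemma L_apex_old_old k x y : 0 < k -> past c q k.-1 x -> past c q k.-1 y ->
  L (c k) x y <-> x <> y.
Proof. by case: k => // k _; apply: (apex_old_old (tw k)). Qed.

Lemma L_old_apex_old k x y : 0 < k -> past c q k.-1 x -> past c q k.-1 y ->
  ~ L x (c k) y.
Proof. by case: k => // k _; apply: (old_apex_old (tw k)). Qed.

Lemma L_twin_old_old i x y : 0 < i -> past c q i.-1 x -> past c q i.-1 y ->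
  L (q i) x y <-> L (q (g i)) x y.
Proof. by case: i => // i _; apply: (twin_old_old (tw i)). Qed.

(** For an earlier apex the twin and its parent are interchangeable. *)
Lemma L_c_q_twin k i y : 0 < k -> k < i -> past c q i.-1 y ->
  L (c k) (q i) y <-> L (c k) (q (g i)) y.
Proof.
case: i => // i k0 ki py.
rewrite (old_twin_old (tw i) (past_c c q ki) py).
by split=> [[[/(c_neq_q tw k0)]//|]|]; [|right].
Qed.

Lemma L_c_c_c k k1 k2 : 0 < k -> 0 < k1 -> 0 < k2 -> k <> k1 -> k <> k2 -> k1 <> k2 ->
  L (c k) (c k1) (c k2) <-> k1 < k /\ k2 < k.
Proof.
move=> p0 p1 p2 n1 n2 n12.
have ap a b : a < b -> past c q b.-1 (c a) by move=> ab; apply: past_c; lia.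
have [lt1|ge1] := ltnP k1 k; have [lt2|ge2] := ltnP k2 k.
- split=> // _; apply/L_apex_old_old; [lia|exact: ap|exact: ap|].
  by move=> /(c_inj tw p1 p2).
- split=> [/Lsym|[]//]; move/L_old_apex_old => -[]//; apply: ap; lia.
- split=> [|[]//]; move/L_old_apex_old => -[]//; apply: ap; lia.
split=> [|[]//]; case: (ltngtP k1 k2) => // lt12.
  by move=> /Lsym/L_old_apex_old -[]//; apply: ap; lia.
by move/L_old_apex_old => -[]//; apply: ap; lia.
Qed.

Lemma L_c_c_q k k1 j : 0 < k -> 0 < k1 -> k <> k1 ->
  L (c k) (c k1) (q j) <-> k1 < k.
Proof.
move=> p0 p1 n1; have [n] := ubnP j; elim: n j => // n IH j jn.
have ap a b : a < b -> past c q b.-1 (c a) by move=> ab; apply: past_c; lia.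
have aq a b : a < b -> past c q b.-1 (q a) by move=> ab; apply: past_q; lia.
have [jk|jk] := ltnP j (maxn k k1).
  have [lt1|ge1] := ltnP k1 k.
    have ljk : j < k by lia.
    split=> // _; apply/(L_apex_old_old p0 (ap _ _ lt1) (aq _ _ ljk)).
    exact: (c_neq_q tw p1).
  by split=> // /L_old_apex_old -[]//; [apply: ap|apply: aq]; lia.
have gj : g j < j by apply: g_lt gP _ _; lia.
have [Ej|nj] := eqVneq j (maxn k k1); last first.
  by rewrite L_symE L_c_q_twin; [rewrite -L_symE IH; lia|lia|lia|apply: ap; lia].
have [lt1|ge1] := ltnP k1 k.
  have {Ej} -> : j = k by lia.
  split=> // _; rewrite L_symE; case: k p0 lt1 {IH n1 jk} => // k _ lt1.
  by apply/(apex_twin_old (tw k) (ap _ _ lt1)); exact: (c_neq_q tw p1).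
have {Ej} -> : j = k1 by lia.
split=> //; case: k1 p1 n1 ge1 {IH jk} => // k1 _ n1 ge1.
have lt : k < k1.+1 by lia.
move/(old_apex_twin (tw k1) (past_c c q lt)) => E.
by case: (c_neq_q tw p0 E).
Qed.

Lemma L_q_c_c i k k1 : 0 < k -> 0 < k1 -> ~ L (q i) (c k) (c k1).
Proof.
move=> p0 p1 H; have [_ _ n1] := Ldist H.
wlog lt1 : i k k1 p0 p1 H n1 / k1 < k => [W|].
  have : k <> k1 by move=> E; apply: n1; rewrite E.
  move=> nk; have [lt|lt|E] := ltngtP k1 k; last by rewrite E in nk.
    exact: (W i k k1).
  by apply: (W i k1 k) => //; [exact: Lsym|move=> E; apply: n1].
have ap a b : a < b -> past c q b.-1 (c a) by move=> ab; apply: past_c; lia.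
have [n] := ubnP i; elim: n i H => // n IH i H jn.
have [ik|ki|E] := ltngtP i k.
- have px : past c q k.-1 (q i) by apply: past_q; lia.
  exact: (L_old_apex_old p0 px (ap _ _ lt1) H).
- have i0 : 0 < i by lia.
  apply: (IH (g i)); last by have := g_lt gP i0; lia.
  have lt1i : k1 < i by lia.
  exact: (L_twin_old_old i0 (ap _ _ ki) (ap _ _ lt1i)).1 H.
rewrite E in H; case: k p0 H {n1 E IH} lt1 => // k _ H lt1.
exact: (twin_apex_old (tw k) (past_c c q lt1) H).
Qed.

End ApexFacts.

(** The ternary relation of a linear order, each point of which is blown up to a
    linear order: between points of different letters it is betweenness of the
    letters, and with two or three points of one letter the middle one is the
    point of largest rank among these. *)
Definition coord_between (li ri lj rj lm rm : nat) : Prop :=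
  lj < li < lm \/ lm < li < lj \/
  (li = lj /\ li <> lm /\ rj < ri) \/
  (li = lm /\ li <> lj /\ rm < ri) \/
  (li = lj /\ li = lm /\ rj < ri /\ rm < ri).

Lemma coord_betweenC li ri lj rj lm rm :
  coord_between li ri lj rj lm rm <-> coord_between li ri lm rm lj rj.
Proof. by rewrite /coord_between; lia. Qed.

Lemma coord_between_below l ri rj lm rm :
  coord_between l ri l rj lm rm -> rj < ri.
Proof. by rewrite /coord_between; lia. Qed.

Lemma coord_between_same li ri l rj rm :
  coord_between li ri l rj l rm -> rj < ri /\ rm < ri.
Proof. by rewrite /coord_between; lia. Qed.

Lemma coord_between_first l ri rp lj rj lm rm :
  (l = lj -> rj < ri /\ rj < rp) -> (l = lm -> rm < ri /\ rm < rp) ->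
  coord_between l rp lj rj lm rm <-> coord_between l ri lj rj lm rm.
Proof. by rewrite /coord_between; lia. Qed.

Lemma coord_between_second li ri l ra rp lm rm :
  coord_between li ri l ra lm rm -> (l = li -> ri <= ra /\ ri <= rp) ->
  coord_between li ri l rp lm rm.
Proof. by rewrite /coord_between; lia. Qed.

Section Word.
Variables (R N : nat) (w : nat -> nat).
Hypothesis wR : forall t, w t < R.

(** The points of index less than [R] are the letters.  They form a path for [L], so
    that, from five letters on, no point but an apex is between every two of them. *)
Definition word_parent (k : nat) : nat := if k < R then k.-1 else w (k - R).

Definition letter (j : nat) : nat := if j < R then j else w (j - R).

(** Of two points with the same letter, the one of larger rank is between the other
    one and the rest: the later of two twins, and the letter itself before all its
    twins. *)
Definition rank (j : nat) : nat := if j < R then R + N else j.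

Definition letter_between (i j m : nat) : Prop :=
  coord_between (letter i) (rank i) (letter j) (rank j) (letter m) (rank m).

(** The relation on the apexes [inl k] and the points [inr j]. *)
Definition wordL (x y z : nat + nat) : Prop :=
  match x, y, z with
  | inl k, inl k1, inl k2 => k1 < k /\ k2 < k
  | inl k, inl k1, inr _ | inl k, inr _, inl k1 => k1 < k
  | inl k, inr i, inr j => ~ (letter i = letter j /\ k <= rank i /\ k <= rank j)
  | inr i, inr j, inl k | inr i, inl k, inr j =>
      letter i = letter j /\ rank j < rank i /\ k <= rank j
  | inr _, inl _, inl _ => False
  | inr i, inr j, inr m => letter_between i j m
  end.

Definition word_point (x : nat + nat) : bool :=
  match x with inl k => R <= k < R + N | inr j => j < R + N end.

Lemma word_parent_lt k : word_parent k.+1 <= k.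
Proof. by rewrite /word_parent; case: ltnP => //= H; have := wR (k.+1 - R); lia. Qed.

Lemma coordP i : (i < R /\ rank i = R + N /\ letter i = i) \/
  (R <= i /\ rank i = i /\ letter i < R).
Proof. by rewrite /rank /letter; case: (ltnP i R) => iR; [left|right; rewrite wR]. Qed.

Lemma letter_lt i : i < R -> letter i = i.
Proof. by rewrite /letter => ->. Qed.

Lemma rank_lt i : i < R -> rank i = R + N.
Proof. by rewrite /rank => ->. Qed.

Lemma rank_ge i : R <= i -> rank i = i.
Proof. by rewrite /rank ltnNge => ->. Qed.

Lemma letter_ltR i : letter i < R.
Proof. by rewrite /letter; case: ifP => // _; exact: wR. Qed.

Lemma rank_twin a i : a < i -> a <> letter i -> letter i = letter a -> rank a = a.
Proof.
move=> ai na E; apply: rank_ge; rewrite leqNgt; apply/negP => aR.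
by apply: na; rewrite E letter_lt.
Qed.

Lemma word_parent_ltR i : i < R -> word_parent i = i.-1.
Proof. by rewrite /word_parent => ->. Qed.

Lemma letter_between_lt i j m : i < R -> j < R -> m < R -> i <> j -> i <> m ->
  letter_between i j m <-> (j < i < m \/ m < i < j).
Proof.
by move=> iR jR mR; rewrite /letter_between !letter_lt // /coord_between; lia.
Qed.

Lemma word_parent_ge i : R <= i -> word_parent i = letter i.
Proof. by rewrite /word_parent /letter ltnNge => ->. Qed.

Lemma reduce_word k i : R <= k -> reduce word_parent k i = if i < k then i else letter i.
Proof.
move=> Rk; case: ltnP => ik; first exact: reduce_lt.
have R0 : 0 < R by apply: leq_ltn_trans (wR 0).
rewrite (reduce_ge word_parent_lt); last by lia.
have iR : (i < R) = false by lia.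
by rewrite /word_parent /letter iR reduce_lt //; have := wR (i - R); lia.
Qed.

Variables (T : Type) (L : T -> T -> T -> Prop) (c q : nat -> T).
Hypothesis Lsym : ternary_sym L.
Hypothesis Ldist : ternary_distinct L.
Hypothesis tw : twin_sequence L word_parent c q.

Let symE := L_symE Lsym.
Let gP := word_parent_lt.
Let R0 : 0 < R. Proof. by apply: leq_ltn_trans (wR 0). Qed.

Lemma past_qq k i : i < k -> past c q k.-1 (q i).
Proof. by move=> ik; apply: past_q; lia. Qed.

Lemma past_cc k i : i < k -> past c q k.-1 (c i).
Proof. by move=> ik; apply: past_c; lia. Qed.

Lemma L_c_q_q_word k i j : R <= k < R + N -> i < R + N -> j < R + N -> i <> j ->
  L (c k) (q i) (q j) <-> ~ (letter i = letter j /\ k <= rank i /\ k <= rank j).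
Proof.
move=> kP iP jP ij; have k0 : 0 < k by lia.
rewrite (L_c_q_q Lsym Ldist gP tw k0 ij) !reduce_word; [|lia..].
have := coordP i; have := coordP j.
by case: (ltnP i k) => ik; case: (ltnP j k) => jk; lia.
Qed.

Lemma L_q_q_c_word k i j : R <= k < R + N -> i < R + N -> j < R + N -> i <> j ->
  L (q i) (q j) (c k) <-> letter i = letter j /\ rank j < rank i /\ k <= rank j.
Proof.
move=> kP iP jP ij; have k0 : 0 < k by lia.
have [Rk kn] := andP kP.
have Ci := coordP i; have Cj := coordP j.
have low a b : a < k -> L (q a) (q b) (c k) <-> a <> b /\ (if b < k then b else letter b) = a.
  by move=> ak; rewrite (L_q_q_c Lsym gP tw b ak) reduce_word.
have late m : k <= i -> m < i -> L (q i) (q m) (c k) <->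
    letter i = letter m /\ R <= m /\ k <= m.
  move=> ki mi; have Cm := coordP m.
  have [Ek|nk] := eqVneq i k.
    rewrite Ek; split; last by lia.
    case: k {low} kP k0 Rk kn ki Ek => // k _ _ _ _ _ Ek /Lsym.
    by rewrite Ek in mi; move/(twin_apex_old (tw k) (past_q c q mi)).
  have lt : k < i by lia.
  have i0 : 0 < i by lia.
  rewrite (L_twin_old_old tw i0 (past_qq mi) (past_cc lt)) word_parent_ge; last by lia.
  by rewrite low; [case: (ltnP m k); lia|lia].
have [ik|ki] := ltnP i k; first by rewrite low //; case: (ltnP j k); lia.
have [ji|ij'|E] := ltngtP j i; last by lia.
  by rewrite late //; lia.
have j0 : 0 < j by lia.
rewrite (L_q_twin_x tw j0 ij' (past_cc (leq_ltn_trans ki ij'))) word_parent_ge; last by lia.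
by rewrite late //; [have := coordP (letter j); lia|lia].
Qed.

Lemma L_q_q_q_word i j m : i < R + N -> j < R + N -> m < R + N ->
  i <> j -> i <> m -> j <> m ->
  L (q i) (q j) (q m) <-> letter_between i j m.
Proof.
have [n] := ubnP (i + j + m); elim: n i j m => // n IH i j m le iP jP mP ij im jm.
have irr a b : ~ L (q a) (q b) (q b) by move=> /Ldist[].
have irl a b : ~ L (q a) (q a) (q b) by move=> /Ldist[].
have irm a b : ~ L (q a) (q b) (q a) by move=> /Ldist[].
(* the largest index is a twin, and may be replaced by its parent *)
have twin_first : j < i -> m < i -> L (q i) (q j) (q m) <-> letter_between i j m.
  move=> ji mi; have i0 : 0 < i by lia.
  rewrite (L_twin_old_old tw i0 (past_qq ji) (past_qq mi)).
  have [iR|Ri] := ltnP i R.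
    have jR := ltn_trans ji iR; have mR := ltn_trans mi iR.
    rewrite word_parent_ltR // letter_between_lt //.
    have pR : i.-1 < R by lia.
    have [<-|pj] := eqVneq i.-1 j; first by split=> [/irl//|]; lia.
    have [<-|pm] := eqVneq i.-1 m; first by split=> [/irm//|]; lia.
    rewrite IH; [|lia..]; rewrite letter_between_lt //; lia.
  have lR := letter_ltR i; rewrite word_parent_ge //.
  have rI := rank_ge Ri; have rP := rank_lt lR; have lP := letter_lt lR.
  have [Ej|pj] := eqVneq (letter i) j.
    rewrite -Ej; split=> [/irl//|].
    by rewrite /letter_between lP rP rI => /coord_between_below []; lia.
  have [Em|pm] := eqVneq (letter i) m.
    rewrite -Em; split=> [/irm//|]; rewrite /letter_between lP rP rI.
    by rewrite coord_betweenC => /coord_between_below []; lia.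
  rewrite IH; [|lia..]; rewrite /letter_between lP rP rI.
  have jE := @rank_twin j i ji (fun E => negP pj (introT eqP (esym E))).
  have mE := @rank_twin m i mi (fun E => negP pm (introT eqP (esym E))).
  by apply: coord_between_first; [move=> /jE ->|move=> /mE ->]; lia.
have twin_second a b : (a = j /\ b = m \/ a = m /\ b = j) -> i < a -> b < a ->
    L (q i) (q a) (q b) <-> letter_between i a b.
  move=> ab ia ba; have a0 : 0 < a by lia.
  rewrite (L_q_twin_x tw a0 ia (past_qq ba)) (q_eq tw).
  have [aR|Ra] := ltnP a R.
    have iR := ltn_trans ia aR; have bR := ltn_trans ba aR.
    rewrite word_parent_ltR // letter_between_lt //; [|lia..].
    have pR : a.-1 < R by lia.
    have [Ei|pi] := eqVneq a.-1 i.
      by rewrite Ei; split=> [[[_ nb]|/irl//]|]; [lia|left; lia].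
    have [Eb|pb] := eqVneq a.-1 b; first by rewrite Eb; split=> [[[]|/irr//]|]; lia.
    rewrite IH; [|lia..]; rewrite letter_between_lt //; lia.
  have lR := letter_ltR a; rewrite word_parent_ge //.
  have rA := rank_ge Ra; have rP := rank_lt lR; have lP := letter_lt lR.
  have [Ei|pi] := eqVneq (letter a) i.
    rewrite -Ei; split=> [_|_].
      rewrite /letter_between lP rP rA.
      have [E|E] := eqVneq (letter a) (letter b).
        have bE := @rank_twin b a ba; rewrite bE //; last lia.
        by right; right; right; right; do ?split=> //; lia.
      by right; right; left; do ?split=> //; [exact/eqP|lia].
    by left; split=> //; lia.
  have [Eb|pb] := eqVneq (letter a) b.
    rewrite Eb; split=> [[[]//|/irr//]|]; rewrite /letter_between -Eb lP rP rA.
    by move/coord_between_same => -[_]; have := coordP i; lia.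
  rewrite IH; [|lia..].
  have iE := @rank_twin i a ia (fun E => negP pi (introT eqP (esym E))).
  split=> [[[E _]|]|H]; [by rewrite E eqxx in pi| |right; move: H];
    rewrite /letter_between lP rP rA.
    by move/coord_between_second; apply=> E; rewrite iE //; lia.
  by move/coord_between_second; apply=> E; rewrite iE //; lia.
have [ji|nji] := ltnP (maxn j m) i; first by apply: twin_first; lia.
have [mj|jm'] := ltnP m j; first by apply: twin_second; lia.
rewrite (L_symE Lsym) /letter_between coord_betweenC.
by apply: twin_second; lia.
Qed.

Definition word_map (x : nat + nat) : T :=
  match x with inl k => c k | inr j => q j end.

Lemma wordL_P x y z : word_point x -> word_point y -> word_point z ->
  x <> y -> x <> z -> y <> z ->
  L (word_map x) (word_map y) (word_map z) <-> wordL x y z.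
Proof.
have neq (X Y : Type) (F : X -> Y) (a b : X) : F a <> F b -> a <> b.
  by move=> H E; apply: H; rewrite E.
case: x y z => [k|i] [k1|j] [k2|m] /= xP yP zP xy xz yz;
  try have := neq _ _ _ _ _ xy; try have := neq _ _ _ _ _ xz;
  try have := neq _ _ _ _ _ yz; move=> *.
- by apply: (L_c_c_c Lsym tw) => //; lia.
- by apply: (L_c_c_q Lsym gP tw) => //; lia.
- by rewrite symE; apply: (L_c_c_q Lsym gP tw) => //; lia.
- exact: L_c_q_q_word.
- by split=> // /(L_q_c_c Lsym Ldist gP tw); apply => //; lia.
- by rewrite symE; apply: L_q_q_c_word => //.
- exact: L_q_q_c_word.
exact: L_q_q_q_word.
Qed.

Lemma word_map_inj x y : word_point x -> word_point y -> word_map x = word_map y -> x = y.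
Proof.
case: x y => [k|i] [k1|j] /= xP yP E.
- by rewrite (c_inj tw _ _ E) //; lia.
- by have k0 : 0 < k by [lia]; case: (c_neq_q tw k0 E).
- by have k0 : 0 < k1 by [lia]; case: (c_neq_q tw k0 (esym E)).
by rewrite (q_inj tw E).
Qed.

End Word.

(** If [l2 <> ld], then 1 and 3 have to be on the other side of [d], or at [d], so
    that 2 is not between them. *)
Lemma coord_between_on ld rd l1 r1 l2 r2 l3 r3 :
  coord_between ld rd l1 r1 l2 r2 -> coord_between ld rd l2 r2 l3 r3 ->
  coord_between l2 r2 l1 r1 l3 r3 -> l2 = ld.
Proof.
move=> H12 H23 H2; have [//|ne] := eqVneq l2 ld; exfalso.
have : (l2 < ld /\ ld <= l1 /\ ld <= l3) \/ (ld < l2 /\ l1 <= ld /\ l3 <= ld).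
  have [l|l] : l2 < ld \/ ld < l2 by lia.
    by left; move: H12 H23; rewrite /coord_between; clear H2; lia.
  by right; move: H12 H23; rewrite /coord_between; clear H2; lia.
by move: H2; rewrite /coord_between; clear; lia.
Qed.

(** No point [d] given by its coordinates can take the part of an apex over four
    points in linear betweenness: by [coord_between_on] it would have the letter
    of both inner points 2 and 3, so that these would be compared by their ranks,
    in opposite directions in the triples 1, 2, 3 and 2, 3, 4. *)
Lemma coord_between_four ld rd l1 r1 l2 r2 l3 r3 l4 r4 :
  coord_between ld rd l1 r1 l2 r2 -> coord_between ld rd l2 r2 l3 r3 ->
  coord_between ld rd l3 r3 l4 r4 ->
  coord_between l2 r2 l1 r1 l3 r3 -> coord_between l3 r3 l2 r2 l4 r4 -> False.
Proof.
move=> H12 H23 H34 H2 H3.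
have E2 := coord_between_on H12 H23 H2.
have E3 := coord_between_on H23 H34 H3.
have E : l2 = l3 by rewrite E2 E3.
have lt : r3 < r2 by move: H2; rewrite /coord_between E; clear; lia.
have gt : r2 < r3 by move: H3; rewrite /coord_between E; clear; lia.
lia.
Qed.

Section WordEmbedding.
Variables (R N : nat) (w : nat -> nat) (R' N' : nat) (w' : nat -> nat).
Hypothesis wR : forall t, w t < R.
Hypothesis wR' : forall t, w' t < R'.
Hypothesis R5 : 4 < R.
Variable f : nat + nat -> nat + nat.
Hypothesis f_point : forall x, word_point R N x -> word_point R' N' (f x).
Hypothesis fL : forall x y z, word_point R N x -> word_point R N y -> word_point R N z ->
  x <> y -> x <> z -> y <> z -> wordL R N w x y z -> wordL R' N' w' (f x) (f y) (f z).

Let letter_inr i j : i <> j -> inr i <> inr j :> nat + nat.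
Proof. by move=> H [E]. Qed.

(** An apex lies between any two letters.  If it were mapped to another kind of
    point, then at most one letter could go to an apex, as such a point never lies
    between two apexes; four of any five letters would thus contradict
    [coord_between_four]. *)
Lemma embedding_apex k : R <= k < R + N -> exists a, f (inl k) = inl a.
Proof.
move=> kP; case Ek : (f (inl k)) => [a|d]; first by exists a.
have centre i j : i < R -> j < R -> i <> j ->
    wordL R' N' w' (inr d) (f (inr i)) (f (inr j)).
  move=> iR jR ij; rewrite -Ek; apply: fL => //=; try lia; try exact: letter_inr.
  by rewrite (letter_lt w iR) (letter_lt w jR) => -[].
have middle i j m : i < j -> j < m -> m < R ->
    wordL R' N' w' (f (inr j)) (f (inr i)) (f (inr m)).
  move=> ij jm mR; apply: fL => /=; try lia; try (apply: letter_inr; lia).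
  by apply/letter_between_lt; lia.
(* at most one of the letters is mapped to an apex *)
have apexes i j : i < R -> j < R -> i <> j ->
    (exists y, f (inr i) = inr y) \/ (exists y, f (inr j) = inr y).
  move=> iR jR ij; have := centre i j iR jR ij.
  by case: (f (inr i)) => [?|y]; case: (f (inr j)) => [?|y']//= _;
    [right; exists y'|left; exists y|left; exists y].
have four i1 i2 i3 i4 : i1 < i2 -> i2 < i3 -> i3 < i4 -> i4 < R ->
    (exists y, f (inr i1) = inr y) -> (exists y, f (inr i2) = inr y) ->
    (exists y, f (inr i3) = inr y) -> (exists y, f (inr i4) = inr y) -> False.
  move=> i12 i23 i34 i4R [y1 E1] [y2 E2] [y3 E3] [y4 E4].
  have := centre i1 i2; have := centre i2 i3; have := centre i3 i4.
  have := middle i1 i2 i3; have := middle i2 i3 i4.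
  rewrite E1 E2 E3 E4 /= => M3 M2 C3 C2 C1.
  by apply: (coord_between_four (C1 _ _ _) (C2 _ _ _) (C3 _ _ _) (M2 _ _ _) (M3 _ _ _)); lia.
have lt i : i < 5 -> i < R by lia.
have bad i : (exists y, f (inr i) = inr y) \/ ~ (exists y, f (inr i) = inr y).
  exact: EM.
exfalso.
have others i j : i < 5 -> j < 5 -> i <> j -> ~ (exists y, f (inr i) = inr y) ->
    exists y, f (inr j) = inr y.
  by move=> i5 j5 ij ni; case: (apexes i j (lt _ i5) (lt _ j5) ij).
case: (bad 0) => [H0|H0]; last by apply: (four 1 2 3 4); try lia; apply: others H0.
case: (bad 1) => [H1|H1]; last by apply: (four 0 2 3 4); try lia; apply: others H1.
case: (bad 2) => [H2|H2]; last by apply: (four 0 1 3 4); try lia; apply: others H2.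
case: (bad 3) => [H3|H3]; last by apply: (four 0 1 2 4); try lia; apply: others H3.
by apply: (four 0 1 2 3) => //; lia.
Qed.

(** The twin created at position [t] is recognised by the apexes: those of index at
    most [R + t] do not tell it from its letter, and the others do.  The image has
    the same form, the threshold being its position. *)
Lemma embedding_position t : t < N -> exists u x,
  [/\ u < N', f (inr (w t)) = inr x, letter R' w' x = w' u,
      (forall k a, R <= k < R + N -> f (inl k) = inl a ->
         (a <= R' + u) = (k <= R + t))
    & R' + u < rank R' N' x].
Proof.
move=> tN; have RP : R <= R < R + N by lia.
have [a Ea] := embedding_apex RP.
have wtR := wR t.
have eE : letter R w (R + t) = w t by rewrite /letter ltnNge leq_addr /= addKn.
have eR : rank R N (R + t) = R + t by rewrite rank_ge // leq_addr.
have JE := letter_lt w wtR; have JR := rank_lt N wtR.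
have e_ne : inr (w t) <> inr (R + t) :> nat + nat by apply: letter_inr; lia.
have below k : R <= k <= R + t ->
    wordL R' N' w' (f (inr (w t))) (f (inr (R + t))) (f (inl k)).
  by move=> kP; apply: fL => //=; [lia|lia|lia|rewrite eE eR JE JR; lia].
have above k : R + t < k < R + N ->
    wordL R' N' w' (f (inl k)) (f (inr (w t))) (f (inr (R + t))).
  by move=> kP; apply: fL => //=; [lia|lia|lia|rewrite eE eR JE JR; lia].
have [y [yR yt]] : exists y, y < R /\ y <> w t.
  by have [->|] := eqVneq (w t) 0; [exists 1; lia|exists 0; lia].
have other : wordL R' N' w' (f (inl R)) (f (inr (w t))) (f (inr y)).
  apply: fL => //=; [lia|lia|apply: letter_inr; lia|].
  by rewrite JE (letter_lt w yR); lia.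
case Ex : (f (inr (w t))) => [b|x].
  have := below R; rewrite Ex Ea => /(_ _) H.
  move: other; rewrite Ex Ea => O.
  have ba : b < a by case: (f (inr y)) O => [? []|?].
  by case: (f (inr (R + t))) H => [b'|y'] /= H; have := H ltac:(lia); lia.
case Ey : (f (inr (R + t))) => [b|z].
  by have := below R; rewrite Ex Ey Ea /= => H; case: H; lia.
have [ll [rk ak]] : letter R' w' x = letter R' w' z /\ rank R' N' z < rank R' N' x /\
    a <= rank R' N' z.
  by have := below R; rewrite Ex Ey Ea /=; apply; lia.
have zP : z < R' + N' by have := @f_point (inr (R + t)); rewrite Ey /=; apply; lia.
have zR : R' <= z.
  rewrite leqNgt; apply/negP => zR; move: rk; rewrite (rank_lt N' zR).
  by have := coordP N' wR' x; have := @f_point (inr (w t)); rewrite Ex /=; lia.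
have zE := rank_ge N' zR.
exists (z - R'), x; rewrite subnKC //; split=> //; first by lia.
- by rewrite ll /letter ltnNge zR.
- move=> k b kP Ek; apply/idP/idP => [bz|kt].
    rewrite leqNgt; apply/negP => kt; have := above k.
    by rewrite Ek Ex Ey /= => /(_ _) H; apply: H; lia.
  have := below k; rewrite Ek Ex Ey /= => H.
  by have := H ltac:(lia); lia.
by rewrite -zE.
Qed.

(** The apex of index [R + t] separates the position [t] from the earlier ones, and
    the apex of index [R] separates the letters. *)
Lemma word_embedding : exists psi : nat -> nat,
  [/\ forall t, t < N -> psi t < N',
      forall s t, s < t -> t < N -> psi s < psi t
    & forall s t, s < N -> t < N -> (w s == w t) = (w' (psi s) == w' (psi t))].
Proof.
have /choice[psi psiP] : forall t, exists u, t < N -> exists x,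
  [/\ u < N', f (inr (w t)) = inr x, letter R' w' x = w' u,
      (forall k a, R <= k < R + N -> f (inl k) = inl a ->
         (a <= R' + u) = (k <= R + t))
    & R' + u < rank R' N' x].
  move=> t; have [tN|Nt] := ltnP t N; last by exists 0; rewrite ltnNge => /negP[].
  by have [u [x H]] := embedding_position tN; exists u => _; exists x.
exists psi; split.
- by move=> t tN; have [x []] := psiP t tN.
- move=> s t st tN.
  have [x [_ _ _ Ht _]] := psiP t tN; have [y [_ _ _ Hs _]] := psiP s (ltn_trans st tN).
  have kP : R <= R + t < R + N by lia.
  have [a Ea] := embedding_apex kP.
  by have := Ht _ _ kP Ea; have := Hs _ _ kP Ea; lia.
move=> s t sN tN.
have [x [_ Ex lx Hx rx]] := psiP s sN; have [y [_ Ey ly Hy ry]] := psiP t tN.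
rewrite -lx -ly; apply/eqP/eqP => [E|E].
  by move: Ey; rewrite -E Ex => -[->].
have [//|/eqP ne] := eqVneq (w s) (w t); exfalso.
have kP : R <= R < R + N by lia.
have [a Ea] := embedding_apex kP.
have := @fL (inl R) (inr (w s)) (inr (w t)).
rewrite Ea Ex Ey /= (letter_lt w (wR s)) (letter_lt w (wR t)) => H.
have hx := Hx _ _ kP Ea; have hy := Hy _ _ kP Ea.
have ws := wR s; have wt := wR t.
by apply: H => //; try exact: letter_inr; lia.
Qed.

End WordEmbedding.

Import GRing.Theory Num.Theory numFieldNormedType.Exports.

(** The finite configuration of a word of length [N]: its [N] apexes, the [R]
    letters and the [N] twins.  Only apexes from index [R] on, for which the
    letters are distinct, are taken. *)
Definition word_index (R N : nat) (x : 'I_N + 'I_(R + N)) : nat + nat :=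
  match x with inl i => inl (R + i) | inr j => inr (val j) end.

Lemma word_index_inj R N : injective (@word_index R N).
Proof.
by move=> [i|j] [i'|j'] //= [E]; [congr inl|congr inr]; apply: val_inj => //=; lia.
Qed.

Lemma word_index_point R N x : word_point R N (@word_index R N x).
Proof. by case: x => [i|j] /=; [have := ltn_ord i|have := ltn_ord j]; lia. Qed.

Lemma word_pointP R N x : word_point R N x -> exists y, x = @word_index R N y.
Proof.
case: x => [k|j] /= xP.
  have kN : k - R < N by lia.
  by exists (inl (Ordinal kN)) => /=; congr inl; lia.
by exists (inr (Ordinal xP)).
Qed.

Definition word_copy (T : Type) (L : T -> T -> T -> Prop) (R N : nat) (w : nat -> nat)
    (h : 'I_N + 'I_(R + N) -> T) : Prop :=
  injective h /\ forall x y z, x <> y -> x <> z -> y <> z ->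
    (L (h x) (h y) (h z) <->
     wordL R N w (word_index x) (word_index y) (word_index z)).

Arguments word_copy {T} L R N w h.

Lemma word_copy_exists (T : Type) (L : T -> T -> T -> Prop) R N w :
  twin_structure L -> (forall t, w t < R) -> exists h, word_copy L R N w h.
Proof.
move=> Ltwin wR; have [_ Lsym Ldist _] := Ltwin.
have [c [q tw]] := twin_sequence_exists Ltwin (word_parent_lt wR).
exists (word_map c q \o @word_index R N); split.
  move=> x y /(word_map_inj wR tw (word_index_point x) (word_index_point y)).
  exact: word_index_inj.
move=> x y z xy xz yz.
by apply: (wordL_P wR Lsym Ldist tw); try exact: word_index_point;
  move/(@word_index_inj _ _).
Qed.

Lemma word_copy_embedding (T : Type) (L : T -> T -> T -> Prop) R N w h R' N' w' h'
    (phi : 'I_N + 'I_(R + N) -> 'I_N' + 'I_(R' + N')) :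
  (forall t, w t < R) -> (forall t, w' t < R') -> 4 < R ->
  word_copy L R N w h -> word_copy L R' N' w' h' -> injective phi ->
  (forall x y z, L (h x) (h y) (h z) -> L (h' (phi x)) (h' (phi y)) (h' (phi z))) ->
  exists psi : nat -> nat,
  [/\ forall t, t < N -> psi t < N',
      forall s t, s < t -> t < N -> psi s < psi t
    & forall s t, s < N -> t < N -> (w s == w t) = (w' (psi s) == w' (psi t))].
Proof.
move=> wR wR' R5 [hI hL] [h'I h'L] phiI phiL.
have /choice[f fP] : forall x : nat + nat, exists y : nat + nat,
    forall a, x = @word_index R N a -> y = @word_index R' N' (phi a).
  move=> x; have [[a ->]|H] := EM (exists a, x = @word_index R N a).
    by exists (word_index (phi a)) => b /(@word_index_inj _ _) ->.
  by exists x => a E; case: H; exists a.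
apply: (@word_embedding R N w R' N' w' wR wR' R5 f).
  by move=> _ /word_pointP[a ->]; rewrite (fP _ a erefl); exact: word_index_point.
move=> _ _ _ /word_pointP[a ->] /word_pointP[b ->] /word_pointP[d ->] ab ad bd.
have neq (u v : 'I_N + 'I_(R + N)) : word_index u <> word_index v -> u <> v.
  by move=> H E; apply: H; rewrite E.
move=> H; rewrite (fP _ a erefl) (fP _ b erefl) (fP _ d erefl).
have {}ab := neq _ _ ab; have {}ad := neq _ _ ad; have {}bd := neq _ _ bd.
have ne u v : u <> v -> phi u <> phi v by move=> uv /phiI.
exact: (h'L _ _ _ (ne _ _ ab) (ne _ _ ad) (ne _ _ bd)).1
  (phiL _ _ _ ((hL _ _ _ ab ad bd).2 H)).
Qed.

(** * Growth *)

Section Growth.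
Variable r : nat.

(** The first half of the word names the letters, so that the pattern of the word
    determines the permutation. *)
Definition perm_word (sigma : {perm 'I_r}) (t : nat) : nat :=
  if t < r then t
  else if insub (t - r) is Some i then val (sigma i) else 0.

Lemma perm_word_lt sigma t R : r < R -> perm_word sigma t < R.
Proof.
rewrite /perm_word => rR; case: ifP => [tr|_]; first exact: ltn_trans tr rR.
by case: insubP => [i _ _|_]; [apply: ltn_trans (ltn_ord _) rR|lia].
Qed.

Lemma increasing_id (psi : nat -> nat) n :
  (forall t, t < n -> psi t < n) -> (forall s t, s < t -> t < n -> psi s < psi t) ->
  forall t, t < n -> psi t = t.
Proof.
move=> psin psiI.
have ge t : t < n -> t <= psi t.
  by elim: t => // t IH tn; have := psiI t t.+1; have := IH (ltnW tn); lia.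
have le m t : t + m < n -> psi t + m <= psi (t + m).
  elim: m => [|m IH] tm; first by rewrite !addn0.
  by have := IH ltac:(lia); have := psiI (t + m) (t + m.+1); lia.
move=> t tn; have := ge t tn; have := le (n.-1 - t) t; have := psin n.-1.
rewrite subnKC; last by lia.
lia.
Qed.

Lemma perm_word_inj sigma sigma' (psi : nat -> nat) :
  (forall t, t < r + r -> psi t < r + r) ->
  (forall s t, s < t -> t < r + r -> psi s < psi t) ->
  (forall s t, s < r + r -> t < r + r -> (perm_word sigma s == perm_word sigma t) =
     (perm_word sigma' (psi s) == perm_word sigma' (psi t))) ->
  sigma = sigma'.
Proof.
move=> psin psiI psiE; have id := increasing_id psin psiI.
have early s t : t < r -> perm_word s t = t by rewrite /perm_word => ->.
have late s (i : 'I_r) : perm_word s (r + i) = s i.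
  rewrite /perm_word ltnNge leq_addr /= addKn.
  by case: insubP => [j _ /val_inj ->//|]; rewrite ltn_ord.
apply/permP => i; apply: val_inj.
have lt1 := ltn_ord i; have lt2 := ltn_ord (sigma i).
have := psiE (r + i) (sigma i); rewrite !id; [|lia..].
rewrite !late !early // eqxx => H.
by have /esym/eqP := H ltac:(lia) ltac:(lia).
Qed.

End Growth.

Lemma counting_ge (R : realType) (X : choiceType) (S : set X) (I : finType)
    (F : I -> X) :
  injective F -> (forall i, S (F i)) -> ((#|I|%:R)%:E <= counting S :> \bar R)%E.
Proof.
move=> FI FS; rewrite /counting; case: ifPn => [/asboolP Sfin|_]; last exact: leey.
rewrite lee_fin ler_nat.
rewrite cardE -(size_map F); apply: uniq_leq_size.
  by rewrite map_inj_uniq // enum_uniq.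
by move=> _ /mapP[i _ ->]; rewrite in_fset_set //; apply/mem_set.
Qed.

(** The terms of the exponential series at [c ^+ 5] tend to 0. *)
Lemma factorial_super_exponential (R : realType) (c : R) : (1 < c)%R ->
  exists K, forall r, K <= r -> (c ^+ 10 * (c ^+ 5) ^+ r < r`!%:R)%R.
Proof.
move=> c1; have c0 : (0 < c)%R by apply: lt_trans c1; exact: ltr01.
have /cvg_series_cvg_0 := is_cvg_series_exp_coeff (c ^+ 5).
move/cvgrPdist_lt => /(_ (c ^+ 10)^-1%R).
rewrite invr_gt0 exprn_gt0 // => /(_ isT)[K _ KP]; exists K => r Kr.
have := KP r Kr; rewrite /= sub0r normrN /exp_coeff /=.
have f0 : (0 < r`!%:R :> R)%R by rewrite ltr0n fact_gt0.
rewrite ger0_norm; last by rewrite divr_ge0 ?exprn_ge0 // ltW.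
by rewrite ltr_pdivrMr // ltr_pdivlMl ?exprn_gt0.
Qed.

Section Consequences.
Variables (Lg : language) (s : Lg) (ar : arity s = 3).
Variables (T : Type) (M : structure Lg T).
Hypothesis Mtwin : twin_structure (ternary ar M).

Lemma card_word_copy R N w (h : 'I_N + 'I_(R + N) -> T) k :
  word_copy (ternary ar M) R N w h -> R + N + N = k -> range h #= `I_k.
Proof.
move=> [hI _] <-; apply: card_eq_trans (inj_card_eq (in2W hI)) _.
rewrite (_ : R + N + N = #|{: 'I_N + 'I_(R + N)}|); last by rewrite card_sum !card_ord addnC.
apply/card_set_bijP; exists (fun x => val (enum_rank x)); split.
- by move=> x _ /=; exact: ltn_ord.
- by move=> x y _ _ /val_inj /enum_rank_inj.
by move=> m /= mP; exists (enum_val (Ordinal mP)); rewrite // enum_valK.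
Qed.

(** Words of length [2 * r] over [k - 4 * r] letters have configurations of size
    [k], whatever the remainder of [k]; the letters beyond the first [r] do not
    occur.  An automorphism taking one configuration to another preserves the
    pattern of the word, as an increasing self-map of the positions is the
    identity. *)
Lemma factorial_orbits (R : realType) r k : 4 < k - 4 * r -> r < k - 4 * r ->
  ((r`!%:R)%:E <= orbit_growth R (Aut M) k)%E.
Proof.
set m := k - 4 * r => m4 rm.
have /choice[h hP] : forall sigma : {perm 'I_r}, exists h,
    word_copy (ternary ar M) m (r + r) (perm_word sigma) h.
  by move=> sigma; apply: word_copy_exists Mtwin _ => t; exact: perm_word_lt.
rewrite -card_Sn; apply: (@counting_ge R _ _ _
  (fun sigma => [set g @` range (h sigma) | g in Aut M])); last first.
  move=> sigma; exists (range (h sigma)) => //=.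
  by apply: card_word_copy (hP sigma) _; lia.
move=> sigma sigma' E.
have [g gA gE] : [set g @` range (h sigma) | g in Aut M] (range (h sigma')).
  by rewrite E; exists id; [exact: isomorphism_id|rewrite image_id].
have /choice[phi phiP] : forall x, exists y, h sigma' y = g (h sigma x).
  move=> x; have : (g @` range (h sigma)) (g (h sigma x)).
    by exists (h sigma x) => //; exists x.
  by rewrite gE => -[y _ Ey]; exists y.
have [_ gEm] := gA; have [gI _] := gEm.
have [] := @word_copy_embedding _ _ _ _ _ _ _ _ _ _ phi
  (fun t => perm_word_lt sigma t rm) (fun t => perm_word_lt sigma' t rm) m4 (hP sigma) (hP sigma').
- move=> x y xy; have [hI _] := hP sigma; apply: hI; apply: gI.
  by rewrite -!phiP xy.
- move=> x y z; rewrite !phiP.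
  by move=> H; apply/(ternary_embedding ar gEm).
by move=> psi [H1 H2 H3]; exact: perm_word_inj H1 H2 H3.
Qed.

Lemma Aut_super_exponential (R : realType) : super_exponential (orbit_growth R (Aut M)).
Proof.
move=> c c1; have [K KP] := factorial_super_exponential c1.
exists (5 * K + 25) => k kK.
have c0 : (0 < c)%R by apply: lt_trans c1; exact: ltr01.
pose r := (k %/ 5).-1.
have [kr1 kr2] : 5 * r + 5 <= k /\ k < 5 * r + 10.
  by rewrite /r; have := divn_eq k 5; have := ltn_pmod k (isT : 0 < 5); lia.
apply: lt_le_trans (@factorial_orbits R r k _ _); [|lia|lia].
rewrite lte_fin; apply: le_lt_trans (KP r _); last by lia.
rewrite -exprM -exprD; apply: ler_weXn2l; [exact: ltW|lia].
Qed.

End Consequences.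

(** * Antichain *)

(** The word [0 0 1 0 2 1 3 2 4 3 ...] of length [2 * n + 4], in which [i] occurs at
    the places [2 * i] and [2 * i + 3], and moreover [0] at [1] and [n] at
    [2 * n + 2]. *)
Definition zigzag (n t : nat) : nat :=
  minn n (if odd t then (t - 3)./2 else t./2).

Lemma zigzag_le n t : zigzag n t <= n. Proof. exact: geq_minl. Qed.

Lemma zigzag_even n i : i <= n -> zigzag n (2 * i) = i.
Proof. by move=> i_n; rewrite /zigzag mul2n odd_double doubleK; exact/minn_idPr. Qed.

Lemma zigzag_odd n i : i <= n -> zigzag n (2 * i + 3) = i.
Proof.
move=> i_n; rewrite /zigzag oddD mul2n odd_double /= addnK doubleK.
exact/minn_idPr.
Qed.

Lemma zigzag_letter n i t : i < n -> zigzag n t = i ->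
  t = 2 * i \/ t = 2 * i + 3 \/ (i = 0 /\ t = 1).
Proof.
move=> i_n; have := odd_double_half t; have := odd_double_half (t - 3).
rewrite /zigzag; case: (boolP (odd t)) => ot; last by lia.
have [t3|t3] := leqP 3 t; first by rewrite oddB // ot /=; lia.
by case: t ot t3 => [|[|[|t]]] //= _ _; rewrite ?minn0 => *; lia.
Qed.

Lemma zigzag_last n t : zigzag n t = n -> 0 < n -> t < 2 * n + 4 ->
  t = 2 * n \/ t = 2 * n + 2 \/ t = 2 * n + 3.
Proof.
have := odd_double_half t; have := odd_double_half (t - 3).
rewrite /zigzag; case: (boolP (odd t)) => ot; last by lia.
have [t3|t3] := leqP 3 t; first by rewrite oddB // ot /=; lia.
by case: t ot t3 => [|[|[|t]]] //= _ _; rewrite ?minn0 => *; lia.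
Qed.

(** A pattern embedding fixes the initial places, because the first letter is
    tripled; then each letter in turn is forced, its second occurrence being
    squeezed in just behind the first occurrence of the next one. *)
Lemma zigzag_antichain n m (psi : nat -> nat) : 0 < n -> 0 < m ->
  (forall t, t < 2 * n + 4 -> psi t < 2 * m + 4) ->
  (forall s t, s < t -> t < 2 * n + 4 -> psi s < psi t) ->
  (forall s t, s < 2 * n + 4 -> t < 2 * n + 4 ->
     (zigzag n s == zigzag n t) = (zigzag m (psi s) == zigzag m (psi t))) ->
  n = m.
Proof.
move=> n0 m0 psim psiI psiE.
have ge t : t < 2 * n + 4 -> t <= psi t.
  by elim: t => // t IH tn; have := psiI t t.+1; have := IH (ltnW tn); lia.
have [nm|mn|//] := ltngtP n m; last first.
  by have := ge (2 * n + 3); have := psim (2 * n + 3); lia.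
have same s t : s < 2 * n + 4 -> t < 2 * n + 4 -> zigzag n s = zigzag n t ->
    zigzag m (psi s) = zigzag m (psi t).
  by move=> sn tn E; apply/eqP; rewrite -psiE // E.
have z0 : zigzag n 0 = 0 := zigzag_even (leq0n n).
have z1 : zigzag n 1 = 0 by rewrite /zigzag /= minn0.
have z3 : zigzag n 3 = 0 := zigzag_odd (leq0n n).
(* the tripled first letter can only go to the tripled first letter *)
have [p0 [p1 p3]] : psi 0 = 0 /\ psi 1 = 1 /\ psi 3 = 3.
  have E1 := same 0 1 ltac:(lia) ltac:(lia) (etrans z0 (esym z1)).
  have E3 := same 0 3 ltac:(lia) ltac:(lia) (etrans z0 (esym z3)).
  have I1 := psiI 0 1 isT ltac:(lia); have I3 := psiI 1 3 isT ltac:(lia).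
  have [lt|ge_m] := ltnP (zigzag m (psi 0)) m.
    have := zigzag_letter lt erefl; have := zigzag_letter lt (esym E1).
    have := zigzag_letter lt (esym E3); lia.
  have E : zigzag m (psi 0) = m by have := zigzag_le m (psi 0); lia.
  have := zigzag_last E m0 (psim 0 ltac:(lia)).
  have := zigzag_last (etrans (esym E1) E) m0 (psim 1 ltac:(lia)).
  have := zigzag_last (etrans (esym E3) E) m0 (psim 3 ltac:(lia)).
  have := psiI 3 4 isT ltac:(lia); have := psim 4 ltac:(lia); lia.
have id i : i <= n -> forall t, t <= 2 * i + 3 -> psi t = t.
  elim: i => [_ t t3|i IH i_n t ti].
    have p2 : psi 2 = 2.
      by have := psiI 1 2 isT ltac:(lia); have := psiI 2 3 isT ltac:(lia); lia.
    by case: t t3 => [|[|[|[|t]]]] //; lia.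
  have {}IH := IH (ltnW i_n).
  have [ti'|ti'] := leqP t (2 * i + 3); first exact: IH.
  have E2 : psi (2 * i.+1) = 2 * i.+1 by apply: IH; lia.
  have E3 := IH (2 * i + 3) (leqnn _).
  have E := same (2 * i.+1) (2 * i.+1 + 3) ltac:(lia) ltac:(lia)
    (etrans (zigzag_even i_n) (esym (zigzag_odd i_n))).
  rewrite E2 zigzag_even in E; last by lia.
  have im : i.+1 < m by lia.
  have := zigzag_letter im (esym E).
  have := psiI (2 * i + 3) (2 * i + 4) ltac:(lia) ltac:(lia).
  have := psiI (2 * i + 4) (2 * i.+1 + 3) ltac:(lia) ltac:(lia).
  have [->|ne] := eqVneq t (2 * i + 4); first by lia.
  have -> : t = 2 * i.+1 + 3 by lia.
  lia.
(* the tripled last letter is only doubled in the longer word *)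
have zn : zigzag n (2 * n + 2) = n.
  have -> : 2 * n + 2 = 2 * n.+1 by lia.
  by rewrite /zigzag mul2n odd_double doubleK; lia.
have := same (2 * n) (2 * n + 2) ltac:(lia) ltac:(lia) _.
rewrite zigzag_even // zn => /(_ erefl).
rewrite !(id n (leqnn n)); [|lia..].
have -> : 2 * n + 2 = 2 * n.+1 by lia.
rewrite !zigzag_even; lia.
Qed.

Section NotWqo.
Variables (Lg : language) (s : Lg) (ar : arity s = 3).
Variables (T : Type) (M : structure Lg T).
Hypothesis Mtwin : twin_structure (ternary ar M).

Lemma Age_not_wqo : ~ wqo (Age M) (@embeds Lg).
Proof.
move=> [H _]; apply: H.
pose n i := i.+1.
have zR i t : zigzag (n i) t < n i + 5 by have := zigzag_le (n i) t; lia.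
have ex i : exists h,
    word_copy (ternary ar M) (n i + 5) (2 * n i + 4) (zigzag (n i)) h.
  exact: word_copy_exists Mtwin (zR i).
pose h i := projT1 (cid (ex i)).
have hP i : word_copy (ternary ar M) (n i + 5) (2 * n i + 4) (zigzag (n i)) (h i).
  exact: projT2 (cid (ex i)).
pose a i : finite_structure Lg :=
  @FiniteStructure Lg ('I_(2 * n i + 4) + 'I_(n i + 5 + (2 * n i + 4)))%type
    (fun r x => @M r (map_tuple (h i) x)).
have aE i : embedding (fs_str (a i)) M (h i) by split=> //; exact: (hP i).1.
exists a; split=> [i|i j ij [f fE]]; first by exists (h i).
apply: ij; suff : n i = n j by case.
have [] := @word_copy_embedding _ _ _ _ _ _ _ _ _ _ f (zR i) (zR j) _ (hP i) (hP j).
- by rewrite /n; lia.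
- exact: fE.1.
- move=> x y z /(ternary_embedding ar (aE i)) H.
  by apply/(ternary_embedding ar (aE j)); apply/(ternary_embedding ar fE).
by move=> psi [H1 H2 H3]; exact: zigzag_antichain H1 H2 H3.
Qed.

End NotWqo.

(** * Conclusion *)
Theorem theorem1p3 (R : realType) :
  (forall (T : Type) (M1 : structure LB1 T), is_MB1 M1 ->
    [/\ ~ monadically_NIP (MB2 M1),
        super_exponential (orbit_growth R (Aut (MB2 M1))) &
        ~ wqo (Age (MB2 M1)) (@embeds LB2)]) /\
  (forall (T : Type) (M1 : structure LD1 T), is_MD1 M1 ->
    [/\ ~ monadically_NIP (MD2 M1),
        super_exponential (orbit_growth R (Aut (MD2 M1))) &
        ~ wqo (Age (MD2 M1)) (@embeds LD2)]).
Proof.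
split=> T M1.
  move=> /MB1_twin_structure Mtwin.
  have tw : twin_structure (ternary (erefl : @arity LB2 (B2 BL) = 3) (MB2 M1)) := Mtwin.
  split; [exact: not_monadically_NIP tw|exact: Aut_super_exponential tw R|].
  exact: Age_not_wqo tw.
move=> /MD1_twin_structure Mtwin.
have tw : twin_structure (ternary (erefl : @arity LD2 (D2 DL) = 3) (MD2 M1)) := Mtwin.
split; [exact: not_monadically_NIP tw|exact: Aut_super_exponential tw R|].
exact: Age_not_wqo tw.
Qed.
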